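(* Let $\Omega\subset\mathbb{R}^N$ be an open connected set with $|\Omega|<\infty$. Let $1<p<\infty$ and $1<q\le p$. Let $H:\mathbb{R}^N\to[0,\infty)$ be a $C^1$ convex $p$-homogeneous function such that, for some $C\ge 1$, \[ \frac{1}{C}\, |z|^p\le H(z)\le C\, |z|^p,\qquad z\in\mathbb{R}^N . \] Let \[ \lambda_{p,q}(\Omega)=\min_{w\in W^{1,p}_0(\Omega)}\left\{\int_\Omega H(\nabla w)\, dx\, :\, \|w\|_{L^q(\Omega)}=1\right\}. \] Let $\lambda>0$ be such that there exists a nontrivial function $u\in W^{1,p}_0(\Omega)$ with $u\ge 0$ in $\Omega$ which is a weak solution of \[ -\frac{1}{p}\,\mathrm{div}\, \nabla H(\nabla u)=\lambda\, u^{q-1}\quad \text{in }\Omega. \] Then \[ \lambda\, \left(\int_\Omega |u|^q\, dx\right)^\frac{q-p}{q}=\lambda_{p,q}(\Omega), \] and $v=u\,\|u\|_{L^q(\Omega)}^{-1}$ is a minimizer of the variational problem defining $\lambda_{p,q}(\Omega)$.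
   Context: $W^{1,p}_0(\Omega)$ denotes the closure of $C^\infty_0(\Omega)$ with respect to the $L^p$ norm of the gradient. $p$-homogeneous means $H(\lambda z)=|\lambda|^pH(z)$ for all $z\in\mathbb{R}^N$ and $\lambda\in\mathbb{R}$ (so $H$ is even). Weak solution means \[ \frac1p\int_\Omega\langle\nabla H(\nabla u),\nabla\varphi\rangle\,dx=\lambda\int_\Omega u^{q-1}\varphi\,dx\qquad\text{for every }\varphi\in W^{1,p}_0(\Omega). \] *)

(* Defs.v *)
From HB Require Import structures.
From mathcomp Require Import all_boot all_order all_algebra.
From mathcomp Require Import all_classical all_reals all_analysis.
From mathcomp Require Import lra.

Set Implicit Arguments.
Unset Strict Implicit.
Unset Printing Implicit Defensive.
Import Order.TTheory GRing.Theory Num.Theory.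
Import numFieldTopology.Exports numFieldNormedType.Exports.

Local Open Scope classical_set_scope.
Local Open Scope ring_scope.

Definition rV_display : measure_display. Proof. exact. Qed.

Section rV_measurable.
Variables (R : realType) (N : nat).

(* Product sigma-algebra, as the library does for n.-tuple; it contains the
   open sets, see [open_measurable_rV]. *)
Let coord : 'I_N -> 'rV[R]_N -> measurableTypeR R := fun i x => x ord0 i.

Let rV_set0 : g_sigma_preimage coord set0.
Proof. exact: sigma_algebra0. Qed.

Let rV_setC A : g_sigma_preimage coord A -> g_sigma_preimage coord (~` A).
Proof. exact: sigma_algebraC. Qed.

Let rV_bigcup (F : (set 'rV[R]_N)^nat) :
  (forall i, g_sigma_preimage coord (F i)) ->
  g_sigma_preimage coord (\bigcup_i (F i)).
Proof. exact: sigma_algebra_bigcup. Qed.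

HB.instance Definition _ := @isMeasurable.Build rV_display
  'rV[R]_N (g_sigma_preimage coord) rV_set0 rV_setC rV_bigcup.

Lemma measurable_coord (i : 'I_N) :
  measurable_fun [set: 'rV[R]_N] (fun x : 'rV[R]_N => x ord0 i).
Proof.
move=> _ Y mY; rewrite setTI; apply: sub_sigma_algebra => /=.
rewrite -bigcup_seq/=; exists i => /=; first by rewrite mem_index_enum.
by exists Y => //; rewrite setTI.
Qed.

Lemma measurable_fun_coordP d (T : measurableType d) (f : T -> 'rV[R]_N) :
  measurable_fun [set: T] f <->
  forall i, measurable_fun [set: T] (fun x => f x ord0 i).
Proof.
split=> [mf i|mf].
  exact: (measurableT_comp (measurable_coord i) mf).
apply: (@measurability _ _ _ _ _ _
   (\big[setU/set0]_(i < N) preimage_set_system setT (coord i) measurable)).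
  by [].
move=> _ [B + <-]; rewrite -bigcup_seq => -[i _ [A mA <-]].
by rewrite !setTI; have := mf i measurableT A mA; rewrite setTI.
Qed.

Lemma open_measurable_rV (U : set 'rV[R]_N) : open U -> measurable U.
Proof.
move=> oU.
pose box (ab : 'rV[rat]_N * 'rV[rat]_N) : set 'rV[R]_N :=
  [set x | forall i, ratr (ab.1 ord0 i) < x ord0 i < ratr (ab.2 ord0 i)].
have mbox ab : measurable (box ab).
  have -> : box ab = \big[setI/setT]_(i < N)
      ((fun x : 'rV[R]_N => x ord0 i) @^-1`
       `](ratr (ab.1 ord0 i)), (ratr (ab.2 ord0 i))[%classic).
    rewrite -bigcap_seq; apply/seteqP; split => x /= h i.
      by move=> _; rewrite /= in_itv/= h.
    by have := h i; rewrite /= in_itv/= mem_index_enum; apply.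
  apply: bigsetI_measurable => i _; rewrite -[X in measurable X]setTI.
  exact: measurable_coord.
have -> : U = \bigcup_(ab in [set ab | box ab `<=` U]) box ab.
  apply/seteqP; split => [x Ux|x [ab abU]]; last exact: abU.
  have /nbhs_ballP[e /= e0 eU] : nbhs x U by exact: open_nbhs_nbhs.
  have Ha i : exists q : rat, x ord0 i - e < ratr q < x ord0 i.
    have /rat_in_itvoo[q] : x ord0 i - e < x ord0 i by rewrite ltrBlDr ltrDl.
    by rewrite in_itv/=; exists q.
  have Hb i : exists q : rat, x ord0 i < ratr q < x ord0 i + e.
    have /rat_in_itvoo[q] : x ord0 i < x ord0 i + e by rewrite ltrDl.
    by rewrite in_itv/=; exists q.
  have [a aP] := choice Ha; have [b bP] := choice Hb.
  exists (\row_i a i, \row_i b i); last first.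
    move=> i /=; rewrite !mxE.
    by have /andP[_ ->] := aP i; have /andP[-> _] := bP i.
  move=> y /= yab; apply: eU; split => // k i; rewrite ord1.
  have := yab i; rewrite /= !mxE => /andP[ay yb].
  have /andP[xa _] := aP i; have /andP[_ xb] := bP i.
  have h1 : y ord0 i < x ord0 i + e by exact: lt_trans xb.
  have h2 : x ord0 i - e < y ord0 i by exact: lt_trans ay.
  by rewrite /ball /= ltr_norml; apply/andP; split; lra.
rewrite bigcup_mkcond; apply: countable_bigcupT_measurable => [|ab].
  exact: countableP.
by case: ifP => _; [exact: mbox|exact: measurable0].
Qed.

End rV_measurable.

Lemma sigma_finite_product d1 d2 (T1 : measurableType d1)
    (T2 : measurableType d2) (R : realType)
    (m1 : {sigma_finite_measure set T1 -> \bar R})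
    (m2 : {sigma_finite_measure set T2 -> \bar R}) :
  sigma_finite setT (m1 \x m2)%E.
Proof.
have /sigma_finiteP[F [TF ndF Foo]] := sigma_finiteT m1.
have /sigma_finiteP[G [TG ndG Goo]] := sigma_finiteT m2.
exists (fun n => F n `*` G n).
  rewrite -setXTT TF TG predeqE => -[x y]; split.
    move=> [/= [n _ Fnx] [k _ Gky]]; exists (maxn n k) => //; split.
    - by move: x Fnx; exact/subsetPset/ndF/leq_maxl.
    - by move: y Gky; exact/subsetPset/ndG/leq_maxr.
  by move=> [n _ []/= ? ?]; split; exists n.
move=> k; have [? ?] := Foo k; have [? ?] := Goo k.
split; first exact: measurableX.
by rewrite product_measure1E// lte_mul_pinfty// ge0_fin_numE.
Qed.

Section lebesgue_rV.
Variable R : realType.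

Definition rV_cons n (z : measurableTypeR R * 'rV[R]_n) : 'rV[R]_n.+1 :=
  row_mx z.1%:M z.2 : 'rV[R]_(1 + n).

Fixpoint lebesgue_rV (N : nat) : set 'rV[R]_N -> \bar R :=
  match N with
  | 0%N => dirac (0 : 'rV[R]_0)
  | n.+1 => pushforward (lebesgue_measure \x @lebesgue_rV n)%E (@rV_cons n)
  end.
Arguments lebesgue_rV : clear implicits.

Lemma rV_cons0 n z : @rV_cons n z ord0 ord0 = z.1.
Proof.
have -> : (ord0 : 'I_(1 + n)) = lshift n ord0 by apply/val_inj.
by apply: eq_trans (row_mxEl _ _ _ _) _; rewrite mxE eqxx.
Qed.

Lemma rV_consS n z i : @rV_cons n z ord0 (lift ord0 i) = z.2 ord0 i.
Proof.
have -> : (lift ord0 i : 'I_(1 + n)) = rshift 1 i by apply/val_inj.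
exact: row_mxEr.
Qed.

Lemma measurable_rV_cons n : measurable_fun [set: _] (@rV_cons n).
Proof.
apply/measurable_fun_coordP => i; have [j|] := unliftP ord0 i.
  move=> ->; under eq_fun do rewrite rV_consS.
  exact: measurableT_comp (measurable_coord j) measurable_snd.
move=> ->; under eq_fun do rewrite rV_cons0.
exact: measurable_fst.
Qed.

Lemma lebesgue_rV_subproof N :
  exists m : {sigma_finite_measure set 'rV[R]_N -> \bar R},
    lebesgue_rV N = m :> (set _ -> _).
Proof.
elim: N => [|n [m mE]]; first by exists (dirac (0 : 'rV[R]_0)).
pose P' := [the {measure set _ -> \bar R} of
  pushforward (lebesgue_measure \x m)%E (@rV_cons n)].
pose P := P' (@measurable_rV_cons n).
have PE : lebesgue_rV n.+1 = P by rewrite /= mE.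
have sP : sigma_finite setT P.
  have [F FT mF] : sigma_finite setT (lebesgue_measure \x m)%E.
    exact: (sigma_finite_product
      [the {sigma_finite_measure set _ -> \bar R} of lebesgue_measure] m).
  pose h (x : 'rV[R]_n.+1) : measurableTypeR R * 'rV[R]_n :=
    (x ord0 ord0, \row_i x ord0 (lift ord0 i)).
  have mh : measurable_fun setT h.
    apply/measurable_fun_pair; first exact: measurable_coord.
    apply/measurable_fun_coordP => i; under eq_fun do rewrite mxE.
    exact: measurable_coord.
  have hK z : h (rV_cons z) = z.
    case: z => a b; congr pair; first by rewrite rV_cons0.
    by apply/rowP => i; rewrite mxE rV_consS.
  exists (fun k => h @^-1` F k) => [|k].
    by rewrite -preimage_bigcup -FT preimage_setT.
  have [mFk Fk] := mF k; split.
    by rewrite -[X in measurable X]setTI; exact: mh.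
  rewrite /P /= /pushforward (_ : _ @^-1` _ = F k)//.
  by apply/seteqP; split => z /=; rewrite hK.
pose sPm := Measure_isSigmaFinite.Build _ _ _ P sP.
pose Q : {sigma_finite_measure set 'rV[R]_n.+1 -> \bar R} :=
  HB.pack (P : set _ -> \bar R) (Measure.class P) sPm.
by exists Q.
Qed.

Let lebesgue_rV0 N : lebesgue_rV N set0 = 0%E.
Proof. by have [m ->] := lebesgue_rV_subproof N; exact: measure0. Qed.

Let lebesgue_rV_ge0 N A : (0 <= lebesgue_rV N A)%E.
Proof. by have [m ->] := lebesgue_rV_subproof N; exact: measure_ge0. Qed.

Let lebesgue_rV_sigma_additive N : semi_sigma_additive (lebesgue_rV N).
Proof.
by have [m ->] := lebesgue_rV_subproof N; exact: measure_semi_sigma_additive.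
Qed.

HB.instance Definition _ N := isMeasure.Build _ _ _ (lebesgue_rV N)
  (@lebesgue_rV0 N) (@lebesgue_rV_ge0 N) (@lebesgue_rV_sigma_additive N).

Let lebesgue_rV_sigma_finite N : sigma_finite setT (lebesgue_rV N).
Proof.
by have [m ->] := lebesgue_rV_subproof N; exact: sigma_finiteT.
Qed.

HB.instance Definition _ N := Measure_isSigmaFinite.Build _ _ _
  (lebesgue_rV N) (@lebesgue_rV_sigma_finite N).

Lemma lebesgue_rV_box N (A : 'I_N -> set (measurableTypeR R)) :
  (forall i, measurable (A i)) ->
  lebesgue_rV N [set x | forall i, A i (x ord0 i)] =
  (\prod_(i < N) lebesgue_measure (A i))%E.
Proof.
elim: N A => [|n IH] A mA.
  rewrite big_ord0 /= diracE (_ : _ \in _ = true)//.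
  by apply/mem_set => -[].
rewrite big_ord_recl -IH; last by move=> i; exact: mA.
rewrite /= /pushforward.
rewrite -(product_measure1E lebesgue_measure (lebesgue_rV n)).
- congr product_measure1; apply/seteqP; split => -[a b] /=.
    move=> h; split; first by have := h ord0; rewrite rV_cons0.
    by move=> i; have := h (lift ord0 i); rewrite rV_consS.
  move=> [Aa Ab] i; have [j|] := unliftP ord0 i => ->.
    by rewrite rV_consS.
  by rewrite rV_cons0.
- exact: mA.
- rewrite [X in measurable X](_ : _ = \big[setI/setT]_(i < n)
    ((fun x : 'rV[R]_n => x ord0 i) @^-1` A (lift ord0 i))).
    apply: bigsetI_measurable => i _; rewrite -[X in measurable X]setTI.
    by apply: measurable_coord => //; exact: mA.
  rewrite -bigcap_seq; apply/seteqP; split => x /= h i.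
    by move=> _; exact: h.
  by have := h i; apply; rewrite /= mem_index_enum.
Qed.

End lebesgue_rV.
Arguments lebesgue_rV R N A : clear implicits.

Section sobolev.
Variables (R : realType) (N : nat).
Local Notation V := 'rV[R]_N.
Local Notation mu := (lebesgue_rV R N).
Implicit Types (Omega : set V) (p q lam : R) (H u w phi : V -> R).
Implicit Types (Du Dw Dphi : V -> V).

Definition dotp (a b : V) : R := \sum_i a ord0 i * b ord0 i.

(* The library norm on 'rV is the sup norm. *)
Definition enorm (a : V) : R := Num.sqrt (dotp a a).

Definition grad (f : V -> R) (x : V) : V := \row_i 'D_(delta_mx ord0 i) f x.

Fixpoint Ck (k : nat) (f : V -> R) : Prop :=
  match k with
  | 0%N => continuous f
  | k'.+1 => (forall x, differentiable f x) /\
             forall i : 'I_N, Ck k' ('D_(delta_mx ord0 i) f)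
  end.

Definition test_function Omega phi : Prop :=
  [/\ forall k, Ck k phi,
      compact (closure [set x | phi x != 0]) &
      closure [set x | phi x != 0] `<=` Omega].

Definition Lp_norm Omega p w : \bar R :=
  Lnorm mu p%:E ((EFin \o w) \_ Omega).

(* [W01p Omega p u Du]: u belongs to W^{1,p}_0(Omega) and Du is its gradient,
   the closure of test functions under the L^p norm of the gradient.  That
   norm alone does not tell which function a Cauchy sequence converges to;
   when |Omega| is finite the Poincare inequality makes the sequence Cauchy in
   L^p(Omega) as well, and u is its limit there.  Since the L^p limits of phi_n
   and of grad phi_n satisfy the integration by parts formula, Du is the
   distributional gradient of u.  Only the values on Omega matter. *)
Definition W01p Omega p u Du : Prop :=
  [/\ measurable_fun Omega u, measurable_fun Omega Du &
      exists phi : nat -> V -> R,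
        [/\ forall n, test_function Omega (phi n),
            Lp_norm Omega p (phi n \- u) @[n --> \oo] --> 0%E &
            Lp_norm Omega p (fun x => enorm (grad (phi n) x - Du x))
              @[n --> \oo] --> 0%E]].

Definition p_homogeneous p H : Prop :=
  forall (t : R) (z : V), H (t *: z) = `|t| `^ p * H z.

Definition energy Omega H Dw : \bar R :=
  (\int[mu]_(x in Omega) (H (Dw x))%:E)%E.

Definition admissible Omega p q w Dw : Prop :=
  W01p Omega p w Dw /\ Lp_norm Omega q w = 1%E.

Definition lambda_pq Omega p q H : \bar R :=
  ereal_inf [set energy Omega H z.2 | z in
    [set z : (V -> R) * (V -> V) | admissible Omega p q z.1 z.2]].

Definition is_minimizer Omega p q H w Dw : Prop :=
  admissible Omega p q w Dw /\ energy Omega H Dw = lambda_pq Omega p q H.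

(* Weak solution of - (1/p) div (grad H (grad u)) = lam * u ^ (q - 1). *)
Definition weak_solution Omega p q H lam u Du : Prop :=
  W01p Omega p u Du /\
  forall phi Dphi, W01p Omega p phi Dphi ->
    ((p^-1)%:E * (\int[mu]_(x in Omega) (dotp (grad H (Du x)) (Dphi x))%:E) =
     lam%:E * (\int[mu]_(x in Omega) (u x `^ (q - 1) * phi x)%:E))%E.

End sobolev.

(* Main.v *)
(* The solution u is positive a.e.: testing the equation with |phi|^p (u+e)^(1-p)
   bounds the gradient of log (u+e) in L^p on a small cube, independently of e.
   If u vanished on a part A of the cube of positive measure while u >= eta > 0
   on a part B, then log (u+e) would differ by log (eta/e) between A and B, which
   the L^1 Poincare inequality forbids as e -> 0.  Hence on small cubes u = 0 a.e.
   or u > 0 a.e., and connectedness of Omega makes the choice global.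

   For a test function phi, taking |phi|^q u^(1-q) in the equation and applying a
   Picone inequality gives
     lam int |phi|^q <= (q/p) int H(grad phi) + (1 - q/p) int H(grad u),
   which passes by density to all w in W^{1,p}_0.  As int H(grad u) = lam int u^q,
   using it for w normalised by ||w||_q = ||u||_q says exactly that u minimises
   int H(grad w) among such w. *)

(* The formal test function |phi|^q u^(1-q) need not lie in W^{1,p}_0, so it is replaced by
   [negpow e m] of u times [powreg (e ^+ 2) m] of phi. Membership in W^{1,p}_0 is accessible only
   through smooth approximants, which may be negative although u is not; hence the functions
   composed with u are chosen smooth on the whole line, with bounded values and bounded derivative.
   The price is that a smooth substitute for max(t, 0) has slope below 1: differentiating its
   negative power produces a factor [dposreg], and the exact cancellation behind Picone's inequality
   is lost. A free weight k in [picone_pointwise] repairs this and lets one pointwise inequality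
   serve both the logarithmic estimate and the comparison with other functions. At a zero of u the
   slope is 1/2 for every e, so the loss disappears in the limit only where u > 0. This is why
   strict positivity has to be settled before the comparison; connectedness of Omega enters only
   there. *)
From HB Require Import structures.
Require Import Defs.
From mathcomp Require Import all_boot all_order all_algebra.
From mathcomp Require Import all_classical all_reals all_analysis measurable_realfun.
From mathcomp Require Import ring lra.
Import Order.TTheory GRing.Theory Num.Theory.
Import numFieldTopology.Exports numFieldNormedType.Exports.
Local Open Scope classical_set_scope.
Local Open Scope ring_scope.
Set Implicit Arguments.
Unset Strict Implicit.
Unset Printing Implicit Defensive.

(** * Calculus on row vectors *)

Section calculus.
Variables (R : realType) (N : nat).
Local Notation V := 'rV[R]_N.
Implicit Types (f g h : V -> R) (x y v : V) (i : 'I_N).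

Lemma derive_compR f (G : R -> R) x v b : differentiable f x ->
  is_derive (f x) 1 G b ->
  differentiable (G \o f) x /\ 'D_v (G \o f) x = b * 'D_v f x.
Proof.
move=> df dG.
have dG' : differentiable G (f x) by apply/derivable1_diffP.
split; first exact: differentiable_comp.
rewrite !deriveE//; last exact: differentiable_comp.
rewrite diff_comp//= -{1}(mulr1 ('d f x v)) -[X in 'd G _ X]/('d f x v *: 1).
rewrite linearZ/= mulrC; congr (_ * _).
by rewrite -deriveE// derive_val.
Qed.

Lemma Ck_derive k f i : Ck k.+1 f -> Ck k ('D_(delta_mx ord0 i) f).
Proof. by move=> [_ h]; exact: h. Qed.

Lemma CkS k f : Ck k.+1 f -> Ck k f.
Proof.
elim: k f => [|k IH] f; first by case=> df _ x; exact: differentiable_continuous.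
by move=> [df Df]; split => // i; apply: IH.
Qed.

Lemma Ck_continuous k f : Ck k f -> continuous f.
Proof. by elim: k f => // k IH f /CkS; exact: IH. Qed.

Lemma Ck_cst k (c : R) : Ck k (fun _ : V => c).
Proof.
elim: k c => [|k IH] c /=; first exact: cst_continuous.
split => [x|i]; first exact: differentiable_cst.
rewrite (_ : 'D__ _ = fun _ => 0) //.
by apply/funext => x; exact: derive_cst.
Qed.

Lemma CkD k f g : Ck k f -> Ck k g -> Ck k (fun x => f x + g x).
Proof.
elim: k f g => [|k IH] f g /=; first by move=> cf cg x; exact: continuousD (cf x) (cg x).
move=> [df Df] [dg Dg]; split => [x|i]; first exact: differentiableD.
rewrite (_ : 'D__ _ = fun x => 'D_(delta_mx ord0 i) f x + 'D_(delta_mx ord0 i) g x).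
  exact: IH.
by apply/funext => x; rewrite deriveD//; exact: diff_derivable.
Qed.

Lemma CkM k f g : Ck k f -> Ck k g -> Ck k (fun x => f x * g x).
Proof.
elim: k f g => [|k IH] f g; first by move=> cf cg x; exact: continuousM (cf x) (cg x).
move=> cf cg; have [df Df] := cf; have [dg Dg] := cg.
split => [x|i]; first exact: differentiableM.
rewrite (_ : 'D__ _ = fun x => f x * 'D_(delta_mx ord0 i) g x + g x * 'D_(delta_mx ord0 i) f x).
  by apply: CkD; apply: IH; [exact: CkS|exact: Ck_derive|exact: CkS|exact: Ck_derive].
by apply/funext => x; rewrite deriveM//; exact: diff_derivable.
Qed.

(** The exponent is generalised in the induction, since differentiating replaces [a] by [a - 1];
    [f > 0] keeps the power away from its singularity at 0. *)
Lemma Ck_powR k f (a : R) : (forall x, 0 < f x) -> Ck k f ->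
  Ck k (fun x => f x `^ a).
Proof.
move=> f0; elim: k a => [|k IH] a cf.
  move=> x; have dp := is_derive1_powR a (f0 x).
  apply: (@continuous_comp _ _ _ f (fun t => t `^ a)); first exact: cf.
  by apply: differentiable_continuous; apply/derivable1_diffP.
have [df Df] := cf.
split => [x|i].
  by have [] := derive_compR 0 (df x) (is_derive1_powR a (f0 x)).
rewrite (_ : 'D__ _ = fun x => a * f x `^ (a - 1) * 'D_(delta_mx ord0 i) f x).
  by apply: CkM; [apply: CkM; [exact: Ck_cst|apply: IH; exact: CkS]|exact: Ck_derive].
apply/funext => x.
by have [_ <-] := derive_compR (delta_mx ord0 i) (df x) (is_derive1_powR a (f0 x)).
Qed.

Lemma gradE f x i : grad f x ord0 i = 'D_(delta_mx ord0 i) f x.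
Proof. by rewrite mxE. Qed.

Lemma derive_dotp f x v : differentiable f x -> 'D_v f x = dotp (grad f x) v.
Proof.
move=> df; rewrite deriveE// [in LHS](row_sum_delta v) linear_sum/=.
by apply: eq_bigr => i _; rewrite linearZ/= gradE deriveE// mulrC.
Qed.

Lemma dotpZr (c : R) x y : dotp x (c *: y) = c * dotp x y.
Proof. by rewrite /dotp mulr_sumr; apply: eq_bigr => i _; rewrite mxE mulrCA. Qed.

Lemma dotpDr x y v : dotp x (y + v) = dotp x y + dotp x v.
Proof. by rewrite /dotp -big_split; apply: eq_bigr => i _; rewrite mxE mulrDr. Qed.

Lemma gradM f g x : differentiable f x -> differentiable g x ->
  grad (fun x => f x * g x) x = f x *: grad g x + g x *: grad f x.
Proof.
move=> df dg; apply/rowP => i; rewrite !mxE deriveM//; exact: diff_derivable.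
Qed.

Lemma grad_comp f (G : R -> R) x b : differentiable f x ->
  is_derive (f x) 1 G b -> grad (G \o f) x = b *: grad f x.
Proof.
move=> df dG; apply/rowP => i; rewrite !mxE.
by have [_ ->] := derive_compR (delta_mx ord0 i) df dG.
Qed.

Lemma coord_le_norm x i : `|x ord0 i| <= `|x|.
Proof.
by rewrite {2}/Num.norm/= mx_normrE; apply: le_trans (le_bigmax _ _ (ord0, i)).
Qed.

Lemma norm_le_coord x (r : R) : 0 <= r -> (forall i, `|x ord0 i| <= r) -> `|x| <= r.
Proof.
move=> r0 h; rewrite /Num.norm/= mx_normrE; apply/bigmax_leP; split => // -[j i] _.
by rewrite (ord1 j)/=.
Qed.

Lemma norm_le_enorm x : `|x| <= enorm x.
Proof.
apply: norm_le_coord => [|i]; first exact: sqrtr_ge0.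
rewrite -sqrtr_sqr ler_wsqrtr// /dotp (bigD1 i)//= expr2 lerDl.
by apply: sumr_ge0 => j _; rewrite -expr2 sqr_ge0.
Qed.

(** The constant is N rather than sqrt N, through N <= N^2; only its finiteness matters later. *)
Lemma enorm_le_norm x : enorm x <= N%:R * `|x|.
Proof.
rewrite -[leRHS]ger0_norm; last by rewrite mulr_ge0.
rewrite -sqrtr_sqr ler_wsqrtr// exprMn.
apply: (@le_trans _ _ (\sum_(i < N) `|x| ^+ 2)).
  by apply: ler_sum => i _; rewrite -expr2 -real_normK ?num_real// ler_sqr// ?nnegrE// coord_le_norm.
rewrite sumr_const card_ord -[leLHS]mulr_natl ler_wpM2r ?sqr_ge0//.
by rewrite -natrX ler_nat; case: (N) => // n; rewrite -{1}(expn1 n.+1) leq_pexp2l.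
Qed.

Lemma continuous_row (F : V -> V) : (forall i, continuous (fun x => F x ord0 i)) ->
  continuous F.
Proof.
move=> h x; apply/(cvgrPdist_le (FF := nbhs_filter x)) => e e0.
have H : \forall y \near x, forall i, `|F x ord0 i - F y ord0 i| <= e.
  have := @filter_forall V 'I_N
    (fun i y => `|F x ord0 i - F y ord0 i| <= e) (nbhs x) (nbhs_filter x).
  apply => i.
  by have /cvgrPdist_le/(_ e e0) := h i x.
near=> y; apply: norm_le_coord; first exact: ltW.
by move=> i; rewrite !mxE; move: i; near: y.
Unshelve. all: by end_near. Qed.

Lemma continuous_grad f : Ck 1 f -> continuous (grad f).
Proof.
move=> [_ cf]; apply: continuous_row => i.
by under eq_fun do rewrite gradE; exact: cf.
Qed.

Lemma continuous_coord i : continuous (fun x : V => x ord0 i).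
Proof. exact: coord_continuous. Qed.

Lemma Ck_coord k i : Ck k (fun x : V => x ord0 i).
Proof.
case: k => [|k]; first exact: continuous_coord.
have dif x : differentiable (fun x : V => x ord0 i) x by exact: differentiable_coord.
split=> // j.
rewrite (_ : 'D__ _ = fun _ => (delta_mx ord0 j : V) ord0 i); first exact: Ck_cst.
apply/funext => x; rewrite deriveE//.
have lc : linear (fun x : V => x ord0 i) by move=> a y z; rewrite !mxE.
pose L := GRing.isLinear.Build R V R *%R _ lc.
pose L' : {linear V -> R} := HB.pack (fun x : V => x ord0 i) L.
rewrite (_ : (fun x : V => x ord0 i) = L')// diff_lin//.
exact: continuous_coord.
Qed.

Lemma continuous_measurable_rV f : continuous f -> measurable_fun [set: V] f.
Proof.
move=> cf; apply: (measurability (@RGenOInfty.G R)); first exact: RGenOInfty.measurableE.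
move=> _ [_ [a ->] <-]; rewrite setTI; apply: open_measurable_rV.
by apply: open_comp => [x _|]; [exact: cf|exact: interval_open].
Qed.

Lemma continuous_measurable_rVrV (F : V -> V) : continuous F -> measurable_fun [set: V] F.
Proof.
move=> cF; apply/measurable_fun_coordP => i; apply: continuous_measurable_rV.
move=> x; apply: (@continuous_comp _ _ _ F (fun x : V => x ord0 i)).
  exact: cF.
exact: continuous_coord.
Qed.

End calculus.

(** * Test functions *)

Section flat.
Variable R : realType.
Implicit Types (t : R) (k : nat).

(** Meant for the point 0, where the two branches of [flat] meet: a quadratic bound makes the
    difference quotient O(h). *)
Lemma is_derive_quadratic (f : R -> R) (c : R) :
  (forall h, `|f h| <= c * h ^+ 2) -> is_derive 0 (1 : R) f (0 : R).
Proof.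
move=> fc; have f0 : f 0 = 0.
  by apply/eqP; rewrite -normr_le0 (le_trans (fc 0))// expr2 !mulr0.
have c0 : 0 <= c by have := fc 1; rewrite expr1n mulr1; apply: le_trans.
suff h0 : (fun h : R => h^-1 *: ((f \o shift 0) (h *: (1 : R)) - f 0)) @ 0^' --> (0 : R).
  by apply: DeriveDef; [apply: cvgP h0|apply: cvg_lim h0].
apply/cvgr0Pnorm_le => e e0; near=> h.
have h0 : h != 0 by near: h; exact: nbhs_dnbhs_neq.
rewrite f0 subr0 /= addr0 [h *: 1]mulr1 normrM normfV.
rewrite ler_pdivrMl ?normr_gt0// (le_trans (fc h))//.
rewrite -real_normK ?num_real// expr2 mulrA mulrC ler_pM2l ?normr_gt0//.
have : `|h| <= e / (c + 1) by near: h; apply: dnbhs0_le; rewrite divr_gt0// ltr_wpDl.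
rewrite ler_pdivlMr ?ltr_wpDl// => /(le_trans _); apply.
by rewrite mulrC ler_wpM2l// lerDl.
Unshelve. all: by end_near. Qed.

(* The span of these functions is stable under differentiation, see
   [is_derive_flat], which makes them all smooth. *)
Definition flat k t : R := if 0 < t then t^-1 ^+ k * expR (- t^-1) else 0.

Lemma flat_ge0 k t : 0 <= flat k t.
Proof.
rewrite /flat; case: ifPn => // t0.
by rewrite mulr_ge0 ?expR_ge0// exprn_ge0// invr_ge0 ltW.
Qed.

(** The exponential exp(1/t) dominates its Taylor term of degree k + 2, which absorbs t^-k and
    leaves a factor t^2. *)
Lemma flat_le k t : `|flat k t| <= (k.+2)`!%:R * t ^+ 2.
Proof.
rewrite ger0_norm ?flat_ge0// /flat; case: ifPn => t0; last first.
  by rewrite mulr_ge0// sqr_ge0.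
have x0 : 0 < t^-1 by rewrite invr_gt0.
have := @expR_ge1Dxn R t^-1 k.+1 (ltW x0).
have F0 : 0 < (k.+2)`!%:R :> R by rewrite ltr0n fact_gt0.
move=> /(le_trans _)-/(_ (t^-1 ^+ k.+2 / (k.+2)`!%:R)) H.
have {}H : t^-1 ^+ k.+2 / (k.+2)`!%:R <= expR t^-1 by apply: H; rewrite lerDr.
rewrite expRN -ler_pdivlMr ?invr_gt0 ?expR_gt0// invrK.
rewrite ler_pdivrMr// in H.
have -> : t^-1 ^+ k = t^-1 ^+ k.+2 * t ^+ 2.
  by rewrite -addn2 exprD -mulrA -exprMn mulVf ?gt_eqF// expr1n mulr1.
by rewrite [leRHS]mulrAC ler_pM2r ?exprn_gt0// [leRHS]mulrC.
Qed.

Lemma is_derive_flat k t :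
  is_derive t (1 : R) (flat k) (- k%:R * flat k.+1 t + flat k.+2 t).
Proof.
have [t0|t0|->] := ltgtP t 0.
- have -> : - k%:R * flat k.+1 t + flat k.+2 t = 0.
    by rewrite /flat ltNge (ltW t0)/= mulr0 addr0.
  apply: (@near_eq_is_derive _ _ _ (cst 0)).
  by near=> s; rewrite /flat ifN// -leNgt ltW//; near: s; exact: lt_nbhsl.
- have xd : is_derive t (1 : R) (fun s : R => s^-1) (- t ^- 2).
    by have := is_deriveV (lt0r_neq0 t0 : id t != 0) (is_derive_id t (1 : R));
      rewrite /= [_ *: _]mulr1.
  have nd : is_derive t (1 : R) (fun s : R => - s^-1) (t ^- 2).
    by have := is_deriveN xd; rewrite opprK.
  have ed : is_derive t (1 : R) (fun s : R => expR (- s^-1)) (expR (- t^-1) * t ^- 2).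
    exact: (@is_derive1_comp R expR (fun s => - s^-1) t _ _ (is_derive_expR (- t^-1)) nd).
  have pd := is_deriveX k xd.
  have := is_deriveM pd ed => /is_derive_eq-/(_ (- k%:R * flat k.+1 t + flat k.+2 t)) H.
  apply: (@near_eq_is_derive _ _ _ ((fun s : R => s^-1) ^+ k * (fun s : R => expR (- s^-1)))).
    by near=> s; rewrite /flat ifT ?fctE//; near: s; exact: lt_nbhsr.
  apply: H; rewrite /flat t0 !fctE /GRing.scale/=.
  case: (k) => [|m]; first by rewrite !expr0 oppr0 !mul0r !mulr0 expr2 exprVn; ring.
  by rewrite -!exprVn -pred_Sn !exprS; ring.
- rewrite /flat ltxx mulr0 addr0; exact: (is_derive_quadratic (flat_le k)).
Unshelve. all: by end_near. Qed.

Lemma flat0_mono t s : t <= s -> flat 0 t <= flat 0 s.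
Proof.
move=> ts; rewrite /flat; case: ifPn => t0; last first.
  by case: ifPn => // _; rewrite expr0 mul1r expR_ge0.
have s0 := lt_le_trans t0 ts; rewrite s0 !expr0 !mul1r ler_expR lerN2.
by rewrite lef_pV2.
Qed.

Lemma flat0_gt0 t : 0 < t -> 0 < flat 0 t.
Proof. by move=> t0; rewrite /flat t0 expr0 mul1r expR_gt0. Qed.

End flat.

Section test_functions.
Variables (R : realType) (N : nat).
Local Notation V := 'rV[R]_N.
Implicit Types (f g : V -> R) (x y : V).

(** The index [m] is generalised because one derivative of [flat m] involves [flat m.+1] and
    [flat m.+2]. *)
Lemma Ck_flat k m g : (forall j, Ck j g) -> Ck k (fun x => flat m (g x)).
Proof.
move=> cg; elim: k m => [|k IH] m.
  move=> x; apply: (@continuous_comp _ _ _ g (flat m)); first exact: (cg 0%N).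
  apply: differentiable_continuous; apply/derivable1_diffP.
  by have [] := is_derive_flat m (g x).
have [dg _] := cg 1%N.
split => [x|i].
  by have [] := derive_compR 0 (dg x) (is_derive_flat m (g x)).
rewrite (_ : 'D__ _ = fun x => (- m%:R * flat m.+1 (g x) + flat m.+2 (g x)) *
    'D_(delta_mx ord0 i) g x).
  apply: CkM; last exact: Ck_derive (cg k.+1).
  by apply: CkD => //; apply: CkM => //; exact: Ck_cst.
apply/funext => x.
by have [_ <-] := derive_compR (delta_mx ord0 i) (dg x) (is_derive_flat m (g x)).
Qed.

Lemma Ck_sum k n (F : 'I_n -> V -> R) : (forall i, Ck k (F i)) ->
  Ck k (fun x => \sum_(i < n) F i x).
Proof.
elim: n F => [|n IH] F cF.
  by under eq_fun do rewrite big_ord0; exact: Ck_cst.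
under eq_fun do rewrite big_ord_recl; apply: CkD => //.
exact: (IH (fun i => F (lift ord0 i))).
Qed.

Lemma compact_cube (a : V) (r : R) : compact [set x : V | forall i, `|x ord0 i - a ord0 i| <= r].
Proof.
have := @rV_compact R N (fun i => `[a ord0 i - r, a ord0 i + r]%classic)
  (fun i => @segment_compact R _ _).
congr (compact _); apply/seteqP; split => x /= h i; have := h i.
  by rewrite in_itv/= ler_distl.
by rewrite in_itv/= ler_distl.
Qed.

Lemma test_function_sub (Omega : set V) f g : test_function Omega f ->
  (forall k, Ck k g) -> (forall x, g x != 0 -> f x != 0) -> test_function Omega g.
Proof.
move=> [_ cf fO] cg gf.
have sub : closure [set x | g x != 0] `<=` closure [set x | f x != 0].
  exact: closure_subset.
split=> //; last exact: subset_trans fO.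
by apply: (subclosed_compact _ cf) => //; exact: closed_closure.
Qed.

(** The standard mollifier profile exp(-1/(r^2 - |x - a|^2)), extended by 0 outside the Euclidean
    ball. *)
Definition bump (a : V) (r : R) (x : V) : R :=
  flat 0 (r ^+ 2 - \sum_i (x ord0 i - a ord0 i) ^+ 2).

Lemma bump_ge0 a r x : 0 <= bump a r x.
Proof. exact: flat_ge0. Qed.

Lemma bump_test (Omega : set V) a r : 0 < r ->
  (forall x, `|x - a| <= r -> Omega x) -> test_function Omega (bump a r).
Proof.
move=> r0 aO.
have sub : closure [set x | bump a r x != 0] `<=` [set x : V | forall i, `|x ord0 i - a ord0 i| <= r].
  rewrite closureE => x; apply; split.
    by apply: compact_closed; [exact: norm_hausdorff|exact: compact_cube].
  move=> y /= + i; apply: contraNT; rewrite -ltNge => rlt.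
  rewrite /bump /flat ifN// -leNgt subr_le0 (bigD1 i)//= (@le_trans _ _ ((y ord0 i - a ord0 i) ^+ 2))//.
    by rewrite -[leRHS]real_normK ?num_real// ler_sqr ?nnegrE// ltW.
  by rewrite lerDl; apply: sumr_ge0 => j _; exact: sqr_ge0.
split.
- move=> k; apply: Ck_flat => j; apply: CkD; first exact: Ck_cst.
  under eq_fun do rewrite -mulN1r; apply: CkM; first exact: Ck_cst.
  apply: Ck_sum => i; under eq_fun do rewrite expr2.
  by apply: CkM; apply: CkD; [exact: Ck_coord|exact: Ck_cst|exact: Ck_coord|exact: Ck_cst].
- by apply: (subclosed_compact _ (@compact_cube a r) sub); exact: closed_closure.
- move=> x /sub /= h; apply: aO; apply: norm_le_coord => [|i]; first exact: ltW.
  by rewrite !mxE.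
Qed.

(** On the cube of half-side r/(2(N+1)) the N squares add up to at most r^2/2, so the argument of
    [flat 0] stays above r^2/2. This cube is the one on which the logarithm of the solution is
    controlled. *)
Lemma bump_lb a r : 0 < r -> exists2 c, 0 < c &
  forall x, `|x - a| <= r / (2 * N.+1%:R) -> c <= bump a r x.
Proof.
move=> r0; exists (flat 0 (r ^+ 2 / 2)); first by rewrite flat0_gt0// divr_gt0// exprn_gt0.
move=> x xa; apply: flat0_mono.
rewrite lerBrDr addrC -lerBrDr {1}(splitr (r ^+ 2)) addrK.
have n0 : 0 < N.+1%:R :> R by rewrite ltr0n.
have b0 : 0 <= r / (2 * N.+1%:R) by rewrite divr_ge0 ?ltW// mulr_gt0.
apply: (@le_trans _ _ (\sum_(i < N) (r / (2 * N.+1%:R)) ^+ 2)).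
  apply: ler_sum => i _; rewrite -real_normK ?num_real// ler_sqr ?nnegrE//.
  by apply: le_trans xa; have := coord_le_norm (x - a) i; rewrite !mxE.
rewrite sumr_const card_ord -[leLHS]mulr_natr exprMn -mulrA ler_wpM2l ?sqr_ge0//.
rewrite exprVn ler_pdivrMl ?exprn_gt0 ?mulr_gt0// exprMn.
have h1 : N%:R <= N.+1%:R ^+ 2 :> R.
  by rewrite -natrX ler_nat expnS expn1 (leq_trans (leqnSn N))// leq_pmulr.
have := sqr_ge0 (N.+1%:R : R); lra.
Qed.

Lemma bounded_compact_support f (K : set V) : continuous f -> compact K ->
  (forall x, ~ K x -> f x = 0) -> exists2 M, 0 <= M & forall x, `|f x| <= M.
Proof.
move=> cf cK f0.
have : compact (f @` K).
  by apply: continuous_compact => //; exact: continuous_subspaceT.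
move=> /compact_bounded[M [_ HM]].
exists (`|M| + 1) => [|x]; first by rewrite addr_ge0.
have [Kx|/f0 ->] := pselect (K x); last by rewrite normr0 addr_ge0.
apply: (HM (`|M| + 1)); last by exists x.
by rewrite (le_lt_trans (ler_norm M))// ltrDl.
Qed.

Lemma grad_out (f : V -> R) x : ~ closure [set x | f x != 0] x -> grad f x = 0.
Proof.
move=> nx; apply/rowP => i; rewrite !mxE.
have : open (~` closure [set x | f x != 0]) by rewrite openC; exact: closed_closure.
rewrite openE => /(_ x nx) nb.
rewrite (@near_eq_derive _ _ _ f (cst 0))//; first exact: derive_cst.
apply: filterS nb => y ny /=; apply/eqP; apply: contra_notT ny => fy.
exact: subset_closure.
Qed.

Lemma test_function_bounded Omega f : test_function Omega f ->
  exists2 M, 0 <= M & forall x, `|f x| <= M /\ `|grad f x| <= M.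
Proof.
move=> [sf cf _].
have [|x nx|M1 M10 h1] := @bounded_compact_support f _ _ cf.
- exact: (sf 0%N).
- by apply/eqP; apply: contra_notT nx => fx; exact: subset_closure.
have [|x nx|M2 M20 h2] := @bounded_compact_support (fun x => `|grad f x|) _ _ cf.
- move=> x; apply: (@continuous_comp _ _ _ (grad f) (fun y : V => `|y|)).
    by apply: continuous_grad; exact: sf.
  exact: norm_continuous.
- by rewrite grad_out// normr0.
exists (M1 + M2) => [|x]; first exact: addr_ge0.
split; first by rewrite (le_trans (h1 x))// lerDl.
by have := h2 x; rewrite normr_id => /le_trans; apply; rewrite lerDr.
Qed.

End test_functions.

(** * Approximation in W^{1,p}_0 *)

Section powers.
Variable R : realType.
Implicit Types a b r : R.

Lemma powR_addle a b r : 0 <= a -> 0 <= b -> 0 <= r ->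
  (a + b) `^ r <= 2 `^ r * (a `^ r + b `^ r).
Proof.
move=> a0 b0 r0; wlog ab : a b a0 b0 / a <= b => [H|].
  have [ab|/ltW ab] := leP a b; first exact: H.
  by rewrite addrC [X in _ * X]addrC; exact: H.
apply: (@le_trans _ _ ((2 * b) `^ r)).
  apply: ge0_ler_powR => //; rewrite ?nnegrE ?addr_ge0 ?mulr_ge0//.
  by rewrite mulr_natl mulr2n lerD2r.
by rewrite powRM// ler_wpM2l ?powR_ge0// lerDr powR_ge0.
Qed.

Lemma powR_le1D a r s : 0 <= a -> 0 <= r -> r <= s -> a `^ r <= 1 + a `^ s.
Proof.
move=> a0 r0 rs; have [a1|a1] := leP 1 a.
  by rewrite (@le_trans _ _ (a `^ s))// ?ler_powR// lerDr.
rewrite (@le_trans _ _ 1)// ?lerDl ?powR_ge0//.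
have := @ge0_ler_powR R r r0 a 1; rewrite powR1; apply; rewrite ?nnegrE//.
exact: ltW.
Qed.

(** At l = 0 the power need not be differentiable, so that case is done by hand with the threshold
    e^(1/r); elsewhere continuity follows from differentiability. *)
Lemma cvg_powR (u : R^nat) (l r : R) : 0 < r -> (forall n, 0 <= u n) ->
  u @ \oo --> l -> (fun n => u n `^ r) @ \oo --> l `^ r.
Proof.
move=> r0 u0 ul.
have : 0 <= l.
  rewrite -(cvg_lim (@Rhausdorff R) ul).
  by apply: limr_ge; [exact: cvgP ul|exact: nearW].
rewrite le_eqVlt => /predU1P[l0|l0].
  rewrite -l0 powR0 ?gt_eqF//; apply/cvgrPdist_le => e e0; near=> n.
  rewrite sub0r normrN ger0_norm ?powR_ge0//.
  have -> : e = (e `^ r^-1) `^ r by rewrite -powRrM mulVf ?gt_eqF// powRr1// ltW.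
  apply: ge0_ler_powR; rewrite ?nnegrE ?powR_ge0//; first exact: ltW.
  rewrite -[leLHS]ger0_norm// -[u n](subr0) distrC l0; near: n.
  by apply: (cvgr_dist_le _ _ ul); rewrite powR_gt0.
have c : {for l, continuous (fun t => t `^ r)}.
  apply: differentiable_continuous; apply/derivable1_diffP.
  by apply: derivable_powR; rewrite in_itv/= l0.
exact: (cvg_comp u (fun t => t `^ r) ul c).
Unshelve. all: by end_near. Qed.

Lemma cvge0_near_lt (x : (\bar R)^nat) (e : \bar R) : x @ \oo --> 0%E -> (0 < e)%E ->
  \forall n \near \oo, (x n < e)%E.
Proof.
move=> x0 e0; have nb : nbhs 0%E [set y | (y < e)%E].
  by apply: open_nbhs_nbhs; split => //; exact: open_ereal_lt_ereal.
exact: (x0 _ nb).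
Qed.

Lemma cvge0_intro (x : (\bar R)^nat) : (forall n, (0 <= x n)%E) ->
  (forall e : R, 0 < e -> \forall n \near \oo, (x n <= e%:E)%E) -> x @ \oo --> 0%E.
Proof.
move=> x0 H; apply/fine_cvgP; split.
  near=> n; rewrite ge0_fin_numE//; apply: (@le_lt_trans _ _ 1%:E); last exact: ltry.
  by near: n; exact: H.
apply/cvgrPdist_le => e e0; near=> n; rewrite sub0r normrN /= ger0_norm ?fine_ge0//.
have : (x n <= e%:E)%E by near: n; exact: H.
have := x0 n; case: (x n) => //=.
Unshelve. all: by end_near. Qed.

End powers.

(** * Domination, dominated convergence and a.e. convergent subsequences *)

Section integral_tools.
Context d (T : measurableType d) (R : realType) (mu : {measure set T -> \bar R}).
Variable (D : set T).
Hypothesis mD : measurable D.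
Implicit Types (f g h : T -> R).

Lemma intgD f g : mu.-integrable D (EFin \o f) -> mu.-integrable D (EFin \o g) ->
  mu.-integrable D (EFin \o (fun x => f x + g x)).
Proof.
by move=> fi gi; have := integrableD mD fi gi; apply: eq_integrable => // x _ /=; rewrite EFinD.
Qed.

Lemma intgZ (c : R) f : mu.-integrable D (EFin \o f) ->
  mu.-integrable D (EFin \o (fun x => c * f x)).
Proof.
by move=> fi; have := integrableZl mD c fi; apply: eq_integrable => // x _ /=; rewrite EFinM.
Qed.

Lemma intg_cst (c : R) : (mu D < +oo)%E -> mu.-integrable D (EFin \o (fun=> c)).
Proof.
move=> Dfin; apply: measurable_bounded_integrable => //.
exact: bounded_cst.
Qed.

Lemma intg_le f g : measurable_fun D f -> mu.-integrable D (EFin \o g) ->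
  (forall x, D x -> `|f x| <= g x) -> mu.-integrable D (EFin \o f).
Proof.
move=> mf gi fg; apply: (le_integrable mD _ _ gi); first exact/measurable_EFinP.
by move=> x Dx /=; rewrite lee_fin (le_trans (fg x Dx))// ler_norm.
Qed.

Lemma intg_le_ae f g : measurable_fun D f -> mu.-integrable D (EFin \o g) ->
  {ae mu, forall x, D x -> `|f x| <= g x} -> mu.-integrable D (EFin \o f).
Proof.
move=> mf gi fg; have mg := measurable_int _ gi.
apply/integrableP; split; first exact/measurable_EFinP.
have /integrableP[_] := gi; apply: le_lt_trans.
apply: ae_ge0_le_integral => //.
- by apply: measurableT_comp => //; exact/measurable_EFinP.
- exact: measurableT_comp.
- apply: filterS fg => x fg Dx /=.
  by rewrite lee_fin (le_trans (fg Dx))// ler_norm.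
Qed.

Lemma intg_fin f : mu.-integrable D (EFin \o f) ->
  (\int[mu]_(x in D) (f x)%:E)%E \is a fin_num.
Proof. by move=> fi; exact: integrable_fin_num. Qed.

Lemma dct_real (f_ : nat -> T -> R) f g :
  (forall n, measurable_fun D (f_ n)) -> measurable_fun D f ->
  mu.-integrable D (EFin \o g) ->
  {ae mu, forall x, D x -> f_ ^~ x @ \oo --> f x /\ forall n, `|f_ n x| <= g x} ->
  mu.-integrable D (EFin \o f) /\
  (fun n => \int[mu]_(x in D) (f_ n x)%:E)%E @ \oo --> (\int[mu]_(x in D) (f x)%:E)%E.
Proof.
move=> mf_ mf gi H.
have [] := @dominated_convergence _ _ _ mu D mD (fun n x => (f_ n x)%:E) (EFin \o f)
  (EFin \o g) _ _ _ gi _.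
- by move=> n; exact/measurable_EFinP.
- exact/measurable_EFinP.
- by apply: filterS H => x H Dx; apply: cvg_EFin; [exact: nearW|exact: (H Dx).1].
- by apply: filterS H => x H n Dx /=; rewrite lee_fin; exact: (H Dx).2.
- by move=> fi _ c; split.
Qed.

(** Choose the subsequence with integrals at most 2^-(n+1). The sum of all its terms then has
    integral at most 1: it is the majorant [h], and the terms tend to 0 wherever it is finite. *)
Lemma ae_subsequence (f_ : nat -> T -> R) : (forall n, measurable_fun D (f_ n)) ->
  (forall n x, D x -> 0 <= f_ n x) ->
  (fun n => \int[mu]_(x in D) (f_ n x)%:E)%E @ \oo --> 0%E ->
  exists (s : nat -> nat) (h : T -> R), mu.-integrable D (EFin \o h) /\
    {ae mu, forall x, D x -> (fun n => f_ (s n) x) @ \oo --> (0 : R) /\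
       forall n, 0 <= f_ (s n) x <= h x}.
Proof.
move=> mf f0 f_0.
have /choice[s sP] : forall n : nat, exists m : nat,
    (\int[mu]_(x in D) (f_ m x)%:E <= (1 / (2 ^ n.+1)%:R)%:E)%E.
  move=> n; have e0 : (0 < (1 / (2 ^ n.+1)%:R)%:E :> \bar R)%E.
    by rewrite lte_fin divr_gt0// ltr0n expn_gt0.
  have : \forall m \near \oo, (\int[mu]_(x in D) (f_ m x)%:E < (1 / (2 ^ n.+1)%:R)%:E)%E.
    exact: cvge0_near_lt.
  by move=> [M _ /(_ M (leqnn M))]/= /ltW; exists M.
pose hE x := (\sum_(0 <= n <oo) (f_ (s n) x)%:E)%E.
have mh : measurable_fun D hE.
  apply: (@ge0_emeasurable_sum _ _ _ D (fun n x => (f_ (s n) x)%:E) xpredT) => //.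
    by move=> k x Dx _; rewrite lee_fin f0.
  by move=> k _; exact/measurable_EFinP.
have hE0 x : D x -> (0 <= hE x)%E.
  by move=> Dx; apply: nneseries_ge0 => n _ _; rewrite lee_fin f0.
have ih : mu.-integrable D hE.
  apply/integrableP; split => //.
  rewrite (eq_integral hE); last by move=> x /[!inE] Dx; rewrite gee0_abs// hE0.
  rewrite integral_nneseries//; last 2 first.
    by move=> n; exact/measurable_EFinP.
    by move=> n x Dx; rewrite lee_fin f0.
  apply: (@le_lt_trans _ _ 1%:E); last exact: ltry.
  apply: le_trans (epsilon_trick0 xpredT (@ler01 R)).
  apply: lee_nneseries => [n _ _|n _]; last exact: sP.
  by apply: integral_ge0 => x Dx; rewrite lee_fin f0.
have fin := integrable_ae mD ih.
(* [fine] sends an infinite sum to 0, which changes the majorant only on a negligible set. *)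
exists s, (fine \o hE); split.
  apply/integrableP; split.
    by apply/measurable_EFinP; apply: measurableT_comp mh => //; exact: measurable_fine.
  have /integrableP[_] := ih; apply: le_lt_trans.
  apply: ae_ge0_le_integral => //.
  - apply: measurableT_comp => //; apply/measurable_EFinP.
    by apply: measurableT_comp mh => //; exact: measurable_fine.
  - exact: measurableT_comp.
  - by apply: filterS fin => x fx Dx /=; rewrite -[in leRHS](fineK (fx Dx)).
apply: filterS fin => x fx Dx.
have f0' n : true -> (0 <= (f_ (s n) x)%:E)%E by move=> _; rewrite lee_fin f0.
have hlt : (hE x < +oo)%E by rewrite ltey_eq fx.
split; last first.
  move=> n; rewrite f0//= -lee_fin fineK ?fx//.
  apply: le_trans (nneseries_lim_ge n.+1 _); last by move=> k _ _; exact: f0'.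
  rewrite big_nat_recr//= leeDr//; apply: sume_ge0 => k _; exact: f0'.
have tl := nneseries_tail_cvg hlt (fun k _ => f0' k isT).
have c0 : (fun n => (f_ (s n) x)%:E) @ \oo --> 0%E.
  apply: (@squeeze_cvge _ _ _ _ (fun=> 0%E) _ _ _ _ _ tl); last exact: cvg_cst.
  apply: nearW => n; rewrite f0'//=.
  apply: le_trans (nneseries_lim_ge n.+1 _); last by move=> k _ _; exact: f0'.
  by rewrite big_nat1.
by have /fine_cvgP[_] := c0.
Qed.

End integral_tools.

(** * Almost everywhere form of the convergence defining W^{1,p}_0 *)

Section sobolev_approx.
Variables (R : realType) (N : nat).
Local Notation V := 'rV[R]_N.
Local Notation mu := (lebesgue_rV R N).
Variables (Omega : set V) (p : R).
Hypothesis oOmega : open Omega.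
Hypothesis p0 : 0 < p.

Let mO : measurable Omega.
Proof. exact: open_measurable_rV. Qed.

Lemma measurable_norm_rV (D : set V) (F : V -> V) : measurable_fun D F ->
  measurable_fun D (fun x => `|F x|).
Proof.
move=> mF; apply: (measurableT_comp (f := fun y : V => `|y|)) => //.
by apply: continuous_measurable_rV; exact: norm_continuous.
Qed.

Lemma measurable_powR_comp (D : set V) (f : V -> R) (r : R) : measurable_fun D f ->
  measurable_fun D (fun x => f x `^ r).
Proof. by move=> mf; exact: (measurableT_comp (measurable_powR r) mf). Qed.

Lemma measurable_enorm (D : set V) (F : V -> V) : measurable_fun D F ->
  measurable_fun D (fun x => enorm (F x)).
Proof.
move=> mF; apply: (measurableT_comp (f := @enorm R N)) => //.
apply: continuous_measurable_rV => x.
apply: (@continuous_comp _ _ _ (fun x : V => dotp x x) (@Num.sqrt R)).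
  apply: (@Ck_continuous _ _ 0).
  by apply: Ck_sum => i; apply: CkM; exact: Ck_coord.
exact: sqrt_continuous.
Qed.

Lemma measurable_fun_coord (D : set V) (F : V -> V) : measurable D ->
  (forall i, measurable_fun D (fun x => F x ord0 i)) -> measurable_fun D F.
Proof.
move=> mD mc _; apply: (@measurability _ _ _ _ _ _
   (\big[setU/set0]_(i < N) preimage_set_system setT (fun x : V => x ord0 i) measurable)).
  by [].
move=> _ [B + <-]; rewrite -bigcup_seq => -[i _ [A mA <-]].
have := mc i mD A mA; congr measurable; apply/seteqP; split => x [Dx]/=.
  by move=> h; split => //; split.
by move=> [_ h]; split.
exact: mD.
Qed.

Lemma measurable_coord_comp (D : set V) (F : V -> V) i : measurable_fun D F ->
  measurable_fun D (fun x => F x ord0 i).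
Proof. by move=> mF; exact: (measurableT_comp (measurable_coord i) mF). Qed.

Lemma measurable_subV (D : set V) (F G : V -> V) : measurable D ->
  measurable_fun D F -> measurable_fun D G -> measurable_fun D (fun x => F x - G x).
Proof.
move=> mD mF mG; apply: measurable_fun_coord => // i.
under eq_fun do rewrite !mxE.
by apply: measurable_funB; exact: measurable_coord_comp.
Qed.

Lemma Lp_normE w : Lp_norm Omega p w =
  ((\int[mu]_(x in Omega) (`|w x| `^ p)%:E) `^ p^-1)%E.
Proof.
rewrite /Lp_norm unlock; congr (_ `^ _)%E.
rewrite [RHS]integral_mkcond; apply: eq_integral => x _.
rewrite /patch; case: ifPn => _ /=; first by [].
by rewrite normr0 powR0// gt_eqF.
Qed.

Lemma poweR_le_inv (I : \bar R) (e a : R) : (0 <= I)%E -> 0 < e -> 0 < a ->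
  (I `^ a <= (e `^ a)%:E)%E -> (I <= e%:E)%E.
Proof.
case: I => [r|_ _ a0|//]; last by rewrite poweRyr ?gt_eqF.
rewrite poweR_EFin !lee_fin => r0 e0 a0; apply: contraTT; rewrite -!ltNge => er.
by apply: gt0_ltr_powR; rewrite ?nnegrE// ltW.
Qed.

Lemma Lp_norm_cvg0 (w : nat -> V -> R) :
  (fun n => Lp_norm Omega p (w n)) @ \oo --> 0%E <->
  (fun n => \int[mu]_(x in Omega) (`|w n x| `^ p)%:E)%E @ \oo --> 0%E.
Proof.
have i0 n : (0 <= \int[mu]_(x in Omega) (`|w n x| `^ p)%:E)%E.
  by apply: integral_ge0 => x _; rewrite lee_fin powR_ge0.
split=> h.
  apply: cvge0_intro => // e e0.
  have : \forall n \near \oo, (Lp_norm Omega p (w n) < (e `^ p^-1)%:E)%E.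
    by apply: cvge0_near_lt => //; rewrite lte_fin powR_gt0.
  by apply: filterS => n; rewrite Lp_normE => /ltW; apply: poweR_le_inv; rewrite ?invr_gt0.
apply: cvge0_intro => [n|e e0]; first by rewrite Lp_normE poweR_ge0.
have : \forall n \near \oo, (\int[mu]_(x in Omega) (`|w n x| `^ p)%:E < (e `^ p)%:E)%E.
  by apply: cvge0_near_lt => //; rewrite lte_fin powR_gt0.
apply: filterS => n; rewrite Lp_normE => /ltW le1.
apply: (poweR_le_inv _ e0 p0); first exact: poweR_ge0.
by rewrite -poweRrM mulVf ?gt_eqF// poweRe1.
Qed.

(* A.e. and dominated form of the convergence in the definition of [W01p] *)
Definition approximated (u : V -> R) (Du : V -> V) (phi : nat -> V -> R) (h : V -> R) :=
  [/\ forall n, test_function Omega (phi n), mu.-integrable Omega (EFin \o h) &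
    {ae mu, forall x, Omega x ->
      [/\ phi ^~ x @ \oo --> u x, (fun n => grad (phi n) x) @ \oo --> Du x,
        forall n, `|phi n x - u x| `^ p <= h x &
        forall n, `|grad (phi n) x - Du x| `^ p <= h x]}].

Lemma test_measurable (D : set V) f : test_function Omega f -> measurable_fun D f.
Proof.
move=> [sf _ _]; apply: measurable_funS (continuous_measurable_rV (sf 0%N)) => //.
Qed.

Lemma test_grad_measurable (D : set V) f : test_function Omega f -> measurable_fun D (grad f).
Proof.
move=> [sf _ _]; apply: measurable_funS (continuous_measurable_rVrV (continuous_grad (sf 1%N))) => //.
Qed.

(** The subsequence is extracted from the sum of the p-th powers of both errors, so that one
    subsequence and one majorant serve the function and its gradient. *)
Lemma W01p_approximated u Du : W01p Omega p u Du ->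
  exists phi h, approximated u Du phi h.
Proof.
move=> [meas_u mDu [phi [tphi /Lp_norm_cvg0 c1 /Lp_norm_cvg0 c2]]].
pose f n x := `|phi n x - u x| `^ p + `|grad (phi n) x - Du x| `^ p.
have m1 n : measurable_fun Omega (fun x => `|phi n x - u x| `^ p).
  apply: measurable_powR_comp.
  apply: measurableT_comp => //; apply: measurable_funB => //.
  exact: test_measurable.
have m2 n : measurable_fun Omega (fun x => `|grad (phi n) x - Du x| `^ p).
  apply: measurable_powR_comp.
  by apply: measurable_norm_rV; apply: measurable_subV => //; exact: test_grad_measurable.
have m3 n : measurable_fun Omega (fun x => enorm (grad (phi n) x - Du x)).
  by apply: measurable_enorm; apply: measurable_subV => //; exact: test_grad_measurable.
have mf n : measurable_fun Omega (f n) by exact: measurable_funD.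
have f0 n x : Omega x -> 0 <= f n x by rewrite addr_ge0 ?powR_ge0.
have [|s [h [ih H]]] := ae_subsequence mO mf f0 (mu := mu).
  have := cvgeD (isT : ((0 : \bar R) +? 0)%E) c1 c2; rewrite adde0 => /(_ _) c.
  apply: (@squeeze_cvge _ _ _ _ (fun=> 0%E) _ _ _ _ _ c); last exact: cvg_cst.
  apply: nearW => n; rewrite integral_ge0/=; last first.
    by move=> x Ox; rewrite lee_fin f0.
  under eq_integral do rewrite EFinD.
  rewrite ge0_integralD//; last 2 first.
    exact/measurable_EFinP.
    exact/measurable_EFinP.
  apply: leeD => //; apply: ge0_le_integral => //.
  - exact/measurable_EFinP.
  - apply/measurable_EFinP; apply: measurable_powR_comp.
    exact: measurableT_comp.
  - move=> x _; rewrite lee_fin; apply: ge0_ler_powR; rewrite ?nnegrE//; first exact: ltW.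
    by apply: le_trans (norm_le_enorm _) _; exact: ler_norm.
exists (phi \o s), h; split => //.
  by move=> n; exact: tphi.
apply: filterS H => x H Ox; have {H} [c0 hb] := H Ox.
have aux (g : nat -> R) : (forall n, 0 <= g n) ->
    (forall n, g n `^ p <= f (s n) x) -> g @ \oo --> (0 : R).
  move=> g0 gf.
  have gp0 : (fun n => g n `^ p) @ \oo --> (0 : R).
    apply: (@squeeze_cvgr _ _ _ _ (fun=> 0) _ _ _ _ _ c0); last exact: cvg_cst.
    by apply: nearW => n; rewrite powR_ge0 gf.
  have := @cvg_powR _ (fun n => g n `^ p) 0 p^-1.
  rewrite invr_gt0 p0 powR0 ?invr_eq0 ?gt_eqF// => /(_ isT (fun n => powR_ge0 _ _) gp0).
  by under eq_fun do rewrite -powRrM mulfV ?gt_eqF// powRr1//.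
split.
- apply/subr_cvg0/norm_cvg0P; apply: aux => // n; rewrite /f /= lerDl powR_ge0//.
- apply/subr_cvg0/norm_cvg0P; apply: aux => // n; rewrite /f /= lerDr powR_ge0//.
- by move=> n; have /andP[_] := hb n; apply: le_trans; rewrite lerDl powR_ge0.
- by move=> n; have /andP[_] := hb n; apply: le_trans; rewrite lerDr powR_ge0.
Qed.

(** Converse by dominated convergence. With [W01p_approximated] it reduces closure properties of
    W^{1,p}_0 to pointwise limits and a majorant. *)
Lemma approximated_W01p u Du phi h : measurable_fun Omega u -> measurable_fun Omega Du ->
  approximated u Du phi h -> W01p Omega p u Du.
Proof.
move=> meas_u mDu [tphi ih H]; split => //; exists phi; split => //.
  apply/Lp_norm_cvg0.
  have [] := @dct_real _ _ _ mu _ mO (fun n x => `|phi n x - u x| `^ p) (fun=> 0) h _ _ ih.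
  - move=> n; apply: measurable_powR_comp.
    apply: measurableT_comp => //; apply: measurable_funB => //.
    exact: test_measurable.
  - exact: measurable_cst.
  - apply: filterS H => x H Ox; have [c _ b _] := H Ox; split; last first.
      by move=> n; rewrite ger0_norm ?powR_ge0// b.
    rewrite -(powR0 (lt0r_neq0 p0)); apply: cvg_powR => //.
    by apply/norm_cvg0P/subr_cvg0.
  by rewrite integral0.
apply/Lp_norm_cvg0.
have [] := @dct_real _ _ _ mu _ mO (fun n x => `|enorm (grad (phi n) x - Du x)| `^ p) (fun=> 0)
    (fun x => N%:R `^ p * h x) _ _ (intgZ mO _ ih).
- move=> n; apply: measurable_powR_comp.
  apply: measurableT_comp => //; apply: measurable_enorm; apply: measurable_subV => //.
  exact: test_grad_measurable.
- exact: measurable_cst.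
- apply: filterS H => x H Ox; have [_ c _ b] := H Ox.
  have le n : `|enorm (grad (phi n) x - Du x)| `^ p <= N%:R `^ p * `|grad (phi n) x - Du x| `^ p.
    rewrite -powRM//; apply: ge0_ler_powR; rewrite ?nnegrE ?mulr_ge0//.
      exact: ltW.
    by rewrite ger0_norm ?sqrtr_ge0// enorm_le_norm.
  split; last first.
    move=> n; rewrite ger0_norm ?powR_ge0// (le_trans (le n))//.
    by rewrite ler_wpM2l ?powR_ge0.
  have c' : (fun n => N%:R `^ p * `|grad (phi n) x - Du x| `^ p) @ \oo --> (0 : R).
    rewrite -(mulr0 (N%:R `^ p)); apply: cvgMr.
    rewrite -(powR0 (lt0r_neq0 p0)); apply: cvg_powR => //.
    by apply/norm_cvg0P/subr_cvg0.
  apply: (@squeeze_cvgr _ _ _ _ (fun=> 0) _ _ _ _ _ c'); last exact: cvg_cst.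
  by apply: nearW => n; rewrite powR_ge0 le.
by rewrite integral0.
Qed.

End sobolev_approx.

(** * Convex homogeneous integrands *)

Lemma gt0_powRD (R : realType) (x r s : R) : 0 < x -> x `^ (r + s) = x `^ r * x `^ s.
Proof. by move=> x0; rewrite powRD// (gt_eqF x0) implybT. Qed.

(** Concavity of y^a, read off Young's inequality for the product y^a times 1 with exponents 1/a and
    1/(1-a). *)
Lemma powR_bernoulli (R : realType) (y a : R) : 0 <= y -> 0 <= a -> a <= 1 ->
  y `^ a <= a * y + (1 - a).
Proof.
move=> y0 a0 a1; move: a0; rewrite le_eqVlt => /predU1P[<-|a0].
  by rewrite powRr0 mul0r add0r subr0.
move: a1; rewrite le_eqVlt => /predU1P[->|a1].
  by rewrite powRr1// mul1r subrr addr0.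
have := @conjugate_powR R (y `^ a) 1 a^-1 (1 - a)^-1.
rewrite powR_ge0 !invr_gt0 a0 subr_gt0 a1 !invrK addrCA subrr addr0 ler01.
move=> /(_ isT isT isT isT erefl); rewrite mulr1 powR1 -powRrM mulfV ?gt_eqF//.
by rewrite powRr1// mulrC mul1r.
Qed.

Section homogeneous_convex.
Variables (R : realType) (N : nat).
Local Notation V := 'rV[R]_N.
Variables (p : R) (H : V -> R).
Hypothesis hp : 1 < p.
Hypothesis hH0 : forall z, 0 <= H z.
Hypothesis hHC1 : Ck 1 H.
Hypothesis hHconv : @convex_function R V setT H.
Hypothesis hHhom : p_homogeneous p H.

Let p0 : 0 < p. Proof. exact: lt_trans hp. Qed.

Let dH z : differentiable H z. Proof. by have [] := hHC1. Qed.

Lemma directional_limit (z v : V) :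
  (fun h => h^-1 * (H (h *: v + z) - H z)) @ (0 : R)^' --> dotp (grad H z) v.
Proof. by rewrite -derive_dotp//; exact: (diff_derivable (dH z)). Qed.

(** Both sides are limits of the same difference quotient of H along the ray of z: homogeneity
    evaluates H((1 + h) z) as (1 + h)^p H z for |h| < 1. *)
Lemma euler_identity z : dotp (grad H z) z = p * H z.
Proof.
have c1 := @directional_limit z z.
have [dp pv] := @is_derive1_powR R p 1 (ltr01).
have c2 : (fun h : R => h^-1 * ((h + 1) `^ p - 1 `^ p)) @ (0 : R)^' --> p.
  have c0 : (fun h : R => h^-1 *: (((@powR R ^~ p) \o shift 1) (h *: (1 : R)) - 1 `^ p)) @ (0 : R)^' -->
      'D_1 (@powR R ^~ p) 1 := dp.
  rewrite pv !powR1 mulr1 in c0; rewrite powR1.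
  apply: cvg_trans c0; apply: near_eq_cvg; apply: nearW => h /=.
  by rewrite [h *: 1]mulr1.
have c3 : (fun h : R => h^-1 * (H (h *: z + z) - H z)) @ (0 : R)^' --> p * H z.
  have c4 : (fun h : R => h^-1 * ((h + 1) `^ p - 1 `^ p) * H z) @ (0 : R)^' --> p * H z.
    by apply: cvgMl.
  apply: cvg_trans c4; apply: near_eq_cvg; near=> h.
  have h1 : 0 < h + 1.
    have : `|h| < 1 by near: h; apply: dnbhs0_lt.
    by rewrite ltr_norml => /andP[? _]; lra.
  rewrite /= -{3}(scale1r z) -scalerDl hHhom gtr0_norm// powR1; ring.
exact: (cvg_unique (@Rhausdorff R) c1 c3).
Unshelve. all: by end_near. Qed.

(** By convexity the quotient along the segment from z to w is at most H w - H z for 0 < h <= 1, so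
    a limit from the right suffices. *)
Lemma tangent_le z w : dotp (grad H z) (w - z) <= H w - H z.
Proof.
have c := cvg_dnbhs_at_right (@directional_limit z (w - z)).
have cc := cvgP _ c.
rewrite -(cvg_lim (@Rhausdorff R) c); apply: limr_le => //; near=> h.
have h0 : 0 < h by [].
have h1 : h <= 1 by near: h; exact: nbhs_right_le.
rewrite ler_pdivrMl//.
have le : H (h *: w + (1 - h) *: z) <= h * H w + (1 - h) * H z.
  exact: (hHconv (Itv01 (ltW h0) h1) (in_setT w) (in_setT z)).
have -> : h *: (w - z) + z = h *: w + (1 - h) *: z.
  by rewrite scalerBr scalerBl scale1r -addrA; congr (_ + _); rewrite addrC.
apply: (@le_trans _ _ ((h * H w + (1 - h) * H z) - H z)); first by rewrite lerD2r.
by rewrite le_eqVlt; apply/orP; left; apply/eqP; ring.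
Unshelve. all: by end_near. Qed.

(** A weighted Young inequality that avoids the convex conjugate of H: the tangent inequality from z
    to t y, simplified by Euler's identity. *)
Lemma dotp_grad_le z y t : 0 < t ->
  t * dotp (grad H z) y <= (p - 1) * H z + t `^ p * H y.
Proof.
move=> t0; have := tangent_le z (t *: y).
rewrite dotpDr dotpZr -[- z]scaleN1r dotpZr euler_identity hHhom gtr0_norm//.
lra.
Qed.

(** The previous bound with t = 1 for y and for -y, H being even. It makes the pairing in the weak
    equation integrable. *)
Lemma dotp_grad_abs z y : `|dotp (grad H z) y| <= (p - 1) * H z + H y.
Proof.
have h1 := @dotp_grad_le z y 1 ltr01.
have := @dotp_grad_le z (- y) 1 ltr01.
have -> : H (- y) = H y by rewrite -scaleN1r hHhom normrN1 powR1 mul1r.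
move: h1; rewrite -[- y]scaleN1r dotpZr !powR1 !mul1r ler_norml; lra.
Qed.

(* Picone-type inequality: Young's inequality with the weight [t] chosen so that
   [t ^ (p - 1) = (k * X) ^ (1 - m)]. *)
Lemma picone_pointwise (m k X : R) z y : 1 < m -> m <= p -> 0 < k -> 0 < X ->
  m * X `^ (m - 1) * (p^-1 * dotp (grad H z) y) <=
  (m - 1) * k * X `^ m * H z
  + k `^ (1 - m) * ((m / p) * H y + (1 - m / p) * H z).
Proof.
move=> m1 mp k0 X0.
have p1 : 0 < p - 1 by rewrite subr_gt0.
have m0 : 0 < m by exact: lt_trans m1.
have powp (s : R) : 0 < s -> s `^ p = s * s `^ (p - 1).
  move=> s0; rewrite -[X in X * _](powRr1 (ltW s0)) -gt0_powRD//.
  by congr (s `^ _); ring.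
have Z0 : 0 < k * X by exact: mulr_gt0.
pose Z := k * X; pose t := Z `^ (- (m - 1) / (p - 1)).
have t0 : 0 < t by exact: powR_gt0.
have := @dotp_grad_le z y t t0; set c := dotp _ _ => H1.
have tp1 : t `^ (p - 1) = Z `^ (1 - m).
  by rewrite -powRrM -mulrA mulVf ?gt_eqF// mulr1 opprB.
have tp : t `^ p = t * Z `^ (1 - m).
  by rewrite -tp1; exact: powp.
have H2 : c <= (p - 1) * H z * t^-1 + Z `^ (1 - m) * H y.
  rewrite -(ler_pM2l t0); apply: (le_trans H1); rewrite tp le_eqVlt; apply/orP; left.
  by apply/eqP; field; rewrite gt_eqF.
have ti : t^-1 = Z `^ ((m - 1) / (p - 1)) by rewrite -powRN; congr (_ `^ _); ring.
have kX : k `^ (1 - m) * Z `^ (m - 1) = X `^ (m - 1).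
  rewrite powRM ?ltW// mulrA -gt0_powRD//.
  by rewrite (_ : 1 - m + (m - 1) = 0) ?powRr0 ?mul1r//; ring.
have ZZ : Z `^ (m - 1) * Z `^ (1 - m) = 1.
  by rewrite -[1 - m]opprB powRN mulfV// gt_eqF ?powR_gt0.
have kXm : k * X `^ m = k `^ (1 - m) * Z `^ m.
  rewrite powRM ?ltW// mulrA -gt0_powRD//.
  by rewrite (_ : 1 - m + m = 1) ?powRr1 ?ltW//; ring.
(* The exponent for which Z^(m-1) / t = (Z^m)^a. It is at most 1 precisely because m <= p, and
   Bernoulli's inequality then replaces (Z^m)^a by an affine function of Z^m. *)
pose a := (m - 1) * p / (m * (p - 1)).
have a0 : 0 <= a.
  by apply: divr_ge0; apply: mulr_ge0; lra.
have a1 : a <= 1.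
  by rewrite ler_pdivrMr ?mulr_gt0// mul1r; lra.
have Ba := @powR_bernoulli R (Z `^ m) a (powR_ge0 _ _) a0 a1.
have Zt : Z `^ (m - 1) * t^-1 = (Z `^ m) `^ a.
  rewrite ti -gt0_powRD// -powRrM; congr (Z `^ _).
  by rewrite /a; field; rewrite !gt_eqF.
have X1 : 0 <= X `^ (m - 1) by exact: powR_ge0.
have K1 : 0 <= k `^ (1 - m) by exact: powR_ge0.
apply: (@le_trans _ _ (m * X `^ (m - 1) * (p^-1 * ((p - 1) * H z * t^-1 + Z `^ (1 - m) * H y)))).
  rewrite ler_wpM2l ?mulr_ge0 ?(ltW m0)// ler_wpM2l ?invr_ge0 ?(ltW p0)//.
have -> : m * X `^ (m - 1) * (p^-1 * ((p - 1) * H z * t^-1 + Z `^ (1 - m) * H y)) =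
    k `^ (1 - m) * ((m / p) * H y + (m / p) * (p - 1) * (Z `^ m) `^ a * H z).
  rewrite -Zt -kX.
  transitivity (k `^ (1 - m) * (m / p * H y * (Z `^ (m - 1) * Z `^ (1 - m)) +
     m / p * (p - 1) * (Z `^ (m - 1) / t) * H z)).
    by field; rewrite !gt_eqF.
  by rewrite ZZ mulr1.
have -> : (m - 1) * k * X `^ m * H z = k `^ (1 - m) * ((m - 1) * Z `^ m * H z).
  by rewrite -(mulrA (m - 1)) kXm; ring.
rewrite -mulrDr ler_wpM2l//.
(* The value of [a] gives (m/p)(p-1)a = m - 1 and (m/p)(p-1)(1-a) = 1 - m/p, so the affine bound
   reproduces the two coefficients exactly. *)
have -> : (m - 1) * Z `^ m * H z + (m / p * H y + (1 - m / p) * H z) =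
  m / p * H y + (m / p) * (p - 1) * (a * Z `^ m + (1 - a)) * H z.
  by rewrite /a; field; rewrite !gt_eqF.
rewrite lerD2l ler_wpM2r// ler_wpM2l// mulr_ge0 ?(ltW p1)// divr_ge0 ?ltW//.
Qed.

End homogeneous_convex.

(** * Integrability, scaling and composition in W^{1,p}_0 *)

Section sobolev_ops.
Variables (R : realType) (N : nat).
Local Notation V := 'rV[R]_N.
Local Notation mu := (lebesgue_rV R N).
Variables (Omega : set V) (p : R).
Hypothesis oOmega : open Omega.
Hypothesis Ofin : (mu Omega < +oo)%E.
Hypothesis p0 : 0 < p.

Let mO : measurable Omega.
Proof. exact: open_measurable_rV. Qed.

Lemma W01p_measurable u Du : W01p Omega p u Du ->
  measurable_fun Omega u /\ measurable_fun Omega Du.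
Proof. by case. Qed.

Lemma powR_distD (W : normedZmodType R) (a b : W) : `|a| `^ p <= 2 `^ p * (`|b - a| `^ p + `|b| `^ p).
Proof.
apply: le_trans (powR_addle _ _ (ltW p0)) => //.
apply: ge0_ler_powR; rewrite ?nnegrE ?addr_ge0//; first exact: ltW.
by rewrite -{1}(subrK b a) (le_trans (ler_normD _ _))// distrC.
Qed.

(** One approximant is enough: phi_0 and its gradient are bounded, Omega has finite measure, and the
    p-th powers of the differences lie below h. *)
Lemma W01p_Lp u Du : W01p Omega p u Du ->
  mu.-integrable Omega (EFin \o (fun x => `|u x| `^ p)) /\
  mu.-integrable Omega (EFin \o (fun x => `|Du x| `^ p)).
Proof.
move=> W; have [meas_u mDu] := W01p_measurable W.
have [phi [h [tphi ih H]]] := W01p_approximated oOmega p0 W.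
have [M M0 bM] := test_function_bounded (tphi 0%N).
have iM : mu.-integrable Omega (EFin \o (fun x => 2 `^ p * (h x + M `^ p))).
  by apply: intgZ => //; apply: intgD => //; exact: intg_cst.
have pM t : 0 <= t <= M -> t `^ p <= M `^ p.
  by move=> /andP[t0 tM]; apply: ge0_ler_powR; rewrite ?nnegrE// ltW.
split; apply: (intg_le_ae mO _ iM).
- by apply: measurable_powR_comp; exact: measurableT_comp.
- apply: filterS H => x H Ox; have [_ _ h1 _] := H Ox.
  rewrite ger0_norm ?powR_ge0// (le_trans (powR_distD _ (phi 0%N x)))//.
  by rewrite ler_wpM2l ?powR_ge0// lerD// pM// normr_ge0 (bM x).1.
- by apply: measurable_powR_comp; exact: measurable_norm_rV.
- apply: filterS H => x H Ox; have [_ _ _ h1] := H Ox.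
  rewrite ger0_norm ?powR_ge0// (le_trans (powR_distD _ (grad (phi 0%N) x)))//.
  by rewrite ler_wpM2l ?powR_ge0// lerD// pM// normr_ge0 (bM x).2.
Qed.

Lemma W01p_scale (c : R) u Du : W01p Omega p u Du ->
  W01p Omega p (fun x => u x * c) (fun x => c *: Du x).
Proof.
move=> W; have [meas_u mDu] := W01p_measurable W.
have [phi [h [tphi ih H]]] := W01p_approximated oOmega p0 W.
have mZ : measurable_fun Omega (fun x => c *: Du x).
  apply: (measurableT_comp (f := fun z : V => c *: z)) => //.
  by apply: continuous_measurable_rVrV; exact: scaler_continuous.
apply: (@approximated_W01p _ _ _ _ oOmega p0 _ _ (fun n x => phi n x * c) (fun x => `|c| `^ p * h x)) => //.
  by apply: measurable_funM => //; exact: measurable_cst.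
have gE n x : grad (fun x => phi n x * c) x = c *: grad (phi n) x.
  have [sphi _ _] := tphi n; have [d _] := sphi 1%N.
  rewrite gradM//.
  rewrite (_ : grad (fun=> c) x = 0) ?scaler0 ?add0r//.
  by apply/rowP => i; rewrite !mxE; exact: derive_cst.
split.
- move=> n; have [sphi _ _] := tphi n.
  apply: (test_function_sub (tphi n)) => [k|x].
    by apply: CkM => //; exact: Ck_cst.
  by apply: contra_neq => ->; rewrite mul0r.
- exact: intgZ.
- apply: filterS H => x H Ox; have [c1 c2 h1 h2] := H Ox; split.
  + by apply: cvgMl.
  + by under eq_fun do rewrite gE; apply: cvgZr.
  + move=> n; rewrite -mulrBl normrM mulrC powRM// ler_wpM2l ?powR_ge0//.
  + move=> n; rewrite gE -scalerBr normrZ powRM// ler_wpM2l ?powR_ge0//.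
Qed.

(** The factor [zeta] supplies the compact support, so G(0) need not vanish. The hypotheses on G
    concern the whole line because the approximants of u take arbitrary values. *)
Lemma W01p_mul (zeta : V -> R) (G g : R -> R) (M : R) u Du :
  test_function Omega zeta ->
  (forall f : V -> R, (forall k, Ck k f) -> forall k, Ck k (G \o f)) ->
  (forall t, is_derive t (1 : R) G (g t)) -> continuous g ->
  (forall t, `|G t| <= M) -> (forall t, `|g t| <= M) ->
  W01p Omega p u Du ->
  W01p Omega p (fun x => G (u x) * zeta x)
    (fun x => G (u x) *: grad zeta x + (zeta x * g (u x)) *: Du x).
Proof.
move=> tz sG dG cg GM gM W; have [meas_u mDu] := W01p_measurable W.
have [iu iDu] := W01p_Lp W.
have [phi [h [tphi ih H]]] := W01p_approximated oOmega p0 W.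
have [K K0 bK] := test_function_bounded tz.
have M0 : 0 <= M by exact: le_trans (GM 0).
have cG : continuous G.
  by move=> t; apply: differentiable_continuous; apply/derivable1_diffP; have [] := dG t.
have mG : measurable_fun Omega (G \o u).
  by apply: measurableT_comp => //; exact: continuous_measurable_fun.
have mg : measurable_fun Omega (g \o u).
  by apply: measurableT_comp => //; exact: continuous_measurable_fun.
have mzeta : measurable_fun Omega zeta by exact: test_measurable tz.
have mgz : measurable_fun Omega (grad zeta) by exact: test_grad_measurable tz.
(* [a] bounds G(phi_n) - G(u) times zeta or its gradient, [b] the coefficient of |grad phi_n - Du| +
   2|Du|. Two uses of [powR_addle] turn the p-th power of the resulting sum into the majorant
   [h']. *)
pose a := 2 * (K * M); pose b := K * M.
have b0 : 0 <= b by exact: mulr_ge0.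
have a0 : 0 <= a by exact: mulr_ge0.
pose h' x := a `^ p + 2 `^ p * (a `^ p + b `^ p * (2 `^ p * (h x + 2 `^ p * `|Du x| `^ p))).
have ih' : mu.-integrable Omega (EFin \o h').
  apply: intgD => //; first exact: intg_cst.
  apply: intgZ => //; apply: intgD => //; first exact: intg_cst.
  by apply: intgZ => //; apply: intgZ => //; apply: intgD => //; exact: intgZ.
have gE n x : grad (fun x => G (phi n x) * zeta x) x =
    G (phi n x) *: grad zeta x + (zeta x * g (phi n x)) *: grad (phi n) x.
  have [sphi _ _] := tphi n; have [d _] := sphi 1%N.
  have [sz _ _] := tz; have [dz _] := sz 1%N.
  have [dGp _] := sG _ sphi 1%N.
  by rewrite (@gradM _ _ (G \o phi n) zeta)// (grad_comp (d x) (dG _)) scalerA.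
apply: (@approximated_W01p _ _ _ _ oOmega p0 _ _ (fun n x => G (phi n x) * zeta x) h').
- exact: measurable_funM.
- apply: measurable_fun_coord => // i; under eq_fun do rewrite !mxE.
  apply: measurable_funD; apply: measurable_funM => //; last exact: measurable_coord_comp.
    by have := measurable_coord_comp i mgz; under eq_fun do rewrite mxE.
  exact: measurable_funM.
split.
- move=> n; have [sphi _ _] := tphi n; have [sz _ _] := tz.
  apply: (test_function_sub tz) => [k|x].
    by apply: CkM => //; exact: sG.
  by apply: contra_neq => ->; rewrite mulr0.
- exact: ih'.
- apply: filterS H => x H Ox; have [c1 c2 h1 h2] := H Ox.
  have cGn : (fun n => G (phi n x)) @ \oo --> G (u x).
    by apply: (cvg_comp _ G c1); exact: cG.
  have cgn : (fun n => g (phi n x)) @ \oo --> g (u x).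
    by apply: (cvg_comp _ g c1); exact: cg.
  have h0 : 0 <= h x by apply: le_trans (h1 0%N); exact: powR_ge0.
  have D0 : 0 <= `|Du x| `^ p by exact: powR_ge0.
  have b2 n : `|(G (phi n x) - G (u x)) * zeta x| <= a.
    rewrite normrM [leRHS](_ : _ = (M + M) * K); last by rewrite /a; ring.
    by apply: ler_pM => //; [rewrite (le_trans (ler_normB _ _))// lerD//|exact: (bK x).1].
  have pmono s t : 0 <= s -> s <= t -> s `^ p <= t `^ p.
    by move=> s0 st; apply: ge0_ler_powR; rewrite ?nnegrE ?(le_trans s0 st)// ltW.
  have q0 : 0 <= 2 `^ p * (a `^ p + b `^ p * (2 `^ p * (h x + 2 `^ p * `|Du x| `^ p))).
    by rewrite !(mulr_ge0, addr_ge0, powR_ge0).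
  split.
  + by apply: cvgMl.
  + under eq_fun do rewrite gE; apply: cvgD; first by apply: cvgZl.
    by apply: cvgZ => //; apply: cvgMr.
  + move=> n; rewrite -mulrBl /h' (le_trans (pmono _ _ _ (b2 n)))// lerDl//.
  + move=> n; rewrite gE /h' (@le_trans _ _ (2 `^ p * (a `^ p + b `^ p * (2 `^ p * (h x + 2 `^ p * `|Du x| `^ p)))))//; last by rewrite lerDr powR_ge0.
    have -> : G (phi n x) *: grad zeta x + (zeta x * g (phi n x)) *: grad (phi n) x -
       (G (u x) *: grad zeta x + (zeta x * g (u x)) *: Du x) =
       (G (phi n x) - G (u x)) *: grad zeta x + zeta x *: (g (phi n x) *: grad (phi n) x - g (u x) *: Du x).
      by apply/rowP => i; rewrite !mxE; ring.
    apply: (@le_trans _ _ ((a + b * (`|grad (phi n) x - Du x| + 2 * `|Du x|)) `^ p)).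
      apply: pmono => //; apply: le_trans (ler_normD _ _) _; rewrite !normrZ; apply: lerD.
        rewrite [leRHS](_ : _ = (M + M) * K); last by rewrite /a; ring.
        by apply: ler_pM => //; [rewrite (le_trans (ler_normB _ _))// lerD//|exact: (bK x).2].
      rewrite /b -mulrA; apply: ler_pM => //; first exact: (bK x).1.
      apply: le_trans (ler_normB _ _) _; rewrite !normrZ.
      apply: (@le_trans _ _ (M * (`|grad (phi n) x - Du x| + `|Du x|) + M * `|Du x|)).
        apply: lerD; apply: ler_pM => //.
        by rewrite -{1}(subrK (Du x) (grad (phi n) x)) ler_normD.
      by rewrite le_eqVlt; apply/orP; left; apply/eqP; ring.
    apply: (le_trans (powR_addle _ _ (ltW p0))) => //.
      by rewrite mulr_ge0// addr_ge0// mulr_ge0.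
    rewrite ler_wpM2l ?powR_ge0// lerD2l powRM//.
    rewrite ler_wpM2l ?powR_ge0//; apply: (le_trans (powR_addle _ _ (ltW p0))) => //.
    by rewrite ler_wpM2l ?powR_ge0// powRM// lerD2r.
Qed.

End sobolev_ops.

(** * Regularised powers *)

Section regularisations.
Variable R : realType.
Implicit Types (e t m : R).

Lemma powR_div (a b r : R) : 0 < a -> 0 < b -> (a / b) `^ r = a `^ r * b `^ (- r).
Proof.
move=> a0 b0; rewrite powRM ?invr_ge0 ?ltW//; congr (_ * _).
by rewrite powRN -powR_inv1 ?ltW// -powRrM mulN1r powRN.
Qed.

Lemma powR_le_neg (a b r : R) : 0 < a -> a <= b -> 0 <= r -> b `^ (- r) <= a `^ (- r).
Proof.
move=> a0 ab r0; rewrite !powRN lef_pV2 ?posrE ?powR_gt0//; last exact: lt_le_trans ab.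
by apply: ge0_ler_powR; rewrite ?nnegrE ?(ltW a0)// (le_trans _ ab) ?ltW.
Qed.

(* Smooth substitutes for |t| and for e + max(t, 0).  As [posreg e] is bounded
   below by [e] on the whole line, its negative powers are C^1 with bounded
   derivative and can be composed with any element of W^{1,p}_0. *)
Definition absreg e t : R := (t ^+ 2 + e ^+ 2) `^ 2^-1.
Definition posreg e t : R := e + (t + absreg e t) / 2.
Definition dposreg e t : R := (1 + t / absreg e t) / 2.

Lemma sqr_sum_gt0 e t : 0 < e -> 0 < t ^+ 2 + e ^+ 2.
Proof. by move=> e0; rewrite ltr_wpDl ?sqr_ge0// exprn_gt0. Qed.

Lemma absreg_gt0 e t : 0 < e -> 0 < absreg e t.
Proof. by move=> e0; rewrite powR_gt0// sqr_sum_gt0. Qed.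

Lemma absregE e t : absreg e t = Num.sqrt (t ^+ 2 + e ^+ 2).
Proof. by rewrite /absreg powR12_sqrt// addr_ge0 ?sqr_ge0. Qed.

Lemma norm_le_absreg e t : `|t| <= absreg e t.
Proof. by rewrite absregE -sqrtr_sqr ler_wsqrtr// lerDl sqr_ge0. Qed.

Lemma absreg0 e : 0 < e -> absreg e 0 = e.
Proof. by move=> e0; rewrite absregE expr0n/= add0r sqrtr_sqr gtr0_norm. Qed.

Lemma eps_le_absreg e t : 0 < e -> e <= absreg e t.
Proof. by move=> e0; rewrite absregE -{1}(gtr0_norm e0) -sqrtr_sqr ler_wsqrtr// lerDr sqr_ge0. Qed.

Lemma is_derive_absreg e t : 0 < e -> is_derive t (1 : R) (absreg e) (t / absreg e t).
Proof.
move=> e0; have s0 := sqr_sum_gt0 t e0.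
have d1 : is_derive t (1 : R) (fun t : R => t ^+ 2 + e ^+ 2) (2 * t).
  have := is_deriveD (is_deriveX 2 (is_derive_id t (1 : R))) (is_derive_cst (e ^+ 2) t (1 : R)).
  have -> : (id ^+ 2 + cst (e ^+ 2) : R -> R) = (fun t : R => t ^+ 2 + e ^+ 2) by [].
  by move=> /is_derive_eq; apply; rewrite addr0 /GRing.scale/= mulr1 expr1.
have := @is_derive1_comp R (fun t => t `^ 2^-1) (fun t : R => t ^+ 2 + e ^+ 2) t _ _
  (is_derive1_powR 2^-1 s0) d1.
move=> /is_derive_eq; apply; rewrite /absreg.
rewrite (_ : 2^-1 - 1 = - 2^-1 :> R); last by field.
by rewrite powRN; field; rewrite gt_eqF ?powR_gt0.
Qed.

Lemma continuous_is_derive (F f : R -> R) : (forall t, is_derive t (1 : R) F (f t)) -> continuous F.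
Proof.
by move=> dF t; apply: differentiable_continuous; apply/derivable1_diffP; have [] := dF t.
Qed.

Lemma continuous_absreg e : 0 < e -> continuous (absreg e).
Proof.
move=> e0; apply: (continuous_is_derive (f := fun t => t / absreg e t)) => t; exact: is_derive_absreg.
Qed.

Lemma is_derive_posreg e t : 0 < e -> is_derive t (1 : R) (posreg e) (dposreg e t).
Proof.
move=> e0.
have := is_deriveD (is_derive_cst e t (1 : R))
  (is_deriveZ (2^-1) (is_deriveD (is_derive_id t (1 : R)) (is_derive_absreg t e0))).
have -> : cst e + 2^-1 \*: (id + absreg e) = posreg e.
  by apply/funext => s; rewrite /posreg/= !fctE /GRing.scale/= mulrC.
by move=> /is_derive_eq; apply; rewrite add0r /dposreg /GRing.scale/= mulrC.
Qed.

Lemma continuous_dposreg e : 0 < e -> continuous (dposreg e).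
Proof.
move=> e0 t; rewrite /dposreg; apply: cvgMl; apply: cvgD; first exact: cvg_cst.
apply: cvgM; first exact: cvg_id.
by apply: cvgV; [rewrite gt_eqF ?absreg_gt0|exact: continuous_absreg].
Qed.

Lemma posreg_ge e t : 0 < e -> t + e <= posreg e t.
Proof. move=> e0; rewrite /posreg; have := norm_le_absreg e t; have := ler_norm t; lra. Qed.

Lemma eps_le_posreg e t : 0 < e -> e <= posreg e t.
Proof.
move=> e0; rewrite /posreg; have := norm_le_absreg e t.
by have := ler_norm (- t); rewrite normrN; lra.
Qed.

Lemma posreg_gt0 e t : 0 < e -> 0 < posreg e t.
Proof. by move=> e0; apply: lt_le_trans (eps_le_posreg t e0). Qed.

(** The value on the zero set of u; the constant 3/2 reappears when [e] is chosen in
    [zero_dichotomy]. *)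
Lemma posreg0 e : 0 < e -> posreg e 0 = 3 / 2 * e.
Proof. by move=> e0; rewrite /posreg absreg0//; field. Qed.

Lemma dposreg_itv e t : 0 < e -> 0 <= dposreg e t <= 1.
Proof.
move=> e0; have s0 := absreg_gt0 t e0; have := norm_le_absreg e t.
rewrite ler_norml => /andP[h1 h2].
have : -1 <= t / absreg e t by rewrite ler_pdivlMr// mulN1r.
have : t / absreg e t <= 1 by rewrite ler_pdivrMr// mul1r.
by rewrite /dposreg; lra.
Qed.

Lemma dposreg_ge e t : 0 < e -> 0 <= t -> 1 / 2 <= dposreg e t.
Proof.
move=> e0 t0; have s0 := absreg_gt0 t e0.
have : 0 <= t / absreg e t by rewrite divr_ge0// ltW.
by rewrite /dposreg; lra.
Qed.

(* [powreg] is normalised to vanish at 0 so that it preserves compact supports. *)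
Definition negpow e m t : R := posreg e t `^ (1 - m).
Definition dnegpow e m t : R := (1 - m) * posreg e t `^ (- m) * dposreg e t.
Definition powreg e m t : R := absreg e t `^ m - e `^ m.

Lemma is_derive_negpow e m t : 0 < e -> is_derive t (1 : R) (negpow e m) (dnegpow e m t).
Proof.
move=> e0.
have := @is_derive1_comp R (fun t => t `^ (1 - m)) (posreg e) t _ _
  (is_derive1_powR (1 - m) (posreg_gt0 t e0)) (is_derive_posreg t e0).
by move=> /is_derive_eq; apply; rewrite (_ : 1 - m - 1 = - m)//; ring.
Qed.

Lemma continuous_dnegpow e m : 0 < e -> continuous (dnegpow e m).
Proof.
move=> e0 t; rewrite /dnegpow; apply: cvgM; last exact: continuous_dposreg.
apply: cvgMr.
apply: (@continuous_comp _ _ _ (posreg e) (fun s => s `^ (- m))).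
  by apply: (continuous_is_derive (f := dposreg e)) => s; exact: is_derive_posreg.
have dp := is_derive1_powR (- m) (posreg_gt0 t e0).
by apply: differentiable_continuous; apply/derivable1_diffP.
Qed.

Lemma negpow_bound e m t : 0 < e -> 1 < m -> `|negpow e m t| <= e `^ (1 - m).
Proof.
move=> e0 m1; rewrite ger0_norm ?powR_ge0// /negpow -opprB.
by apply: powR_le_neg => //; [exact: eps_le_posreg|rewrite subr_ge0 ltW].
Qed.

Lemma dnegpow_bound e m t : 0 < e -> 1 < m -> `|dnegpow e m t| <= (m - 1) * e `^ (- m).
Proof.
move=> e0 m1; have /andP[d0 d1] := dposreg_itv t e0.
have n1 : `|1 - m| = m - 1 by rewrite distrC ger0_norm// subr_ge0 ltW.
rewrite /dnegpow normrM [X in X * _]normrM n1 (ger0_norm d0) (ger0_norm (powR_ge0 _ _)).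
rewrite -mulrA ler_wpM2l ?subr_ge0 ?(ltW m1)// -[leRHS]mulr1.
apply: ler_pM => //; first exact: powR_ge0.
apply: powR_le_neg => //; [exact: eps_le_posreg|apply: ltW; exact: lt_trans m1].
Qed.

Lemma is_derive_powreg e m t : 0 < e ->
  is_derive t (1 : R) (powreg e m) (m * absreg e t `^ (m - 1) * (t / absreg e t)).
Proof.
move=> e0.
have := is_deriveB (@is_derive1_comp R (fun t => t `^ m) (absreg e) t _ _
  (is_derive1_powR m (absreg_gt0 t e0)) (is_derive_absreg t e0)) (is_derive_cst (e `^ m) t (1 : R)).
by move=> /is_derive_eq; apply; rewrite subr0.
Qed.

Lemma powreg_ge0 e m t : 0 < e -> 0 <= m -> 0 <= powreg e m t.
Proof.
move=> e0 m0; rewrite subr_ge0; apply: ge0_ler_powR; rewrite ?nnegrE ?(ltW e0)//.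
  by rewrite ltW// absreg_gt0.
exact: eps_le_absreg.
Qed.

Lemma powreg0 e m : 0 < e -> powreg e m 0 = 0.
Proof. by move=> e0; rewrite /powreg absreg0// subrr. Qed.

Lemma cvg_absreg (e : R^nat) s : e @ \oo --> (0 : R) -> (fun n => absreg (e n) s) @ \oo --> `|s|.
Proof.
move=> ce; under eq_fun do rewrite absregE; rewrite -sqrtr_sqr.
have c : (fun n => s ^+ 2 + e n * e n) @ \oo --> s ^+ 2 + 0 * 0.
  by apply: cvgD; [exact: cvg_cst|exact: cvgM].
rewrite mulr0 addr0 in c; rewrite (_ : (fun n => _) = (fun n => Num.sqrt (s ^+ 2 + e n * e n))); last by apply/funext => n; rewrite -expr2.
exact: (cvg_comp _ (@Num.sqrt R) c (@sqrt_continuous R _)).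
Qed.

Lemma cvg_posreg (e : R^nat) t : e @ \oo --> (0 : R) -> 0 < t ->
  (fun n => posreg (e n) t) @ \oo --> t.
Proof.
move=> ce t0; have c : (fun n => posreg (e n) t) @ \oo --> 0 + (t + `|t|) / 2.
  by apply: cvgD => //; apply: cvgMl; apply: cvgD; [exact: cvg_cst|exact: cvg_absreg].
by move: c; rewrite (_ : 0 + (t + `|t|) / 2 = t)// gtr0_norm//; field.
Qed.

(** At t = 0 the value is 1/2 for every e, so the limit 1 is specific to t > 0. *)
Lemma cvg_dposreg (e : R^nat) t : e @ \oo --> (0 : R) -> 0 < t ->
  (fun n => dposreg (e n) t) @ \oo --> (1 : R).
Proof.
move=> ce t0; have c : (fun n => dposreg (e n) t) @ \oo --> (1 + t / `|t|) / 2.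
  apply: cvgMl; apply: cvgD; first exact: cvg_cst.
  apply: cvgMr; apply: cvgV; first by rewrite normr_eq0 gt_eqF.
  exact: cvg_absreg.
by move: c; rewrite (_ : (1 + t / `|t|) / 2 = 1)// gtr0_norm// divff ?gt_eqF//; field.
Qed.

Lemma cvg_powR_gt0 (x : R^nat) (l r : R) : 0 < l -> x @ \oo --> l ->
  (fun n => x n `^ r) @ \oo --> l `^ r.
Proof.
move=> l0 xl; have c : {for l, continuous (fun t => t `^ r)}.
  apply: differentiable_continuous; apply/derivable1_diffP.
  by have [] := is_derive1_powR r l0.
exact: (cvg_comp x (fun t => t `^ r) xl c).
Qed.

Lemma cvg_negpow (e : R^nat) m t : e @ \oo --> (0 : R) -> 0 < t ->
  (fun n => negpow (e n) m t) @ \oo --> t `^ (1 - m).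
Proof. by move=> ce t0; apply: cvg_powR_gt0 => //; exact: cvg_posreg. Qed.

Lemma cvg_powreg (e : R^nat) m s : e @ \oo --> (0 : R) -> (forall n, 0 < e n) -> 0 < m ->
  (fun n => powreg (e n) m s) @ \oo --> `|s| `^ m.
Proof.
move=> ce e0 m0; rewrite -[X in _ --> X]subr0 -(powR0 (lt0r_neq0 m0)).
apply: cvgB; apply: cvg_powR => //; last by move=> n; exact: ltW.
  by move=> n; rewrite ltW// absreg_gt0.
exact: cvg_absreg.
Qed.

Lemma absreg_mono (e d s t : R) : 0 <= e <= d -> `|s| <= `|t| -> absreg e s <= absreg d t.
Proof.
move=> /andP[e0 ed] st; rewrite !absregE ler_wsqrtr//; apply: lerD.
  by rewrite -[leLHS]real_normK ?num_real// -[leRHS]real_normK ?num_real// ler_sqr ?nnegrE.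
by rewrite ler_sqr ?nnegrE// (le_trans e0).
Qed.

End regularisations.

Section smooth_regularisations.
Variables (R : realType) (N : nat).
Local Notation V := 'rV[R]_N.
Implicit Types (f : V -> R) (e m : R).

Lemma Ck_absreg k f e : 0 < e -> Ck k f -> Ck k (absreg e \o f).
Proof.
move=> e0 cf; apply: (@Ck_powR _ _ k (fun x => f x ^+ 2 + e ^+ 2) 2^-1).
  by move=> x; exact: sqr_sum_gt0.
by apply: CkD; [under eq_fun do rewrite expr2; exact: CkM|exact: Ck_cst].
Qed.

Lemma Ck_negpow k f e m : 0 < e -> Ck k f -> Ck k (negpow e m \o f).
Proof.
move=> e0 cf; apply: (@Ck_powR _ _ k (posreg e \o f)) => [x|]; first exact: posreg_gt0.
apply: CkD; first exact: Ck_cst.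
by apply: CkM; [apply: CkD => //; exact: Ck_absreg|exact: Ck_cst].
Qed.

Lemma Ck_powreg k f e m : 0 < e -> Ck k f -> Ck k (powreg e m \o f).
Proof.
move=> e0 cf; apply: CkD; last exact: Ck_cst.
apply: (@Ck_powR _ _ k (absreg e \o f)) => [x|]; first exact: absreg_gt0.
exact: Ck_absreg.
Qed.

Lemma test_powreg Omega f e m : 0 < e -> test_function Omega f ->
  test_function Omega (powreg e m \o f).
Proof.
move=> e0 tf; have [sf _ _] := tf; apply: (test_function_sub tf) => [k|x].
  exact: Ck_powreg.
by apply: contra_neq => /= ->; rewrite powreg0.
Qed.

Variables (p : R) (H : V -> R).
Hypothesis hp : 1 < p.
Hypothesis hH0 : forall z, 0 <= H z.
Hypothesis hHC1 : Ck 1 H.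
Hypothesis hHconv : @convex_function R V setT H.
Hypothesis hHhom : p_homogeneous p H.

(* For [k = dposreg e t] the negative term disappears; for [m = p] and [k = 1/4]
   it survives, since [dposreg e t] is at least 1/2 for [t >= 0], and yields
   [caccioppoli].  The parameter [e ^+ 2] of [absreg], negligible with respect to
   the one of [posreg], makes the normalisation of [powreg] cost only [e `^ m]. *)
Lemma test_pointwise e m k s t (y z : V) : 0 < e -> 1 < m -> m <= p -> 0 < k ->
  p^-1 * dotp (grad H z) (negpow e m t *: ((m * absreg (e ^+ 2) s `^ (m - 1) * (s / absreg (e ^+ 2) s)) *: y)
     + (powreg (e ^+ 2) m s * dnegpow e m t) *: z) <=
  k `^ (1 - m) * ((m / p) * H y + (1 - m / p) * H z)
  - (m - 1) * (dposreg e t - k) * (absreg (e ^+ 2) s / posreg e t) `^ m * H z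
  + (m - 1) * e `^ m * H z.
Proof.
move=> e0 m1 mp k0.
have p0 : 0 < p by exact: lt_trans hp.
have m0 : 0 < m by exact: lt_trans m1.
have d0 : 0 < e ^+ 2 by exact: exprn_gt0.
have T0 := absreg_gt0 s d0; have U0 := posreg_gt0 t e0.
set T := absreg (e ^+ 2) s in T0 *; set U := posreg e t in U0 *.
have X0 : 0 < T / U by exact: divr_gt0.
have /andP[th0 th1] := dposreg_itv t e0.
have pic := @picone_pointwise R N p H hp hH0 hHC1 hHconv hHhom m k (T / U) z ((s / T) *: y) m1 mp k0 X0.
(* Differentiating [absreg] puts the factor s / T on y; its modulus is at most 1, and homogeneity
   discards it. *)
have Hy : H ((s / T) *: y) <= H y.
  rewrite hHhom -[leRHS]mul1r ler_wpM2r//.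
  have := @ge0_ler_powR R p (ltW p0) `|s / T| 1; rewrite powR1; apply; rewrite ?nnegrE//.
  by rewrite normrM normfV (gtr0_norm T0) ler_pdivrMr// mul1r norm_le_absreg.
have Um : (e ^+ 2) `^ m * U `^ (- m) <= e `^ m.
  rewrite -powR_div//; apply: ge0_ler_powR; rewrite ?nnegrE ?(ltW m0) ?(ltW e0) ?divr_ge0 ?(ltW d0) ?(ltW U0)//.
  by rewrite ler_pdivrMr// expr2 ler_pM2l// eps_le_posreg.
rewrite dotpDr !dotpZr (euler_identity hHC1 hHhom).
set c := dotp _ y.
have -> : p^-1 * (negpow e m t * (m * T `^ (m - 1) * (s / T) * c) +
    powreg (e ^+ 2) m s * dnegpow e m t * (p * H z)) =
    m * (T / U) `^ (m - 1) * (p^-1 * (s / T * c))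
     - (m - 1) * dposreg e t * (T / U) `^ m * H z
     + (m - 1) * dposreg e t * ((e ^+ 2) `^ m * U `^ (- m)) * H z.
  rewrite !powR_div// opprB /negpow /powreg /dnegpow -/T -/U.
  by field; rewrite !gt_eqF.
move: pic; rewrite dotpZr -/c => pic.
have k1 : 0 <= k `^ (1 - m) * (m / p).
  by apply: mulr_ge0; [exact: powR_ge0|apply: divr_ge0; exact: ltW].
have h1 : k `^ (1 - m) * (m / p) * H (s / T *: y) <= k `^ (1 - m) * (m / p) * H y by rewrite ler_wpM2l.
have h2 : (m - 1) * dposreg e t * ((e ^+ 2) `^ m * U `^ (- m)) * H z <= (m - 1) * e `^ m * H z.
  apply: ler_wpM2r => //; rewrite -mulrA; apply: ler_wpM2l; first by rewrite subr_ge0 ltW.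
  apply: le_trans Um; rewrite -[leRHS]mul1r; apply: ler_wpM2r => //.
  by apply: mulr_ge0; exact: powR_ge0.
set A := (T / U) `^ m in pic *; lra.
Qed.

End smooth_regularisations.

(** * Testing the equation *)

(** The integrands may change sign. max(f, g) equals g almost everywhere and dominates f everywhere,
    which reduces the claim to a pointwise comparison. *)
Lemma le_integral_ae d (T : measurableType d) (R : realType)
    (mu : {measure set T -> \bar R}) (D : set T) (f g : T -> R) : measurable D ->
  mu.-integrable D (EFin \o f) -> mu.-integrable D (EFin \o g) ->
  {ae mu, forall x, D x -> f x <= g x} ->
  (\int[mu]_(x in D) (f x)%:E <= \int[mu]_(x in D) (g x)%:E)%E.
Proof.
move=> mD fi gi fg.
have mf : measurable_fun D f by apply/measurable_EFinP; exact: measurable_int fi.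
have mg : measurable_fun D g by apply/measurable_EFinP; exact: measurable_int gi.
have mm : measurable_fun D (fun x => Num.max (f x) (g x)) by exact: measurable_maxr.
have e : {ae mu, forall x, D x -> (Num.max (f x) (g x))%:E = (g x)%:E}.
  by apply: filterS fg => x fg Dx; rewrite (max_idPr (fg Dx)).
have E : (\int[mu]_(x in D) (Num.max (f x) (g x))%:E = \int[mu]_(x in D) (g x)%:E)%E.
  by apply: ae_eq_integral => //; exact/measurable_EFinP.
rewrite -E; apply: le_integral => //.
  apply: (@intg_le_ae _ _ _ mu D mD _ (fun x => `|f x| + `|g x|)) => //.
    by apply: intgD => //; exact: integrable_norm.
  apply: nearW => x Dx; rewrite maxEge; case: ifP => _.
    by rewrite lerDl.
  by rewrite lerDr.
by move=> x _; rewrite lee_fin le_max lexx.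
Qed.

Section weak.
Variables (R : realType) (N : nat).
Local Notation V := 'rV[R]_N.
Local Notation mu := (lebesgue_rV R N).
Variables (Omega : set V).
Hypothesis oOmega : open Omega.
Hypothesis Ofin : (mu Omega < +oo)%E.
Variables (p q : R).
Hypothesis hp : 1 < p.
Hypothesis hq : 1 < q.
Hypothesis hqp : q <= p.
Variable H : V -> R.
Hypothesis hH0 : forall z, 0 <= H z.
Hypothesis hHC1 : Ck 1 H.
Hypothesis hHconv : @convex_function R V setT H.
Hypothesis hHhom : p_homogeneous p H.
Variable C : R.
Hypothesis hC : 1 <= C.
Hypothesis hHbnd : forall z, C^-1 * enorm z `^ p <= H z <= C * enorm z `^ p.

Let p0 : 0 < p. Proof. exact: lt_trans hp. Qed.
Let mO : measurable Omega. Proof. exact: open_measurable_rV. Qed.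

(** Converts the Euclidean growth bound to the sup norm, in which the approximation majorants are
    expressed. *)
Lemma growth z : H z <= C * N%:R `^ p * `|z| `^ p.
Proof.
have /andP[_] := hHbnd z; move=> /le_trans; apply; rewrite -mulrA ler_wpM2l ?(le_trans ler01)//.
rewrite -powRM//; apply: ge0_ler_powR; rewrite ?nnegrE ?mulr_ge0 ?sqrtr_ge0//; first exact: ltW.
exact: enorm_le_norm.
Qed.

Lemma measurable_H (D : set V) (F : V -> V) : measurable_fun D F -> measurable_fun D (H \o F).
Proof.
move=> mF; apply: (measurableT_comp (f := H)) => //; apply: continuous_measurable_rV.
exact: Ck_continuous hHC1.
Qed.

Lemma measurable_dotp_grad (D : set V) (F G : V -> V) : measurable_fun D F -> measurable_fun D G ->
  measurable_fun D (fun x => dotp (grad H (F x)) (G x)).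
Proof.
move=> mF mG; rewrite /dotp; apply: measurable_sum => i; apply: measurable_funM.
  apply: (measurableT_comp (f := fun z : V => grad H z ord0 i)) => //.
  apply: continuous_measurable_rV => z.
  apply: (@continuous_comp _ _ _ (grad H) (fun y : V => y ord0 i)).
    exact: continuous_grad.
  exact: continuous_coord.
exact: measurable_coord_comp.
Qed.

Lemma integrable_H w Dw : W01p Omega p w Dw -> mu.-integrable Omega (EFin \o (H \o Dw)).
Proof.
move=> W; have [_ iD] := W01p_Lp oOmega Ofin p0 W; have [_ mD] := W01p_measurable W.
apply: (@intg_le _ _ _ mu Omega mO _ (fun x => C * N%:R `^ p * `|Dw x| `^ p)).
- exact: measurable_H.
- exact: intgZ.
- by move=> x _; rewrite /= ger0_norm// growth.
Qed.

Lemma integrable_dotp u Du w Dw : W01p Omega p u Du -> W01p Omega p w Dw ->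
  mu.-integrable Omega (EFin \o (fun x => dotp (grad H (Du x)) (Dw x))).
Proof.
move=> Wu Ww; have iu := integrable_H Wu; have iw := integrable_H Ww.
have [_ mDu] := W01p_measurable Wu; have [_ mDw] := W01p_measurable Ww.
apply: (@intg_le _ _ _ mu Omega mO _ (fun x => (p - 1) * H (Du x) + H (Dw x))).
- exact: measurable_dotp_grad.
- by apply: intgD => //; exact: intgZ.
- by move=> x _; apply: dotp_grad_abs.
Qed.

Variables (lam : R) (u : V -> R) (Du : V -> V).
Hypothesis hlam : 0 < lam.
Hypothesis hu0 : {ae mu, forall x, Omega x -> 0 <= u x}.
Hypothesis husol : weak_solution Omega p q H lam u Du.

Let Wu : W01p Omega p u Du. Proof. by have [] := husol. Qed.
Let meas_u : measurable_fun Omega u. Proof. by have [] := W01p_measurable Wu. Qed.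
Let mDu : measurable_fun Omega Du. Proof. by have [] := W01p_measurable Wu. Qed.

Lemma weak_identity w Dw : W01p Omega p w Dw ->
  (\int[mu]_(x in Omega) (p^-1 * dotp (grad H (Du x)) (Dw x))%:E =
   lam%:E * \int[mu]_(x in Omega) (u x `^ (q - 1) * w x)%:E)%E.
Proof.
move=> W; have [_ /(_ _ _ W) <-] := husol.
under eq_integral do rewrite EFinM.
exact: (integralZl mO (integrable_dotp Wu W)).
Qed.

(** The equation tested with u itself; Euler's identity turns the left side into the energy. *)
Lemma energy_solution :
  (\int[mu]_(x in Omega) (H (Du x))%:E = lam%:E * \int[mu]_(x in Omega) (`|u x| `^ q)%:E)%E.
Proof.
have := weak_identity Wu.
under eq_integral do rewrite (euler_identity hHC1 hHhom) mulrA mulVf ?gt_eqF// mul1r.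
move=> ->; congr (_ * _)%E; apply: ae_eq_integral => //.
- apply/measurable_EFinP; apply: measurable_funM => //; exact: measurable_powR_comp.
- by apply/measurable_EFinP; apply: measurable_powR_comp; exact: measurableT_comp.
- apply: filterS hu0 => x u0 Ox; congr EFin; rewrite ger0_norm ?u0//.
  have := u0 Ox; rewrite le_eqVlt => /predU1P[<-|ux].
    by rewrite mulr0 powR0// gt_eqF// (lt_trans _ hq).
  by rewrite -{2}(powRr1 (ltW ux)) -gt0_powRD// subrK.
Qed.

Lemma integrable_Lq r : 0 <= r -> r <= p ->
  mu.-integrable Omega (EFin \o (fun x => `|u x| `^ r)).
Proof.
move=> r0 rp; have [iu _] := W01p_Lp oOmega Ofin p0 Wu.
apply: (@intg_le _ _ _ mu Omega mO _ (fun x => 1 + `|u x| `^ p)).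
- by apply: measurable_powR_comp; exact: measurableT_comp.
- by apply: intgD => //; exact: intg_cst.
- by move=> x _; rewrite ger0_norm ?powR_ge0//; exact: powR_le1D.
Qed.

Section test.
Variables (phi : V -> R) (tphi : test_function Omega phi).
Variables (e m : R) (e0 : 0 < e) (m1 : 1 < m) (mp : m <= p).

(** The regularisation of |phi|^m u^(1-m); [Dpsi] is its gradient by the chain rule, in the shape
    produced by [W01p_mul]. *)
Let psi x := negpow e m (u x) * powreg (e ^+ 2) m (phi x).
Let Dpsi x := negpow e m (u x) *:
     ((m * absreg (e ^+ 2) (phi x) `^ (m - 1) * (phi x / absreg (e ^+ 2) (phi x))) *: grad phi x)
     + (powreg (e ^+ 2) m (phi x) * dnegpow e m (u x)) *: Du x.

Lemma test_W01p : W01p Omega p psi Dpsi.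
Proof.
have d0 : 0 < e ^+ 2 by exact: exprn_gt0.
have := @W01p_mul R N Omega p oOmega Ofin p0 (powreg (e ^+ 2) m \o phi) (negpow e m) (dnegpow e m)
  (e `^ (1 - m) + (m - 1) * e `^ (- m)) u Du (test_powreg m d0 tphi).
have gE x : grad (powreg (e ^+ 2) m \o phi) x =
  (m * absreg (e ^+ 2) (phi x) `^ (m - 1) * (phi x / absreg (e ^+ 2) (phi x))) *: grad phi x.
  have [sphi _ _] := tphi; have [d _] := sphi 1%N.
  by rewrite (grad_comp (d x) (is_derive_powreg m (phi x) d0)).
rewrite (_ : Dpsi = fun x => negpow e m (u x) *: grad (powreg (e ^+ 2) m \o phi) x +
    ((powreg (e ^+ 2) m \o phi) x * dnegpow e m (u x)) *: Du x); last first.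
  by apply/funext => x; rewrite gE.
apply => //.
- by move=> f sf k; exact: Ck_negpow.
- by move=> t; exact: is_derive_negpow.
- exact: continuous_dnegpow.
- move=> t; apply: le_trans (negpow_bound t e0 m1) _.
  by rewrite lerDl mulr_ge0 ?powR_ge0// subr_ge0 ltW.
- move=> t; apply: le_trans (dnegpow_bound t e0 m1) _.
  by rewrite lerDr powR_ge0.
Qed.

Lemma integrable_test_pairing :
  mu.-integrable Omega (EFin \o (fun x => p^-1 * dotp (grad H (Du x)) (Dpsi x))).
Proof. by apply: intgZ => //; apply: integrable_dotp; [exact: Wu|exact: test_W01p]. Qed.

Lemma integrable_H_test : mu.-integrable Omega (EFin \o (H \o grad phi)).
Proof.
have [M M0 bM] := test_function_bounded tphi.
apply: (@intg_le _ _ _ mu Omega mO _ (fun x => C * N%:R `^ p * M `^ p)).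
- by apply: measurable_H; exact: test_grad_measurable tphi.
- exact: intg_cst.
- move=> x _; rewrite /= ger0_norm//; apply: (le_trans (growth _)).
  rewrite ler_wpM2l ?mulr_ge0 ?powR_ge0 ?(le_trans ler01)//.
  by apply: ge0_ler_powR; rewrite ?nnegrE//; [exact: ltW|exact: (bM x).2].
Qed.

(** Taking k = [dposreg e (u x)] at each point makes the negative term of [test_pointwise] vanish.
    The bound is integrable since [dposreg] is at least 1/2 where u >= 0, so that its power 1 - m is
    bounded. *)
Lemma test_upper :
  (lam%:E * \int[mu]_(x in Omega) (u x `^ (q - 1) * psi x)%:E <=
   \int[mu]_(x in Omega) (dposreg e (u x) `^ (1 - m) *
      ((m / p) * H (grad phi x) + (1 - m / p) * H (Du x)) + (m - 1) * e `^ m * H (Du x))%:E)%E.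
Proof.
rewrite -(weak_identity test_W01p); apply: le_integral_ae => //.
- exact: integrable_test_pairing.
- apply: (intg_le_ae mO _ (g := fun x => (1 / 2) `^ (1 - m) *
      ((m / p) * H (grad phi x) + (1 - m / p) * H (Du x)) + (m - 1) * e `^ m * H (Du x))).
  + apply: measurable_funD; last first.
      by apply: measurable_funM; [exact: measurable_cst|exact: measurable_H].
    apply: measurable_funM.
      apply: measurable_powR_comp; apply: measurableT_comp => //.
      by apply: continuous_measurable_fun; exact: continuous_dposreg.
    apply: measurable_funD; apply: measurable_funM; first exact: measurable_cst.
    - by apply: measurable_H; exact: test_grad_measurable tphi.
    - exact: measurable_cst.
    - exact: measurable_H.
  + have iB := integrable_H_test; have iA := integrable_H Wu.
    apply: intgD => //; last exact: intgZ.
    by apply: intgZ => //; apply: intgD => //; exact: intgZ.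
  + apply: filterS hu0 => x u0 Ox.
    have th := dposreg_ge e0 (u0 Ox).
    have m0 : 0 < m by exact: lt_trans m1.
    have mp0 : 0 <= m / p by apply: divr_ge0; exact: ltW.
    have mp1 : 0 <= 1 - m / p by rewrite subr_ge0 ler_pdivrMr// mul1r.
    have S0 : 0 <= m / p * H (grad phi x) + (1 - m / p) * H (Du x).
      by apply: addr_ge0; apply: mulr_ge0.
    have Q0 : 0 <= (m - 1) * e `^ m * H (Du x).
      by apply: mulr_ge0 => //; apply: mulr_ge0; [rewrite subr_ge0 ltW|exact: powR_ge0].
    rewrite ger0_norm; last by apply: addr_ge0 => //; apply: mulr_ge0 => //; exact: powR_ge0.
    rewrite lerD2r; apply: ler_wpM2r => //; rewrite -opprB; apply: powR_le_neg => //.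
    by rewrite subr_ge0 ltW.
- apply: filterS hu0 => x u0 Ox.
  have th : 0 < dposreg e (u x) by apply: lt_le_trans (dposreg_ge e0 (u0 Ox)); lra.
  have := @test_pointwise _ _ p H hp hH0 hHC1 hHconv hHhom e m (dposreg e (u x)) (phi x) (u x)
     (grad phi x) (Du x) e0 m1 mp th.
  by rewrite subrr mulr0 !mul0r subr0.
Qed.

End test.

(** For m = p the coefficient 1 - m/p vanishes, and k = 1/4 against a slope of at least 1/2 leaves
    (p - 1)/4 in front of the weighted energy. With e <= 1 the right side does not depend on e. *)
Lemma caccioppoli phi e : test_function Omega phi -> 0 < e -> e <= 1 ->
  mu.-integrable Omega (EFin \o (fun x => (`|phi x| / posreg e (u x)) `^ p * H (Du x))) /\
  (((p - 1) / 4)%:E * \int[mu]_(x in Omega) ((`|phi x| / posreg e (u x)) `^ p * H (Du x))%:E <=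
  \int[mu]_(x in Omega) (4^-1 `^ (1 - p) * H (grad phi x) + (p - 1) * H (Du x))%:E)%E.
Proof.
move=> tphi e0 e1.
have iP := integrable_test_pairing tphi e0 hp.
have iB := integrable_H_test tphi.
have iA := integrable_H Wu.
pose P x := p^-1 * dotp (grad H (Du x)) (negpow e p (u x) *:
     ((p * absreg (e ^+ 2) (phi x) `^ (p - 1) * (phi x / absreg (e ^+ 2) (phi x))) *: grad phi x)
     + (powreg (e ^+ 2) p (phi x) * dnegpow e p (u x)) *: Du x).
pose B x := 4^-1 `^ (1 - p) * H (grad phi x) + (p - 1) * H (Du x).
have iB' : mu.-integrable Omega (EFin \o B) by apply: intgD => //; exact: intgZ.
have iBP : mu.-integrable Omega (EFin \o (fun x => B x - P x)).
  apply: intgD => //; have := intgZ mO (- 1) iP.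
  by apply: eq_integrable => // x _ /=; rewrite mulN1r.
pose f x := (`|phi x| / posreg e (u x)) `^ p * H (Du x).
have f0 x : 0 <= f x by rewrite mulr_ge0 ?powR_ge0.
have mf : measurable_fun Omega f.
  apply: measurable_funM; last exact: measurable_H.
  apply: measurable_powR_comp; apply: measurable_funM.
    by apply: measurableT_comp => //; exact: test_measurable tphi.
  apply: (measurableT_comp (f := fun t => (posreg e t)^-1)) => //.
  apply: continuous_measurable_fun => t; apply: cvgV; first by rewrite gt_eqF// posreg_gt0.
  by apply: (continuous_is_derive (f := dposreg e)) => s; exact: is_derive_posreg.
have le1 : {ae mu, forall x, Omega x -> (p - 1) / 4 * f x <= B x - P x}.
  apply: filterS hu0 => x u0 Ox.
  have k0 : 0 < 4^-1 :> R by rewrite invr_gt0.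
  have := @test_pointwise _ _ p H hp hH0 hHC1 hHconv hHhom e p 4^-1 (phi x) (u x)
     (grad phi x) (Du x) e0 hp (lexx p) k0.
  rewrite -/(P x) divff ?gt_eqF// mul1r subrr mul0r addr0 => h.
  have th := dposreg_ge e0 (u0 Ox).
  have d0 : 0 < e ^+ 2 by exact: exprn_gt0.
  have U0 := posreg_gt0 (u x) e0.
  have ep : e `^ p <= 1.
    by have := @ge0_ler_powR R p (ltW p0) e 1; rewrite powR1; apply; rewrite ?nnegrE// ltW.
  have fX : f x <= (absreg (e ^+ 2) (phi x) / posreg e (u x)) `^ p * H (Du x).
    apply: ler_wpM2r => //; apply: ge0_ler_powR; rewrite ?nnegrE ?divr_ge0 ?(ltW U0)//.
    - exact: ltW.
    - by rewrite ltW// absreg_gt0.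
    - by rewrite ler_pM2r ?invr_gt0// norm_le_absreg.
  set Y := (absreg _ _ / _) `^ p in h fX.
  have Y0 : 0 <= Y * H (Du x) by rewrite mulr_ge0 ?powR_ge0.
  have h2 : (p - 1) * 4^-1 * (Y * H (Du x)) <= (p - 1) * (dposreg e (u x) - 4^-1) * (Y * H (Du x)).
    apply: ler_wpM2r => //; apply: ler_wpM2l; first by rewrite subr_ge0 ltW.
    lra.
  have h3 : (p - 1) * e `^ p * H (Du x) <= (p - 1) * H (Du x).
    by apply: ler_wpM2r => //; rewrite -[leRHS]mulr1; apply: ler_wpM2l => //; rewrite subr_ge0 ltW.
  have h4 : (p - 1) / 4 * f x <= (p - 1) * 4^-1 * (Y * H (Du x)).
    by apply: ler_wpM2l => //; rewrite mulr_ge0 ?subr_ge0 ?(ltW hp)// ltW.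
  rewrite /B; lra.
have ipf : mu.-integrable Omega (EFin \o (fun x => (p - 1) / 4 * f x)).
  apply: (intg_le_ae mO _ iBP); first by apply: measurable_funM => //; exact: measurable_cst.
  apply: filterS le1 => x le1 Ox; rewrite ger0_norm ?le1// mulr_ge0//.
  by rewrite divr_ge0 ?subr_ge0 ?(ltW hp).
have c0 : 0 < (p - 1) / 4 by rewrite divr_gt0 ?subr_gt0.
have intf : mu.-integrable Omega (EFin \o f).
  have := intgZ mO ((p - 1) / 4)^-1 ipf.
  by apply: eq_integrable => // x _ /=; rewrite mulrA mulVf ?gt_eqF// mul1r.
split => //.
rewrite -integralZl//; under eq_integral do rewrite -EFinM.
apply: (le_trans (le_integral_ae mO ipf iBP le1)).
under eq_integral do rewrite EFinB.
rewrite integralB//; rewrite leeBlDr; last exact: intg_fin.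
(* The integral of [P] is lam times that of the nonnegative u^(q-1) psi, so dropping it preserves
   the bound: only the supersolution property of u is used here. *)
rewrite leeDl// (weak_identity (test_W01p tphi e0 hp)) mule_ge0 ?lee_fin ?(ltW hlam)//.
apply: integral_ge0 => x _; rewrite lee_fin mulr_ge0 ?powR_ge0// mulr_ge0 ?powR_ge0//.
by apply: powreg_ge0; [exact: exprn_gt0|exact: ltW].
Qed.

(** Let e -> 0 in [test_upper] with m = q. Where u > 0 the slope tends to 1, and u^(q-1) times
    [negpow] tends to u^(q-1) u^(1-q) = 1, so u disappears from the left side. *)
Lemma test_limit phi : test_function Omega phi ->
  {ae mu, forall x, Omega x -> 0 < u x} ->
  (lam%:E * \int[mu]_(x in Omega) (`|phi x| `^ q)%:E <=
   \int[mu]_(x in Omega) ((q / p) * H (grad phi x) + (1 - q / p) * H (Du x))%:E)%E.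
Proof.
move=> tphi upos.
have q0 : 0 < q by exact: lt_trans hq.
have [M M0 bM] := test_function_bounded tphi.
have iB := integrable_H_test tphi; have iA := integrable_H Wu.
have mphi : measurable_fun Omega phi by exact: test_measurable tphi.
pose e n : R := n.+1%:R^-1.
have e0 n : 0 < e n by rewrite invr_gt0.
have e1 n : e n <= 1 by rewrite invf_le1// ler1n.
have ce : e @ \oo --> (0 : R) by exact: cvg_harmonic.
pose f n x := u x `^ (q - 1) * (negpow (e n) q (u x) * powreg (e n ^+ 2) q (phi x)).
pose S x := (q / p) * H (grad phi x) + (1 - q / p) * H (Du x).
pose g n x := dposreg (e n) (u x) `^ (1 - q) * S x + (q - 1) * e n `^ q * H (Du x).
have mS : measurable_fun Omega S.
  apply: measurable_funD; apply: measurable_funM; first exact: measurable_cst.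
  - by apply: measurable_H; exact: test_grad_measurable tphi.
  - exact: measurable_cst.
  - exact: measurable_H.
have qp0 : 0 <= q / p by apply: divr_ge0; exact: ltW.
have qp1 : 0 <= 1 - q / p by rewrite subr_ge0 ler_pdivrMr// mul1r.
have S0 x : 0 <= S x by apply: addr_ge0; apply: mulr_ge0.
have ub n : (lam%:E * \int[mu]_(x in Omega) (f n x)%:E <= \int[mu]_(x in Omega) (g n x)%:E)%E.
  exact: (test_upper tphi (e0 n) hq hqp).
have mf n : measurable_fun Omega (f n).
  apply: measurable_funM; first exact: measurable_powR_comp.
  apply: measurable_funM; apply: measurableT_comp => //; apply: continuous_measurable_fun.
    by apply: continuous_is_derive => t; exact: is_derive_negpow.
  apply: continuous_is_derive => t; apply: is_derive_powreg; exact: exprn_gt0.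
have mg n : measurable_fun Omega (g n).
  apply: measurable_funD; apply: measurable_funM => //.
  - apply: measurable_powR_comp; apply: measurableT_comp => //.
    by apply: continuous_measurable_fun; exact: continuous_dposreg.
  - exact: measurable_H.
have cf_ae : {ae mu, forall x, Omega x -> f ^~ x @ \oo --> `|phi x| `^ q /\
    forall n, `|f n x| <= absreg 1 M `^ q}.
  apply: filterS upos => x up Ox; have {}up := up Ox; split.
    have -> : `|phi x| `^ q = u x `^ (q - 1) * (u x `^ (1 - q) * `|phi x| `^ q).
      by rewrite mulrA -gt0_powRD// (_ : q - 1 + (1 - q) = 0) ?powRr0 ?mul1r//; ring.
    apply: cvgMr; apply: cvgM; first exact: cvg_negpow.
    apply: cvg_powreg => // [|n]; last exact: exprn_gt0.
    have c2 : (fun n => e n * e n) @ \oo --> (0 * 0 : R) by exact: cvgM.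
    by move: c2; rewrite mulr0; under eq_fun do rewrite -expr2.
  move=> n; have d0 : 0 < e n ^+ 2 by exact: exprn_gt0.
  have P0 : 0 <= powreg (e n ^+ 2) q (phi x) by apply: powreg_ge0 => //; exact: ltW.
  have G0 : 0 <= negpow (e n) q (u x) by exact: powR_ge0.
  rewrite ger0_norm; last by apply: mulr_ge0; [exact: powR_ge0|exact: mulr_ge0].
  (* Since u <= [posreg], the product of u^(q-1) and [negpow] is at most 1; what remains is bounded
     uniformly in n because phi is bounded by M and e_n^2 <= 1. *)
  rewrite /f mulrA; apply: (@le_trans _ _ (1 * powreg (e n ^+ 2) q (phi x))).
    apply: ler_wpM2r => //; rewrite /negpow -(opprB q) powRN.
    rewrite ler_pdivrMr ?powR_gt0 ?posreg_gt0// mul1r.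
    apply: ge0_ler_powR; rewrite ?nnegrE ?subr_ge0 ?(ltW hq) ?(ltW up)//.
      by rewrite ltW// posreg_gt0.
    by apply: le_trans (posreg_ge (u x) (e0 n)); rewrite lerDl ltW.
  rewrite mul1r /powreg; apply: (@le_trans _ _ (absreg (e n ^+ 2) (phi x) `^ q)).
    by rewrite gerBl powR_ge0.
  apply: ge0_ler_powR; rewrite ?nnegrE ?(ltW q0) ?(ltW (absreg_gt0 _ d0)) ?(ltW (absreg_gt0 _ ltr01))//.
  apply: absreg_mono; last by rewrite (ger0_norm M0); exact: (bM x).1.
  by rewrite (ltW d0)/=; apply: exprn_ile1 => //; exact: ltW.
have iS : mu.-integrable Omega (EFin \o S) by apply: intgD => //; exact: intgZ.
have ig : mu.-integrable Omega (EFin \o (fun x => (1 / 2) `^ (1 - q) * S x + (q - 1) * H (Du x))).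
  by apply: intgD => //; exact: intgZ.
have cg_ae : {ae mu, forall x, Omega x -> g ^~ x @ \oo --> S x /\
    forall n, `|g n x| <= (1 / 2) `^ (1 - q) * S x + (q - 1) * H (Du x)}.
  apply: filterS upos => x up Ox; have {}up := up Ox; split.
    have -> : S x = 1 `^ (1 - q) * S x + (q - 1) * 0 `^ q * H (Du x).
      by rewrite powR1 powR0 ?gt_eqF// mulr0 mul0r addr0 mul1r.
    apply: cvgD; apply: cvgMl.
      by apply: cvg_powR_gt0 => //; exact: cvg_dposreg.
    by apply: cvgMr; apply: cvg_powR => // n; exact: ltW.
  move=> n.
  have th := dposreg_ge (e0 n) (ltW up).
  have eq1 : e n `^ q <= 1.
    by have := @ge0_ler_powR R q (ltW q0) (e n) 1; rewrite powR1; apply; rewrite ?nnegrE// ltW.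
  have Q0 : 0 <= q - 1 by rewrite subr_ge0 ltW.
  rewrite ger0_norm; last first.
    by apply: addr_ge0; apply: mulr_ge0 => //; [exact: powR_ge0|apply: mulr_ge0 => //; exact: powR_ge0].
  apply: lerD; apply: ler_wpM2r => //.
    by rewrite -opprB; apply: powR_le_neg.
  by rewrite -[leRHS]mulr1; apply: ler_wpM2l.
have [_ cf] := @dct_real _ _ _ mu Omega mO f (fun x => `|phi x| `^ q)
  (fun=> absreg 1 M `^ q) mf
  (measurable_powR_comp q (measurableT_comp (@normr_measurable R setT) mphi)) (intg_cst mO _ Ofin) cf_ae.
have [_ cg] := @dct_real _ _ _ mu Omega mO g S
  (fun x => (1 / 2) `^ (1 - q) * S x + (q - 1) * H (Du x)) mg mS ig cg_ae.
have cl : (fun n => lam%:E * \int[mu]_(x in Omega) (f n x)%:E)%E @ \oo -->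
    (lam%:E * \int[mu]_(x in Omega) (`|phi x| `^ q)%:E)%E.
  by apply: cvgeZl.
rewrite -(cvg_lim (@ereal_hausdorff R) cl) -(cvg_lim (@ereal_hausdorff R) cg).
by apply: lee_lim; [apply: cvgP cl|apply: cvgP cg|exact: nearW].
Qed.

End weak.

(** * Poincare inequality on cubes *)

Section tonelli_on.
Local Open Scope ereal_scope.
Context d1 d2 (T1 : measurableType d1) (T2 : measurableType d2) (R : realType).
Variables (m1 : {sigma_finite_measure set T1 -> \bar R})
  (m2 : {sigma_finite_measure set T2 -> \bar R}).
Variables (D1 : set T1) (D2 : set T2).
Hypotheses (mD1 : measurable D1) (mD2 : measurable D2).
Variable f : T1 * T2 -> \bar R.
Hypotheses (mf : measurable_fun setT f) (f0 : forall x, 0 <= f x).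

Let g := f \_ (D1 `*` D2).

Let mg : measurable_fun setT g.
Proof.
apply/(measurable_restrictT _ _).1; first exact: measurableX.
exact: measurable_funTS.
Qed.

Let g0 x : 0 <= g x.
Proof. by rewrite /g patchE; case: ifPn. Qed.

Let g1 x : \int[m2]_y g (x, y) = ((fun x => \int[m2]_(y in D2) f (x, y)) \_ D1) x.
Proof.
rewrite patchE; case: ifPn => [|]; rewrite ?inE ?notin_setE => Dx.
  rewrite [RHS]integral_mkcond; apply: eq_integral => y _.
  by rewrite /g !patchE in_setX/= mem_set.
rewrite integral0_eq// => y _; rewrite /g patchE in_setX/= memNset//.
Qed.

Let g2 y : \int[m1]_x g (x, y) = ((fun y => \int[m1]_(x in D1) f (x, y)) \_ D2) y.
Proof.
rewrite patchE; case: ifPn => [|]; rewrite ?inE ?notin_setE => Dy.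
  rewrite [RHS]integral_mkcond; apply: eq_integral => x _.
  by rewrite /g !patchE in_setX/= [X in _ && X]mem_set// andbT.
rewrite integral0_eq// => x _; rewrite /g patchE in_setX/= [X in _ && X]memNset// andbF//.
Qed.

Lemma tonelli_swap : \int[m1]_(x in D1) \int[m2]_(y in D2) f (x, y) =
  \int[m2]_(y in D2) \int[m1]_(x in D1) f (x, y).
Proof.
rewrite [LHS]integral_mkcond [RHS]integral_mkcond.
under eq_integral do rewrite -g1.
under [RHS]eq_integral do rewrite -g2.
exact: fubini_tonelli.
Qed.

Lemma tonelli_product : \int[m1 \x m2]_(z in D1 `*` D2) f z =
  \int[m1]_(x in D1) \int[m2]_(y in D2) f (x, y).
Proof.
rewrite [LHS]integral_mkcond [RHS]integral_mkcond fubini_tonelli1//.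
by apply: eq_integral => x _; rewrite -g1.
Qed.

End tonelli_on.

Lemma measurable_partial_integral d1 d2 (T1 : measurableType d1) (T2 : measurableType d2)
    (R : realType) (m2 : {sigma_finite_measure set T2 -> \bar R}) (D2 : set T2)
    (f : T1 * T2 -> \bar R) : measurable D2 -> measurable_fun setT f ->
  (forall x, 0 <= f x)%E ->
  measurable_fun setT (fun x => \int[m2]_(y in D2) f (x, y))%E.
Proof.
move=> mD2 mf f0.
have mg : measurable_fun setT (f \_ (setT `*` D2)).
  apply/(measurable_restrictT _ _).1; first exact: measurableX.
  exact: measurable_funTS.
have g0 x : (0 <= (f \_ (setT `*` D2)) x)%E by rewrite patchE; case: ifPn.
have := @measurable_fun_fubini_tonelli_F _ _ _ _ _ m2 _ mg g0; congr (measurable_fun _ _); apply/funext => x.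
rewrite /fubini_F [RHS]integral_mkcond; apply: eq_integral => y _.
by rewrite !patchE in_setX/= in_setT.
Qed.

Section poincare.
Variable R : realType.
Local Notation leb := (@lebesgue_measure R).

(** The sup-norm ball, written coordinatewise so that it splits as an interval times a cube of one
    dimension less. *)
Definition cube (N : nat) (a : 'rV[R]_N) (r : R) : set 'rV[R]_N :=
  [set x | forall i, `|x ord0 i - a ord0 i| < r].

Definition itvc (c r : R) : set (measurableTypeR R) := `]c - r, c + r[%classic.

Lemma cube_itvc N (a : 'rV[R]_N) r : cube a r = [set x | forall i, itvc (a ord0 i) r (x ord0 i)].
Proof.
by apply/seteqP; split => x /= h i; have := h i; rewrite /itvc /= in_itv/= ltr_distl.
Qed.

Lemma measurable_itvc c r : measurable (itvc c r).
Proof. exact: measurable_itv. Qed.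

Lemma itvc_measure c r : 0 < r -> leb (itvc c r) = (2 * r)%:E.
Proof.
move=> r0; rewrite /itvc lebesgue_measure_itv/= lte_fin ifT; last lra.
by rewrite -EFinB; congr EFin; ring.
Qed.

Lemma measurable_cube N (a : 'rV[R]_N) r : measurable (cube a r).
Proof.
rewrite cube_itvc [X in measurable X](_ : _ = \big[setI/setT]_(i < N)
  ((fun x : 'rV[R]_N => x ord0 i) @^-1` itvc (a ord0 i) r)).
  apply: bigsetI_measurable => i _; rewrite -[X in measurable X]setTI.
  by apply: measurable_coord => //; exact: measurable_itvc.
rewrite -bigcap_seq; apply/seteqP; split => x /= h i; first by move=> _; exact: h.
by have := h i; apply; rewrite /= mem_index_enum.
Qed.

Lemma cube_measure N (a : 'rV[R]_N) r : 0 < r -> lebesgue_rV R N (cube a r) = ((2 * r) ^+ N)%:E.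
Proof.
move=> r0; rewrite cube_itvc (@lebesgue_rV_box R N (fun i => itvc (a ord0 i) r)); last by move=> i; exact: measurable_itvc.
under eq_bigr do rewrite itvc_measure//.
rewrite prodEFin; congr EFin.
by rewrite prodr_const card_ord.
Qed.

Definition tail n (a : 'rV[R]_n.+1) : 'rV[R]_n := \row_i a ord0 (lift ord0 i).

Lemma rV_cons_cube n (a : 'rV[R]_n.+1) r :
  @rV_cons R n @^-1` cube a r = itvc (a ord0 ord0) r `*` cube (tail a) r.
Proof.
apply/seteqP; split => -[t z] /=.
  move=> h; split.
    by have := h ord0; rewrite rV_cons0/= /itvc/= in_itv/= ltr_distl.
  by move=> i; have := h (lift ord0 i); rewrite rV_consS mxE.
move=> [ht hz] i; have [j|] := unliftP ord0 i => ->.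
  by have := hz j; rewrite rV_consS mxE.
by rewrite rV_cons0/= ltr_distl; move: ht; rewrite /itvc/= in_itv/=.
Qed.

(** [lebesgue_rV] is built as the image of a product measure under [rV_cons], so this is a change of
    variables followed by Tonelli. *)
Lemma integral_cube n (a : 'rV[R]_n.+1) r (F : 'rV[R]_n.+1 -> \bar R) :
  measurable_fun setT F -> (forall x, 0 <= F x)%E ->
  (\int[lebesgue_rV R n.+1]_(x in cube a r) F x =
   \int[leb]_(t in itvc (a ord0 ord0) r) \int[lebesgue_rV R n]_(z in cube (tail a) r)
      F (rV_cons (t, z)))%E.
Proof.
move=> mF F0.
have mc : measurable (cube a r) := measurable_cube a r.
have mFc : measurable_fun (cube a r) F by exact: measurable_funTS.
have E := @ge0_integral_pushforward _ _ _ _ _ _ (@measurable_rV_cons R n)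
  (leb \x lebesgue_rV R n)%E _ F mc mFc (fun y _ => F0 y).
transitivity (\int[(leb \x lebesgue_rV R n)%E]_(x in @rV_cons R n @^-1` cube a r) (F \o @rV_cons R n) x)%E.
  exact: E.
rewrite rV_cons_cube (tonelli_product leb (lebesgue_rV R n))//.
- exact: measurable_itvc.
- exact: measurable_cube.
- by apply: measurableT_comp => //; exact: measurable_rV_cons.
- by move=> x; exact: F0.
Qed.

(** The fundamental theorem of calculus between s and t, after which the domain is enlarged to the
    whole interval to get a bound independent of both points. *)
Lemma itv_oscillation (F f : R -> R) (c r s t : R) :
  (forall x, is_derive x (1 : R) F (f x)) -> continuous f ->
  itvc c r s -> itvc c r t ->
  (`|F t - F s|%:E <= \int[leb]_(x in itvc c r) `|f x|%:E)%E.
Proof.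
move=> dF cf; wlog st : s t / s <= t => [W|] Is It.
  have [st|/ltW ts] := leP s t; first exact: W.
  by rewrite distrC; exact: W.
have mf : measurable_fun setT f by exact: continuous_measurable_fun.
move: st; rewrite le_eqVlt => /predU1P[->|st].
  by rewrite subrr normr0; apply: integral_ge0 => x _; rewrite lee_fin.
have cF : continuous F := continuous_is_derive dF.
have E := @continuous_FTC2 R f F s t st.
have {}E : (\int[leb]_(x in `[s, t]) (f x)%:E)%E = ((F t)%:E - (F s)%:E)%E.
  apply: E.
  - exact: continuous_subspaceT.
  - split.
    + by move=> x _; have [] := dF x.
    + by apply: cvg_at_right_filter; exact: cF.
    + by apply: cvg_at_left_filter; exact: cF.
  - by move=> x _; rewrite derive1E; have [_ ->] := dF x.
rewrite -abse_EFin EFinB -E.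
apply: (@le_trans _ _ (\int[leb]_(x in `[s, t]) `|f x|%:E)%E).
  by apply: le_abse_integral => //; apply/measurable_EFinP; exact: measurable_funTS.
apply: ge0_subset_integral => //.
- exact: measurable_itvc.
- by apply/measurable_EFinP; apply: measurableT_comp => //; exact: measurable_funTS.
move=> x; move: Is It; rewrite /itvc/= !in_itv/= => /andP[h1 h2] /andP[h3 h4] /andP[h5 h6].
by rewrite (lt_le_trans h1 h5) (le_lt_trans h6 h4).
Qed.

Lemma rV_cons_delta0 n (t h : R) (z : 'rV[R]_n) :
  rV_cons (h + t, z) = h *: delta_mx ord0 ord0 + rV_cons (t, z).
Proof.
apply/rowP => i; rewrite [RHS]mxE [X in _ = X + _]mxE [X in _ * X]mxE.
have [j|] := unliftP ord0 i => ->.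
  by rewrite !rV_consS/= ?andbF mulr0 add0r.
by rewrite !rV_cons0/= mulr1.
Qed.

Lemma rV_cons_deltaS n (t h : R) (z : 'rV[R]_n) (j : 'I_n) :
  rV_cons (t, h *: delta_mx ord0 j + z) = h *: delta_mx ord0 (lift ord0 j) + rV_cons (t, z).
Proof.
apply/rowP => i; rewrite [RHS]mxE [X in _ = X + _]mxE [X in _ * X]mxE.
have [k|] := unliftP ord0 i => ->.
  by rewrite !rV_consS/= !mxE/= (inj_eq lift_inj).
by rewrite !rV_cons0/= ?andbF mulr0 add0r.
Qed.

(** A directional derivative only sees the restriction to a line; this transfers partial derivatives
    of f to its lower-dimensional sections. *)
Lemma is_derive_shift (n : nat) (f : 'rV[R]_n -> R) (x v : 'rV[R]_n) (U : normedModType R)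
    (F : U -> R) (y w : U) (d : R) :
  (forall h : R, F (h *: w + y) = f (h *: v + x)) -> is_derive x v f d -> is_derive y w F d.
Proof.
move=> E [df dE].
have fE : (fun h : R => h^-1 *: ((F \o shift y) (h *: w) - F y)) =
  (fun h : R => h^-1 *: ((f \o shift x) (h *: v) - f x)).
  apply/funext => h /=; rewrite E; have := E 0; rewrite !scale0r !add0r => ->//.
by apply: DeriveDef; rewrite /derivable /derive fE.
Qed.

(* Induction on the dimension: [f (s0, z0) - f (s, y)] splits through
   [f (s, z0)], the first part being one-dimensional in [s]. *)
Lemma poincare_cube N (a : 'rV[R]_N) (r : R) (f : 'rV[R]_N -> R) (g : 'I_N -> 'rV[R]_N -> R) :
  0 < r -> measurable_fun setT f -> (forall i, measurable_fun setT (g i)) ->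
  (forall i x, is_derive x (delta_mx ord0 i) f (g i x)) ->
  (forall i x, continuous (fun t : R => g i (t *: delta_mx ord0 i + x))) ->
  (\int[lebesgue_rV R N]_(x in cube a r) \int[lebesgue_rV R N]_(y in cube a r) `|f x - f y|%:E
   <= ((2 * r) ^+ N.+1)%:E * \sum_i \int[lebesgue_rV R N]_(x in cube a r) `|g i x|%:E)%E.
Proof.
move=> r0; elim: N a f g => [|n IH] a f g mf mg df cg.
  rewrite big_ord0 mule0 integral0_eq// => x _; rewrite integral0_eq// => y _.
  by rewrite (_ : x = y) ?subrr ?normr0//; apply/rowP => -[].
set I := itvc (a ord0 ord0) r; set Q := cube (tail a) r.
have mI : measurable I := measurable_itvc _ _.
have mQ : measurable Q := measurable_cube _ _.
set mn := lebesgue_rV R n.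
pose fs s z := f (rV_cons (s, z)).
pose gs i s z := g i (rV_cons (s, z)).
have mcons := @measurable_rV_cons R n.
have mfs : measurable_fun setT (fun sz => fs sz.1 sz.2).
  have := measurableT_comp mf mcons; congr measurable_fun; apply/funext => -[s z] //.
have mgs i : measurable_fun setT (fun sz => gs i sz.1 sz.2).
  have := measurableT_comp (mg i) mcons; congr measurable_fun; apply/funext => -[s z] //.
have IHs s : (\int[mn]_(z in Q) \int[mn]_(y in Q) `|fs s z - fs s y|%:E <=
    ((2 * r) ^+ n.+1)%:E * \sum_i \int[mn]_(z in Q) `|gs (lift ord0 i) s z|%:E)%E.
  apply: (IH (tail a) (fs s) (fun i => gs (lift ord0 i) s)).
  - exact: (measurableT_comp mfs (pair1_measurable s)).
  - by move=> i; exact: (measurableT_comp (mgs _) (pair1_measurable s)).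
  - move=> i z; apply: (is_derive_shift _ (df (lift ord0 i) (rV_cons (s, z)))) => h.
    by rewrite /fs rV_cons_deltaS.
  - move=> i z; rewrite (_ : (fun t => _) =
      (fun t : R => g (lift ord0 i) (t *: delta_mx ord0 (lift ord0 i) + rV_cons (s, z)))).
      exact: cg.
    by apply/funext => h; rewrite /gs rV_cons_deltaS.
(* [K z] controls the oscillation along the line above z in the first coordinate, [J z] the
   oscillation inside the slices. *)
pose K z := (\int[leb]_(t in I) `|gs ord0 t z|%:E)%E.
pose J z := (\int[leb]_(s in I) \int[mn]_(y in Q) `|fs s z - fs s y|%:E)%E.
have K0 z : (0 <= K z)%E by apply: integral_ge0 => t _; rewrite lee_fin.
have J0 z : (0 <= J z)%E by apply: integral_ge0 => t _; apply: integral_ge0 => y _; rewrite lee_fin.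
have mG0 : measurable_fun setT (fun zt : 'rV[R]_n * measurableTypeR R => `|gs ord0 zt.2 zt.1|%:E).
  apply/measurable_EFinP; apply: measurableT_comp => //.
  apply: (measurableT_comp (mgs ord0) (g := fun p : 'rV[R]_n * measurableTypeR R => (p.2, p.1))).
  exact: measurable_fun_pair measurable_snd measurable_fst.
have mK : measurable_fun setT K.
  by apply: (measurable_partial_integral leb mI mG0) => -[z t]; rewrite lee_fin.
have mP : measurable_fun setT (fun p : ('rV[R]_n * measurableTypeR R) * 'rV[R]_n =>
    `|fs p.1.2 p.1.1 - fs p.1.2 p.2|%:E).
  apply/measurable_EFinP; apply: measurableT_comp => //; apply: measurable_funB.
    apply: (measurableT_comp mfs (g := fun p : ('rV[R]_n * measurableTypeR R) * 'rV[R]_n => (p.1.2, p.1.1))).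
    apply: measurable_fun_pair.
      exact: (measurableT_comp measurable_snd measurable_fst).
    exact: (measurableT_comp measurable_fst measurable_fst).
  apply: (measurableT_comp mfs (g := fun p : ('rV[R]_n * measurableTypeR R) * 'rV[R]_n => (p.1.2, p.2))).
  apply: measurable_fun_pair; last exact: measurable_snd.
  exact: (measurableT_comp measurable_snd measurable_fst).
have mJ' : measurable_fun setT (fun p : 'rV[R]_n * measurableTypeR R =>
   \int[mn]_(y in Q) `|fs p.2 p.1 - fs p.2 y|%:E)%E.
  by apply: (measurable_partial_integral (lebesgue_rV R n) mQ mP) => x; rewrite lee_fin.
have J'0 (p : 'rV[R]_n * measurableTypeR R) : (0 <= \int[mn]_(y in Q) `|fs p.2 p.1 - fs p.2 y|%:E)%E.
  by apply: integral_ge0 => y _; rewrite lee_fin.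
have mJ : measurable_fun setT J.
  exact: (measurable_partial_integral leb mI mJ' J'0).
have mFF : measurable_fun setT (fun p : 'rV[R]_n.+1 * 'rV[R]_n.+1 => `|f p.1 - f p.2|%:E).
  apply/measurable_EFinP; apply: measurableT_comp => //; apply: measurable_funB.
    exact: (measurableT_comp mf measurable_fst).
  exact: (measurableT_comp mf measurable_snd).
(* The bound does not involve s0, so the last integration over the first coordinate only multiplies
   by the length 2r. *)
have inner s0 z0 : I s0 -> (\int[lebesgue_rV R n.+1]_(y in cube a r) `|f (rV_cons (s0, z0)) - f y|%:E <=
   ((2 * r) ^+ n.+1)%:E * K z0 + J z0)%E.
  move=> Is0; rewrite integral_cube; last 2 first.
    exact: (measurableT_comp mFF (pair1_measurable (rV_cons (s0, z0)))).
    by move=> y; rewrite lee_fin.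
  have mR s : measurable_fun setT (fun y => `|fs s z0 - fs s y|%:E).
    exact: (measurableT_comp mP (pair1_measurable (z0, s))).
  have mRJ : measurable_fun setT (fun s => \int[mn]_(y in Q) `|fs s z0 - fs s y|%:E)%E.
    exact: (measurableT_comp mJ' (pair1_measurable z0)).
  have cQ : (mn Q = ((2 * r) ^+ n)%:E) by exact: cube_measure.
  have cI : (leb I = (2 * r)%:E) by exact: itvc_measure.
  apply: (@le_trans _ _ (\int[leb]_(s in I) (K z0 * mn Q + \int[mn]_(y in Q) `|fs s z0 - fs s y|%:E))%E).
    apply: ge0_le_integral => //.
    - by move=> s _; apply: integral_ge0 => y _; rewrite lee_fin.
    - apply: measurable_funTS; apply: (measurable_partial_integral (lebesgue_rV R n) mQ (f := fun p : measurableTypeR R * 'rV[R]_n => `|f (rV_cons (s0, z0)) - f (rV_cons (p.1, p.2))|%:E)).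
        apply/measurable_EFinP; apply: measurableT_comp => //; apply: measurable_funB => //.
      by move=> x; rewrite lee_fin.
    - apply: measurable_funTS; apply: emeasurable_funD => //.
    - move=> s Is.
      rewrite -(integral_cst mn mQ) -ge0_integralD//; try exact: measurable_funTS; last by move=> y _; exact: K0.
      apply: ge0_le_integral => //.
      + apply: measurable_funTS.
        apply/measurable_EFinP; apply: measurableT_comp => //; apply: measurable_funB => //.
        exact: (measurableT_comp mfs (pair1_measurable s)).
      + by apply: measurable_funTS; apply: emeasurable_funD.
      + move=> y _; apply: (@le_trans _ _ (`|fs s0 z0 - fs s z0|%:E + `|fs s z0 - fs s y|%:E)%E).
          by rewrite -EFinD lee_fin (le_trans _ (ler_normD _ _))// addrA subrK.
        rewrite leeD2r//; apply: (itv_oscillation (F := fun t => fs t z0) (f := fun t => gs ord0 t z0) _ _ Is Is0).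
          move=> t; apply: (is_derive_shift _ (df ord0 (rV_cons (t, z0)))) => h.
          by rewrite /fs [h *: 1]mulr1 rV_cons_delta0.
        rewrite (_ : (fun t => _) =
          (fun t : R => g ord0 (t *: delta_mx ord0 ord0 + rV_cons ((0 : R), z0)))).
          exact: cg.
        by apply/funext => h; rewrite /gs -rV_cons_delta0 addr0.
  rewrite ge0_integralD//; first last.
  - exact: measurable_funTS.
  - by move=> s _; apply: integral_ge0 => y _; rewrite lee_fin.
  - by move=> s _; apply: mule_ge0.
  have ci : (\int[leb]_(s in I) (K z0 * mn Q) = ((2 * r) ^+ n.+1)%:E * K z0)%E.
    apply: (eq_trans (integral_cst leb mI (K z0 * mn Q)%E)).
    transitivity (K z0 * ((2 * r) ^+ n)%:E * (2 * r)%:E)%E.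
      by congr (_ * _ * _)%E; [exact: cQ|exact: cI].
    by rewrite -muleA -EFinM muleC -exprSr.
  by rewrite [X in (X + _ <= _)%E]ci.
have mh : measurable_fun setT (fun x =>
    \int[lebesgue_rV R n.+1]_(y in cube a r) `|f x - f y|%:E)%E.
  apply: (measurable_partial_integral (lebesgue_rV R n.+1) (measurable_cube a r) mFF).
  by move=> x; rewrite lee_fin.
rewrite integral_cube//; last first.
  by move=> x; apply: integral_ge0 => y _; rewrite lee_fin.
have icube i : (\int[lebesgue_rV R n.+1]_(x in cube a r) `|g i x|%:E =
    \int[leb]_(s in I) \int[mn]_(z in Q) `|gs i s z|%:E)%E.
  rewrite integral_cube//.
  by apply/measurable_EFinP; apply: measurableT_comp.
have KE : (\int[mn]_(z in Q) K z = \int[lebesgue_rV R n.+1]_(x in cube a r) `|g ord0 x|%:E)%E.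
  rewrite icube (tonelli_swap (lebesgue_rV R n) leb mQ mI mG0)//.
(* After exchanging the integrals over z and s, the induction hypothesis applies on each slice. *)
have JE : (\int[mn]_(z in Q) J z <=
   ((2 * r) ^+ n.+1)%:E * \sum_i \int[lebesgue_rV R n.+1]_(x in cube a r) `|g (lift ord0 i) x|%:E)%E.
  rewrite /J (tonelli_swap (lebesgue_rV R n) leb mQ mI mJ' J'0).
  have mgi i : measurable_fun setT (fun s => \int[mn]_(z in Q) `|gs (lift ord0 i) s z|%:E)%E.
    apply: (measurable_partial_integral (lebesgue_rV R n) mQ (f := fun p => `|gs (lift ord0 i) p.1 p.2|%:E)).
      by apply/measurable_EFinP; apply: measurableT_comp => //; exact: mgs.
    by move=> x; rewrite lee_fin.
  have gi0 i s : (0 <= \int[mn]_(z in Q) `|gs (lift ord0 i) s z|%:E)%E.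
    by apply: integral_ge0 => z _; rewrite lee_fin.
  have c0 : (0 <= ((2 * r) ^+ n.+1)%:E)%E by rewrite lee_fin exprn_ge0// mulr_ge0// ltW.
  apply: (@le_trans _ _ (\int[leb]_(s in I) (((2 * r) ^+ n.+1)%:E *
      \sum_i \int[mn]_(z in Q) `|gs (lift ord0 i) s z|%:E)))%E.
    apply: ge0_le_integral => //.
    - by move=> s _; apply: integral_ge0 => z _; exact: (J'0 (z, s)).
    - apply: measurable_funTS; apply: (measurable_partial_integral (lebesgue_rV R n) mQ
       (f := fun p : measurableTypeR R * 'rV[R]_n => \int[mn]_(y in Q) `|fs p.1 p.2 - fs p.1 y|%:E)%E).
        apply: (measurableT_comp mJ' (g := fun p : measurableTypeR R * 'rV[R]_n => (p.2, p.1))).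
        exact: measurable_fun_pair measurable_snd measurable_fst.
      by move=> x; exact: (J'0 (x.2, x.1)).
    - apply: measurable_funTS; apply: measurable_funeM; exact: emeasurable_sum.
    - by move=> s _; exact: IHs.
  rewrite ge0_integralZl//; last 2 first.
  - by apply: measurable_funTS; exact: emeasurable_sum.
  - by move=> s _; apply: sume_ge0.
  rewrite ge0_integral_sum//; last first.
    by move=> i; exact: measurable_funTS.
  by under eq_bigr do rewrite -icube.
apply: (@le_trans _ _ (\int[leb]_(t in I) \int[mn]_(z in Q) (((2 * r) ^+ n.+1)%:E * K z + J z)))%E.
  apply: ge0_le_integral => //.
  - move=> s _; apply: integral_ge0 => z _; apply: integral_ge0 => y _; rewrite lee_fin//.
  - apply: measurable_funTS; apply: (measurable_partial_integral (lebesgue_rV R n) mQ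
       (f := fun p => \int[lebesgue_rV R n.+1]_(y in cube a r) `|f (rV_cons p) - f y|%:E)%E).
      exact: (measurableT_comp mh mcons).
    by move=> x; apply: integral_ge0 => y _; rewrite lee_fin.
  - move=> s Is; apply: ge0_le_integral => //.
    + by move=> z _; apply: integral_ge0 => y _; rewrite lee_fin.
    + apply: measurable_funTS.
      exact: (measurableT_comp (measurableT_comp mh mcons) (pair1_measurable s)).
    + by apply: measurable_funTS; apply: emeasurable_funD => //; exact: measurable_funeM.
    + by move=> z _; exact: inner.
have c0 : (0 <= ((2 * r) ^+ n.+1)%:E)%E by rewrite lee_fin exprn_ge0// mulr_ge0// ltW.
set S := (\int[mn]_(z in Q) _)%E.
(* This is the factor 2r that raises the power from n + 1 to n + 2. *)
have ci : (\int[leb]_(s in I) S = (2 * r)%:E * S)%E.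
  apply: (eq_trans (integral_cst leb mI S)); rewrite muleC; congr (_ * _)%E.
  exact: itvc_measure.
rewrite [X in (X <= _)%E]ci /S {ci S} ge0_integralD//; last 3 first.
  by move=> z _; exact: mule_ge0.
  by apply: measurable_funTS; exact: measurable_funeM.
  exact: measurable_funTS.
rewrite ge0_integralZl//; last exact: measurable_funTS.
rewrite KE big_ord_recl (exprS _ n.+1) [X in (_ <= X * _)%E]EFinM -[X in (_ <= X)%E]muleA.
apply: lee_wpmul2l; first by rewrite lee_fin mulr_ge0// ltW.
have G0 i : (0 <= \int[lebesgue_rV R n.+1]_(x in cube a r) `|g i x|%:E)%E.
  by apply: integral_ge0 => x _; rewrite lee_fin.
have S0 : (0 <= \sum_(i < n) \int[lebesgue_rV R n.+1]_(x in cube a r) `|g (lift ord0 i) x|%:E)%E.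
  by apply: sume_ge0.
by rewrite (ge0_muleDr _ (G0 ord0) S0) leeD2l.
Qed.

End poincare.

(** * Positivity of the solution *)

Section logarithm.
Variable R : realType.
Implicit Types e t : R.

Definition logreg e t : R := ln (posreg e t).
Definition dlogreg e t : R := dposreg e t / posreg e t.

Lemma is_derive_logreg e t : 0 < e -> is_derive t (1 : R) (logreg e) (dlogreg e t).
Proof.
move=> e0; have := @is_derive1_comp R (@ln R) (posreg e) t _ _
  (is_derive1_ln (posreg_gt0 t e0)) (is_derive_posreg t e0).
by move=> /is_derive_eq; apply; rewrite /dlogreg mulrC.
Qed.

Lemma continuous_posreg e : 0 < e -> continuous (posreg e).
Proof.
by move=> e0; apply: (continuous_is_derive (f := dposreg e)) => t; exact: is_derive_posreg.
Qed.

Lemma continuous_dlogreg e : 0 < e -> continuous (dlogreg e).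
Proof.
move=> e0 t; apply: cvgM; first exact: continuous_dposreg.
by apply: cvgV; [rewrite gt_eqF ?posreg_gt0|exact: continuous_posreg].
Qed.

Lemma dlogreg_bound e t : 0 < e -> `|dlogreg e t| <= e^-1.
Proof.
move=> e0; have /andP[d0 d1] := dposreg_itv t e0; have U0 := posreg_gt0 t e0.
rewrite normrM normfV (ger0_norm d0) (gtr0_norm U0) -[leRHS]mul1r.
apply: ler_pM => //; first by rewrite invr_ge0 ltW.
by rewrite lef_pV2 ?posrE// eps_le_posreg.
Qed.

Lemma logreg_lipschitz e s t : 0 < e -> `|logreg e t - logreg e s| <= e^-1 * `|t - s|.
Proof.
move=> e0; wlog st : s t / s <= t => [W|].
  have [st|/ltW ts] := leP s t; first exact: W.
  by rewrite distrC (distrC t); exact: W.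
have [] := @MVT_segment R (logreg e) (dlogreg e) s t st.
- by move=> x _; exact: is_derive_logreg.
- apply: continuous_subspaceT.
  by apply: (continuous_is_derive (f := dlogreg e)) => x; exact: is_derive_logreg.
by move=> c _ ->; rewrite normrM ler_wpM2r// dlogreg_bound.
Qed.

End logarithm.

(** * Oscillation of the regularised logarithm on a cube *)

Section log_oscillation.
Variables (R : realType) (N : nat).
Local Notation V := 'rV[R]_N.
Local Notation mu := (lebesgue_rV R N).
Variables (Omega : set V).
Hypothesis oOmega : open Omega.
Hypothesis Ofin : (mu Omega < +oo)%E.
Variable p : R.
Hypothesis hp : 1 < p.
Variables (u : V -> R) (Du : V -> V).
Hypothesis Wu : W01p Omega p u Du.
Variables (a : V) (rho : R).
Hypothesis rho0 : 0 < rho.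
Let Q := cube a rho.
Hypothesis QO : Q `<=` Omega.

Let p0 : 0 < p. Proof. exact: lt_trans hp. Qed.
Let mO : measurable Omega. Proof. exact: open_measurable_rV. Qed.
Let mQ : measurable Q. Proof. exact: measurable_cube. Qed.
Let meas_u : measurable_fun Q u.
Proof. by have [m _] := W01p_measurable Wu; exact: measurable_funS m. Qed.
Let mDu : measurable_fun Q Du.
Proof. by have [_ m] := W01p_measurable Wu; exact: measurable_funS m. Qed.
Let Qfin : (mu Q < +oo)%E. Proof. by rewrite cube_measure// ltry. Qed.

Variable e : R.
Hypothesis e0 : 0 < e.

Let mlog (f : V -> R) (D : set V) : measurable_fun D f -> measurable_fun D (fun x => logreg e (f x)).
Proof.
move=> mf; apply: (measurableT_comp (f := logreg e)) => //; apply: continuous_measurable_fun.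
by apply: (continuous_is_derive (f := dlogreg e)) => x; exact: is_derive_logreg.
Qed.

Let mdlog (f : V -> R) (D : set V) : measurable_fun D f -> measurable_fun D (fun x => dlogreg e (f x)).
Proof.
move=> mf; apply: (measurableT_comp (f := dlogreg e)) => //; apply: continuous_measurable_fun.
exact: continuous_dlogreg.
Qed.

Section smooth.
Variable phi : V -> R.
Hypothesis tphi : test_function Omega phi.

(** For x in A and y in B, the gap be - al is at most |f x - f y| plus two Lipschitz errors e^-1
    |phi - u| from replacing u by phi. Integrate over A x B, enlarge to Q x Q and apply the Poincare
    inequality to f. *)
Lemma log_oscillation_test (A B : set V) (al be : R) :
  measurable A -> measurable B -> A `<=` Q -> B `<=` Q -> al <= be ->
  (forall x, A x -> logreg e (u x) <= al) -> (forall x, B x -> be <= logreg e (u x)) ->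
  mu.-integrable Q (EFin \o (fun x => `|phi x - u x|)) ->
  ((be - al)%:E * mu A * mu B <=
   ((2 * rho) ^+ N.+1)%:E * \sum_i \int[mu]_(x in Q) `|dlogreg e (phi x) * grad phi x ord0 i|%:E
   + (2 * e^-1)%:E * mu Q * \int[mu]_(x in Q) `|phi x - u x|%:E)%E.
Proof.
move=> mA mB AQ BQ ab hA hB iphi.
have [sphi _ _] := tphi; have [dphi _] := sphi 1%N.
have mphi : measurable_fun setT phi by exact: test_measurable tphi.
pose f x := logreg e (phi x).
pose g (i : 'I_N) x := dlogreg e (phi x) * grad phi x ord0 i.
have mf : measurable_fun setT f by exact: mlog.
have mg i : measurable_fun setT (g i).
  apply: measurable_funM; first exact: mdlog.
  by apply: measurable_coord_comp; exact: test_grad_measurable tphi.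
have P := @poincare_cube R N a rho f g rho0 mf mg.
have {}P : (\int[mu]_(x in Q) \int[mu]_(y in Q) `|f x - f y|%:E <=
    ((2 * rho) ^+ N.+1)%:E * \sum_i \int[mu]_(x in Q) `|g i x|%:E)%E.
  apply: P => [i x|i x].
    have [d dE] := derive_compR (delta_mx ord0 i) (dphi x) (is_derive_logreg (phi x) e0).
    apply: DeriveDef; first exact: diff_derivable.
    by rewrite dE /g gradE.
  move=> t; apply: (@continuous_comp _ _ _ (fun t : R => t *: delta_mx ord0 i + x) (g i)).
    by apply: cvgD; [apply: cvgZl; exact: cvg_id|exact: cvg_cst].
  apply: continuousM.
    apply: (@continuous_comp _ _ _ phi (dlogreg e)); last exact: continuous_dlogreg.
    exact: (sphi 0%N).
  apply: (@continuous_comp _ _ _ (grad phi) (fun y : V => y ord0 i)).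
    exact: continuous_grad.
  exact: continuous_coord.
pose E x := e^-1 * `|phi x - u x|.
have E0 x : 0 <= E x by rewrite mulr_ge0 ?invr_ge0 ?(ltW e0).
have mE : measurable_fun Q E.
  apply: measurable_funM; first exact: measurable_cst.
  apply: measurableT_comp => //; apply: measurable_funB => //; exact: measurable_funTS.
have sum_le x y : A x -> B y -> (be - al) <= `|f x - f y| + E x + E y.
  move=> Ax By; have h1 := hA _ Ax; have h2 := hB _ By.
  have h3 := logreg_lipschitz (u x) (phi x) e0; have h4 := logreg_lipschitz (u y) (phi y) e0.
  rewrite -/(f x) -/(E x) in h3; rewrite -/(f y) -/(E y) in h4.
  have h5 : f y - f x <= `|f x - f y| by rewrite distrC ler_norm.
  move: h3; rewrite ler_norml => /andP[h3 h3']; move: h4; rewrite ler_norml => /andP[h4 h4'].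
  lra.
have mFF : measurable_fun setT (fun z : V * V => `|f z.1 - f z.2|%:E).
  apply/measurable_EFinP; apply: measurableT_comp => //; apply: measurable_funB.
    exact: (measurableT_comp mf measurable_fst).
  exact: (measurableT_comp mf measurable_snd).
have mF1 x : measurable_fun setT (fun y => `|f x - f y|%:E).
  exact: (measurableT_comp mFF (pair1_measurable x)).
have mI D : measurable D -> measurable_fun setT (fun x => \int[mu]_(y in D) `|f x - f y|%:E)%E.
  move=> mD; apply: (measurable_partial_integral mu mD mFF) => z; rewrite lee_fin//.
have mEA D : measurable D -> D `<=` Q -> measurable_fun D (EFin \o E).
  by move=> mD DQ; apply/measurable_EFinP; exact: measurable_funS mE.
pose iE := (\int[mu]_(x in Q) (E x)%:E)%E.
have iE0 : (0 <= iE)%E by apply: integral_ge0 => x _; rewrite lee_fin.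
have EQ D : measurable D -> D `<=` Q -> (\int[mu]_(x in D) (E x)%:E <= iE)%E.
  move=> mD DQ; apply: ge0_subset_integral => //; first exact: mEA.
  by move=> x _; rewrite lee_fin.
have step1 x : A x -> ((be - al)%:E * mu B <=
    \int[mu]_(y in Q) `|f x - f y|%:E + (E x)%:E * mu Q + iE)%E.
  move=> Ax; rewrite -(integral_cst mu mB).
  apply: (@le_trans _ _ (\int[mu]_(y in B) (`|f x - f y|%:E + ((E x)%:E + (E y)%:E)))%E).
    apply: ge0_le_integral => //.
    - by move=> y _; rewrite lee_fin subr_ge0.
    - apply: emeasurable_funD; first exact: measurable_funTS.
      by apply: emeasurable_funD => //; exact: mEA.
    - by move=> y By; rewrite -!EFinD lee_fin addrA; exact: sum_le.
  rewrite ge0_integralD//; first last.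
  - by apply: emeasurable_funD => //; exact: mEA.
  - by move=> y _; rewrite -EFinD lee_fin addr_ge0.
  - exact: measurable_funTS.
  rewrite -addeA; apply: leeD.
    by apply: ge0_subset_integral => //; exact: measurable_funTS.
  rewrite ge0_integralD//; first last.
  - exact: mEA.
  - by move=> y _; rewrite lee_fin.
  - by move=> y _; rewrite lee_fin.
  apply: leeD; last exact: EQ.
  have -> := integral_cst mu mB (E x)%:E.
  apply: lee_wpmul2l; first by rewrite lee_fin.
  by apply: le_measure => //; rewrite inE.
have -> : (((be - al)%:E * mu A * mu B) = \int[mu]_(x in A) ((be - al)%:E * mu B))%E.
  by rewrite (integral_cst mu mA) muleAC.
apply: (@le_trans _ _ (\int[mu]_(x in A) (\int[mu]_(y in Q) `|f x - f y|%:E + ((E x)%:E * mu Q + iE)))%E).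
  apply: ge0_le_integral => //.
  - by move=> x _; rewrite mule_ge0// lee_fin subr_ge0.
  - apply: emeasurable_funD; first by apply: measurable_funTS; exact: mI.
    apply: emeasurable_funD => //; apply: emeasurable_funM => //; exact: mEA.
  - by move=> x Ax; rewrite addeA; exact: step1.
rewrite ge0_integralD//; first last.
- apply: emeasurable_funD => //; apply: emeasurable_funM => //; exact: mEA.
- by move=> x _; rewrite adde_ge0// mule_ge0// lee_fin.
- by apply: measurable_funTS; exact: mI.
- by move=> x _; apply: integral_ge0 => y _; rewrite lee_fin.
apply: leeD.
  apply: le_trans P; apply: ge0_subset_integral => //.
  - by apply: measurable_funTS; exact: mI.
  - by move=> x _; apply: integral_ge0 => y _; rewrite lee_fin.
rewrite ge0_integralD//; first last.
- by apply: emeasurable_funM => //; exact: mEA.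
- by move=> x _; rewrite mule_ge0// lee_fin.
have -> := integral_cst mu mA iE.
rewrite (_ : (\int[mu]_(x in A) ((E x)%:E * mu Q) = mu Q * \int[mu]_(x in A) (E x)%:E)%E); last first.
  under eq_integral do rewrite muleC.
  by rewrite ge0_integralZl//; [exact: mEA|move=> x _; rewrite lee_fin].
have iEE : iE = ((e^-1)%:E * \int[mu]_(x in Q) `|phi x - u x|%:E)%E.
  rewrite /iE; under eq_integral do rewrite EFinM.
  rewrite ge0_integralZl//.
  - by apply/measurable_EFinP; apply: measurableT_comp => //; apply: measurable_funB => //; exact: measurable_funTS.
  - by rewrite lee_fin invr_ge0 ltW.
apply: (@le_trans _ _ (mu Q * iE + mu Q * iE)%E).
  apply: leeD.
    by apply: lee_wpmul2l => //; exact: EQ.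
  by rewrite muleC; apply: lee_wpmul2r => //; apply: le_measure => //; rewrite inE.
rewrite iEE cube_measure//.
have iF : (\int[mu]_(x in Q) `|phi x - u x|%:E)%E \is a fin_num by exact: (intg_fin mQ).
rewrite -(fineK iF) -!EFinM -EFinD lee_fin le_eqVlt; apply/orP; left; apply/eqP.
ring.
Qed.

End smooth.

(** The limit along the approximants of u, with e fixed: [dlogreg] is bounded by 1/e, which gives a
    majorant, and the Lipschitz errors vanish. The sets A and B are tied to u, so the left side does
    not move. *)
Lemma log_oscillation (A B : set V) (al be : R) :
  measurable A -> measurable B -> A `<=` Q -> B `<=` Q -> al <= be ->
  (forall x, A x -> logreg e (u x) <= al) -> (forall x, B x -> be <= logreg e (u x)) ->
  ((be - al)%:E * mu A * mu B <=
   ((2 * rho) ^+ N.+1)%:E * \sum_i \int[mu]_(x in Q) `|dlogreg e (u x) * Du x ord0 i|%:E)%E.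
Proof.
move=> mA mB AQ BQ ab hA hB.
have [phi [h [tphi ih H]]] := W01p_approximated oOmega p0 Wu.
have [iu iDu] := W01p_Lp oOmega Ofin p0 Wu.
have QS (f : V -> R) : mu.-integrable Omega (EFin \o f) -> mu.-integrable Q (EFin \o f).
  by move=> fi; exact: integrableS fi.
have HQ : {ae mu, forall x, Q x -> [/\ (fun n => phi n x) @ \oo --> u x,
    (fun n => grad (phi n) x) @ \oo --> Du x,
    forall n, `|phi n x - u x| <= 1 + h x & forall n, `|grad (phi n) x - Du x| <= 1 + h x]}.
  apply: filterS H => x H Qx; have [c1 c2 h1 h2] := H (QO Qx); split => // n.
    have := @powR_le1D R `|phi n x - u x| 1 p (normr_ge0 _) ler01 (ltW hp).
    by rewrite powRr1// => /le_trans; apply; rewrite lerD2l.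
  have := @powR_le1D R `|grad (phi n) x - Du x| 1 p (normr_ge0 _) ler01 (ltW hp).
  by rewrite powRr1// => /le_trans; apply; rewrite lerD2l.
have i1h : mu.-integrable Q (EFin \o (fun x => 1 + h x)).
  by apply: intgD => //; [exact: intg_cst|exact: QS].
have mphi n : measurable_fun Q (phi n) by exact: test_measurable (tphi n).
have mgphi n : measurable_fun Q (grad (phi n)) by exact: test_grad_measurable (tphi n).
have mD n : measurable_fun Q (fun x => `|phi n x - u x|).
  by apply: measurableT_comp => //; exact: measurable_funB.
have iphi n : mu.-integrable Q (EFin \o (fun x => `|phi n x - u x|)).
  apply: (intg_le_ae mQ _ i1h) => //; apply: filterS HQ => x HQ Qx.
  by have [_ _ h1 _] := HQ Qx; rewrite normr_id.
have cD : (fun n => \int[mu]_(x in Q) `|phi n x - u x|%:E)%E @ \oo --> 0%E.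
  have [] := @dct_real _ _ _ mu Q mQ (fun n x => `|phi n x - u x|) (fun=> 0) _ mD _ i1h _.
  - exact: measurable_cst.
  - apply: filterS HQ => x HQ Qx; have [c1 _ h1 _] := HQ Qx; split.
      by apply/norm_cvg0P/subr_cvg0.
    by move=> n; rewrite normr_id.
  - by move=> _; rewrite integral0.
have cG i : (fun n => \int[mu]_(x in Q) `|dlogreg e (phi n x) * grad (phi n) x ord0 i|%:E)%E @ \oo -->
    (\int[mu]_(x in Q) `|dlogreg e (u x) * Du x ord0 i|%:E)%E.
  have [] := @dct_real _ _ _ mu Q mQ (fun n x => `|dlogreg e (phi n x) * grad (phi n) x ord0 i|)
     (fun x => `|dlogreg e (u x) * Du x ord0 i|)
     (fun x => e^-1 * ((1 + h x) + (1 + `|Du x| `^ p))) _ _ _ _; last by move=> _.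
  - move=> n; apply: measurableT_comp => //; apply: measurable_funM; first exact: mdlog.
    exact: measurable_coord_comp.
  - apply: measurableT_comp => //; apply: measurable_funM; first exact: mdlog.
    exact: measurable_coord_comp.
  - apply: intgZ => //; apply: intgD => //; apply: intgD => //; first exact: intg_cst.
    exact: QS.
  - apply: filterS HQ => x HQ Qx; have [c1 c2 h1 h2] := HQ Qx; split.
      apply: cvg_norm; apply: cvgM.
        by apply: (cvg_comp _ (dlogreg e) c1); exact: continuous_dlogreg.
      by apply: (cvg_comp _ (fun y : V => y ord0 i) c2); exact: continuous_coord.
    move=> n; rewrite normr_id normrM; apply: ler_pM => //; first exact: dlogreg_bound.
    apply: (le_trans (coord_le_norm _ _)).
    rewrite -[X in `|X|](subrK (Du x)) (le_trans (ler_normD _ _))// lerD//.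
    have := @powR_le1D R `|Du x| 1 p (normr_ge0 _) ler01 (ltW hp).
    by rewrite powRr1.
have le n := log_oscillation_test (tphi n) mA mB AQ BQ ab hA hB (iphi n).
have cS : (fun n => \sum_i \int[mu]_(x in Q) `|dlogreg e (phi n x) * grad (phi n) x ord0 i|%:E)%E @ \oo -->
    (\sum_i \int[mu]_(x in Q) `|dlogreg e (u x) * Du x ord0 i|%:E)%E.
  apply: cvg_nnesum => // i _.
  by apply: nearW => n; apply: integral_ge0 => x _; rewrite lee_fin.
have c1 := cvgeZl (isT : ((2 * rho) ^+ N.+1)%:E \is a fin_num) cS.
have Qf : ((2 * e^-1)%:E * mu Q)%E \is a fin_num by rewrite cube_measure.
have c2 := cvgeZl Qf cD; rewrite mule0 in c2.
have c3 : (fun n => ((2 * rho) ^+ N.+1)%:E * \sum_i \int[mu]_(x in Q) `|dlogreg e (phi n x) * grad (phi n) x ord0 i|%:E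
   + (2 * e^-1)%:E * mu Q * \int[mu]_(x in Q) `|phi n x - u x|%:E)%E @ \oo -->
   (((2 * rho) ^+ N.+1)%:E * \sum_i \int[mu]_(x in Q) `|dlogreg e (u x) * Du x ord0 i|%:E + 0)%E.
  by apply: cvgeD => //; rewrite fin_num_adde_defl.
rewrite adde0 in c3.
by apply: cvge_ge c3; exact: nearW.
Qed.

End log_oscillation.

(** * Locally negligible sets *)

Section negligible_local.
Variables (R : realType) (N : nat).
Local Notation V := 'rV[R]_N.
Local Notation mu := (lebesgue_rV R N).

Lemma open_cube (a : V) r : open (cube a r).
Proof.
rewrite openE => x ax.
have H : \forall y \near (x : V), forall i : 'I_N, `|(y : V) ord0 i - a ord0 i| < r.
  have := @filter_forall V 'I_N
    (fun i y => `|y ord0 i - a ord0 i| < r) (nbhs x) (nbhs_filter x).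
  apply => i.
  have c : (fun y : V => `|y ord0 i - a ord0 i|) @ x --> `|x ord0 i - a ord0 i|.
    have c0 : (fun y : V => y ord0 i) @ x --> x ord0 i by exact: continuous_coord.
    exact: (cvg_norm (cvgB c0 (cvg_cst (a ord0 i)))).
  by apply: (cvgr_lt _ c).
exact: H.
Qed.

Lemma cube_center (a : V) r : 0 < r -> cube a r a.
Proof. by move=> r0 i; rewrite subrr normr0. Qed.

Lemma cube_sub (x : V) (U : set V) : open U -> U x -> exists2 r, 0 < r & forall y, `|y - x| <= r -> U y.
Proof.
rewrite openE => oU Ux; have /nbhs_closedballP[r rU] := oU _ Ux.
exists r%:num => // y yr; apply: rU; rewrite closed_ballE//= /closed_ball_ /=.
by rewrite distrC.
Qed.

(** A Lindelof argument: countably many rational cubes on which S is negligible already cover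
    Omega. *)
Lemma negligible_local (Omega S : set V) :
  (forall x, Omega x -> exists2 r, 0 < r & mu.-negligible (cube x r `&` S)) ->
  mu.-negligible (Omega `&` S).
Proof.
move=> loc.
pose F (i : 'rV[rat]_N * nat) : set V := cube (\row_j ratr (i.1 ord0 j)) i.2.+1%:R^-1.
pose G n : set V := if @unpickle ('rV[rat]_N * nat)%type n is Some i then
  (if `[< mu.-negligible (F i `&` S) >] then F i `&` S else set0) else set0.
apply: (@negligibleS _ _ _ _ (\bigcup_n G n)).
  move=> x [Ox Sx]; have [r r0 nr] := loc x Ox.
  (* Two points of a cube of half-side 1/(k+1) differ by less than 2/(k+1) < r in each coordinate,
     so a rational cube containing x lies in [cube x r]. *)
  have [k kr] : exists k : nat, k.+1%:R^-1 < r / 2.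
    have := @cvg_harmonic R; move=> /cvgr0Pnorm_lt/(_ (r / 2)).
    rewrite divr_gt0// => /(_ isT)[k _ /(_ k (leqnn k))] /=.
    by rewrite ger0_norm ?invr_ge0//; exists k.
  have /choice[q qP] : forall i : 'I_N, exists q : rat, `|x ord0 i - ratr q| < k.+1%:R^-1.
    move=> i; have /rat_in_itvoo[q] : x ord0 i - k.+1%:R^-1 < x ord0 i + k.+1%:R^-1.
      by rewrite ltrBlDr -addrA ltrDl addr_gt0// invr_gt0.
    by rewrite in_itv/= => /andP[h1 h2]; exists q; rewrite ltr_distlC h1.
  pose i : 'rV[rat]_N * nat := (\row_j q j, k).
  exists (pickle i) => //; rewrite /G pickleK ifT; last first.
    apply/asboolP; apply: negligibleS nr => y [Fy Sy]; split=> // j.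
    have := Fy j; have := qP j; rewrite !mxE /i /= => h1 h2.
    have {h1 h2} h : `|y ord0 j - ratr (q j)| + `|ratr (q j) - x ord0 j| < r.
      rewrite (distrC (ratr _)); apply: lt_trans (ltrD h2 h1) _; move: kr; set d := _^-1; lra.
    apply: le_lt_trans h; rewrite (_ : y ord0 j - x ord0 j = (y ord0 j - ratr (q j)) + (ratr (q j) - x ord0 j)).
      exact: ler_normD.
    by rewrite addrA subrK.
  by split=> // j; rewrite !mxE; exact: qP.
apply: negligible_bigcup => n; rewrite /G; case: unpickle => [i|]; last exact: negligible_set0.
by case: ifPn => [/asboolP//|_]; exact: negligible_set0.
Qed.

End negligible_local.

(** * From the logarithmic estimate to strict positivity *)

Section positivity.
Variables (R : realType) (N : nat).
Local Notation V := 'rV[R]_N.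
Local Notation mu := (lebesgue_rV R N).
Variables (Omega : set V).
Hypothesis oOmega : open Omega.
Hypothesis Ofin : (mu Omega < +oo)%E.
Variables (p q : R).
Hypothesis hp : 1 < p.
Hypothesis hq : 1 < q.
Variable H : V -> R.
Hypothesis hH0 : forall z, 0 <= H z.
Hypothesis hHC1 : Ck 1 H.
Hypothesis hHconv : @convex_function R V setT H.
Hypothesis hHhom : p_homogeneous p H.
Variable C : R.
Hypothesis hC : 1 <= C.
Hypothesis hHbnd : forall z, C^-1 * enorm z `^ p <= H z <= C * enorm z `^ p.
Variables (lam : R) (u : V -> R) (Du : V -> V).
Hypothesis hlam : 0 < lam.
Hypothesis hu0 : {ae mu, forall x, Omega x -> 0 <= u x}.
Hypothesis husol : weak_solution Omega p q H lam u Du.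

Let p0 : 0 < p. Proof. exact: lt_trans hp. Qed.
Let mO : measurable Omega. Proof. exact: open_measurable_rV. Qed.
Let Wu : W01p Omega p u Du. Proof. by have [] := husol. Qed.

Section local.
Variables (a : V) (r : R).
Hypothesis r0 : 0 < r.
Hypothesis rO : forall x, `|x - a| <= r -> Omega x.
(** The radius of [bump_lb], so that the cutoff is bounded below on [Q]. *)
Let rho := r / (2 * N.+1%:R).
Let Q := cube a rho.

Let rho0 : 0 < rho. Proof. by rewrite divr_gt0// mulr_gt0. Qed.

Let rho_le x : Q x -> `|x - a| <= rho.
Proof.
move=> Qx; apply: norm_le_coord => [|i]; first exact: ltW.
by rewrite !mxE; apply: ltW; exact: Qx.
Qed.

Let QO : Q `<=` Omega.
Proof.
move=> x /rho_le xr; apply: rO; apply: (le_trans xr).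
rewrite ler_pdivrMr ?mulr_gt0// ler_peMr ?(ltW r0)//.
have : 1 <= N.+1%:R :> R by rewrite ler1n.
lra.
Qed.

Let mQ : measurable Q. Proof. exact: measurable_cube. Qed.

(** The p-th power of |Du| / [posreg] is bounded on Q by [caccioppoli] with a bump as cutoff,
    uniformly in e. The inequality s <= 1 + s^p then replaces Holder's. *)
Lemma dlog_bound : exists2 K : R, 0 <= K & forall e, 0 < e -> e <= 1 -> forall i,
  (\int[mu]_(x in Q) `|dlogreg e (u x) * Du x ord0 i|%:E <= K%:E)%E.
Proof.
have tb := bump_test r0 rO.
have [c c0 cb] := bump_lb a r0.
set b := bump a r in tb cb.
have [meas_u mDu] := W01p_measurable Wu.
pose J := (\int[mu]_(x in Omega) (4^-1 `^ (1 - p) * H (grad b x) + (p - 1) * H (Du x))%:E)%E.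
have J0 : (0 <= J)%E.
  apply: integral_ge0 => x _; rewrite lee_fin addr_ge0// mulr_ge0// ?powR_ge0//.
  by rewrite subr_ge0 ltW.
have Jfin : J \is a fin_num.
  apply: (intg_fin mO); apply: intgD => //; apply: intgZ => //.
    exact: (integrable_H_test oOmega Ofin hp hH0 hHC1 hC hHbnd tb).
  exact: (integrable_H oOmega Ofin hp hH0 hHC1 hC hHbnd Wu).
pose D := C / c `^ p.
have cp0 : 0 < c `^ p by exact: powR_gt0.
have D0 : 0 <= D by rewrite divr_ge0 ?powR_ge0// (le_trans ler01).
have p40 : 0 < (p - 1) / 4 by rewrite divr_gt0// subr_gt0.
(* The measure of Q comes from the 1 in s <= 1 + s^p; D = C / c^p pays for replacing |Du|^p by H(Du)
   and for inserting the cutoff, at least c on Q. *)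
exists ((2 * rho) ^+ N + D * (((p - 1) / 4)^-1 * fine J)).
  apply: addr_ge0; first by rewrite exprn_ge0// mulr_ge0// ltW.
  by rewrite mulr_ge0// mulr_ge0 ?fine_ge0// invr_ge0 ltW.
move=> e e0 e1 i.
have [intf le1] := caccioppoli oOmega Ofin hp hH0 hHC1 hHconv hHhom hC hHbnd hlam hu0 husol tb e0 e1.
pose f x := (`|b x| / posreg e (u x)) `^ p * H (Du x).
have f0 x : 0 <= f x by rewrite mulr_ge0 ?powR_ge0.
have mf : measurable_fun Omega f by apply/measurable_EFinP; exact: (measurable_int _ intf).
have mfQ : measurable_fun Q f by exact: measurable_funS mf.
have ifin := intg_fin mO intf.
have le2 : (\int[mu]_(x in Omega) (f x)%:E <= (((p - 1) / 4)^-1 * fine J)%:E)%E.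
  rewrite -(fineK ifin) lee_fin -(ler_pM2l p40) mulrA mulfV ?gt_eqF// mul1r.
  by rewrite -lee_fin EFinM !fineK.
have pt x : Q x -> `|dlogreg e (u x) * Du x ord0 i| <= 1 + D * f x.
  move=> Qx; have U0 := posreg_gt0 (u x) e0.
  have /andP[d0 d1] := dposreg_itv (u x) e0.
  apply: (@le_trans _ _ (`|Du x| / posreg e (u x))).
    rewrite normrM mulrC; apply: ler_pM => //; first exact: coord_le_norm.
    rewrite normrM normfV (ger0_norm d0) (gtr0_norm U0) -[leRHS]mul1r.
    by apply: ler_wpM2r => //; rewrite invr_ge0 ltW.
  have X0 : 0 <= `|Du x| / posreg e (u x) by rewrite divr_ge0// ltW.
  have := powR_le1D X0 ler01 (ltW hp); rewrite powRr1// => /le_trans; apply.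
  rewrite lerD2l powRM ?invr_ge0 ?(ltW U0)// /D /f.
  have b0 : c <= `|b x| by rewrite ger0_norm ?bump_ge0//; apply: cb; exact: rho_le.
  have h1 : `|Du x| `^ p <= C * H (Du x).
    have /andP[h _] := hHbnd (Du x).
    have C0 : 0 < C by exact: lt_le_trans hC.
    rewrite -(ler_pM2l C0) mulrA mulfV ?gt_eqF// mul1r in h; apply: le_trans h.
    apply: ge0_ler_powR; rewrite ?nnegrE ?sqrtr_ge0//; [exact: ltW|exact: norm_le_enorm].
  have h2 : c `^ p <= `|b x| `^ p.
    by apply: ge0_ler_powR; rewrite ?nnegrE ?(ltW c0)//; exact: ltW.
  rewrite powRM ?invr_ge0 ?(ltW U0)//.
  set w := (posreg _ _)^-1 `^ p.
  have w0 : 0 <= w by exact: powR_ge0.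
  apply: (@le_trans _ _ (C * H (Du x) * w)); first exact: ler_wpM2r.
  have -> : C / c `^ p * (`|b x| `^ p * w * H (Du x)) = (`|b x| `^ p / c `^ p) * (C * H (Du x) * w).
    by ring.
  apply: ler_peMl; first by rewrite !mulr_ge0// (le_trans ler01).
  by rewrite ler_pdivlMr// mul1r.
apply: (@le_trans _ _ (\int[mu]_(x in Q) (1%:E + D%:E * (f x)%:E))%E).
  apply: ge0_le_integral => //.
  - apply/measurable_EFinP; apply: measurableT_comp => //; apply: measurable_funM.
      apply: (measurableT_comp (f := dlogreg e)).
        by apply: continuous_measurable_fun; exact: continuous_dlogreg.
      exact: measurable_funS meas_u.
    by apply: measurable_coord_comp; exact: measurable_funS mDu.
  - by apply: emeasurable_funD => //; apply: measurable_funeM; exact/measurable_EFinP.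
rewrite ge0_integralD//; first last.
- by apply: measurable_funeM; exact/measurable_EFinP.
- by move=> x _; rewrite mule_ge0// lee_fin.
rewrite ge0_integralZl//; first last.
- by move=> x _; rewrite lee_fin.
- exact/measurable_EFinP.
have -> := integral_cst mu mQ 1%:E.
rewrite EFinD; apply: leeD.
  have E : mu Q = ((2 * rho) ^+ N)%:E by exact: cube_measure.
  by rewrite -E mul1e.
rewrite [leRHS]EFinM; apply: lee_wpmul2l; first by rewrite lee_fin.
apply: le_trans le2; apply: ge0_subset_integral => //; last by move=> x _; rewrite lee_fin.
exact/measurable_EFinP.
Qed.

(** If the zero set A has positive measure, the bound on the oscillation of the logarithm, uniform
    in e, forces each level set {u >= 1/(k+1)} to be negligible. *)
Lemma zero_dichotomy : mu.-negligible (Q `&` [set x | u x = 0]) \/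
  mu.-negligible (Q `&` [set x | 0 < u x]).
Proof.
have [meas_u mDu] := W01p_measurable Wu.
have muQ : measurable_fun Q u by exact: measurable_funS meas_u.
have [|nA] := pselect (mu.-negligible (Q `&` [set x | u x = 0])); [by left|right].
have mA : measurable (Q `&` [set x | u x = 0]).
  exact: (muQ mQ [set 0] (measurable_set1 _)).
set A := Q `&` _ in nA mA.
have le_cube B : measurable B -> B `<=` Q -> (mu B <= ((2 * rho) ^+ N)%:E)%E.
  by move=> mB BQ; rewrite -(cube_measure a rho0); apply: le_measure; rewrite ?inE.
have finB B : measurable B -> B `<=` Q -> mu B \is a fin_num.
  by move=> mB BQ; rewrite ge0_fin_numE//; apply: le_lt_trans (le_cube _ mB BQ) _; exact: ltry.
have AQ : A `<=` Q by move=> x [].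
have A0 : 0 < fine (mu A).
  rewrite lt0r fine_ge0// andbT; apply/eqP => mA0; apply: nA.
  have E : mu A = 0%E by rewrite -(fineK (finB _ mA AQ)) mA0.
  exact/negligibleP.
have [K K0 KP] := dlog_bound.
pose B (k : nat) := Q `&` [set x | k.+1%:R^-1 <= u x].
have mB k : measurable (B k).
  have := muQ mQ `[k.+1%:R^-1, +oo[%classic (measurable_itv _).
  by congr measurable; apply/seteqP; split => x [Qx] /=; rewrite in_itv/= andbT.
apply: (@negligibleS _ _ _ _ (\bigcup_k B k)).
  move=> x [Qx ux]; have := @cvg_harmonic R; move=> /cvgr0Pnorm_lt/(_ (u x) ux)[k _ /(_ k (leqnn k))] /=.
  by rewrite ger0_norm ?invr_ge0// => /ltW h; exists k.
apply: negligible_bigcup => k; apply/negligibleP => //.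
have BQ : B k `<=` Q by move=> x [].
have Bf := finB _ (mB k) BQ.
suff E : mu (B k) = 0%E by exact: E.
rewrite -(fineK Bf); congr EFin; apply/eqP; rewrite eq_le fine_ge0// andbT leNgt; apply/negP => B0.
pose M := (2 * rho) ^+ N.+1 * (N%:R * K).
have M0 : 0 <= M by rewrite !mulr_ge0// exprn_ge0// mulr_ge0// ltW.
pose eta : R := k.+1%:R^-1.
have eta0 : 0 < eta by rewrite invr_gt0.
have eta1 : eta <= 1 by rewrite invf_le1// ler1n.
(* Chosen so that t |A| |B_k| = M + |A| |B_k|, which exceeds the bound M. *)
pose t := M / (fine (mu A) * fine (mu (B k))) + 1.
have AB0 : 0 < fine (mu A) * fine (mu (B k)) by exact: mulr_gt0.
have t0 : 0 < t by rewrite ltr_wpDl// divr_ge0// ltW.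
(* On A the regularised logarithm equals ln(3e/2) by [posreg0]; this e makes it ln eta - t, exactly
   t below its lower bound ln eta on B_k. *)
pose e := 2 / 3 * (eta * expR (- t)).
have e0 : 0 < e by rewrite !mulr_gt0// expR_gt0.
have et1 : eta * expR (- t) <= 1.
  by rewrite -[leRHS]mulr1; apply: ler_pM => //; rewrite ?(ltW eta0) ?expR_ge0// -expR0 ler_expR oppr_le0 ltW.
have e1 : e <= 1 by rewrite /e; lra.
have alE : ln (3 / 2 * e) = ln eta - t.
  rewrite (_ : 3 / 2 * e = eta * expR (- t)); last by rewrite /e; field.
  by rewrite lnM ?posrE ?expR_gt0// expRK.
have := log_oscillation oOmega Ofin hp Wu rho0 QO e0 mA (mB k) AQ BQ (al := ln (3 / 2 * e)) (be := ln eta).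
rewrite alE; have -> : ln eta - (ln eta - t) = t by ring.
move=> /(_ _ _ _) H1.
have : (t%:E * mu A * mu (B k) <= M%:E)%E.
  apply: (@le_trans _ _ (((2 * rho) ^+ N.+1)%:E * \sum_i \int[mu]_(x in Q) `|dlogreg e (u x) * Du x ord0 i|%:E)%E).
    apply: H1.
    - by rewrite gerBl ltW.
    - by move=> x [_ /= ->]; rewrite /logreg posreg0// alE.
    - move=> x [_ /= ux]; rewrite /logreg ler_ln ?posrE ?posreg_gt0//.
      by apply: (le_trans ux); apply: le_trans (posreg_ge (u x) e0); rewrite lerDl ltW.
  rewrite /M EFinM; apply: lee_wpmul2l; first by rewrite lee_fin exprn_ge0// mulr_ge0// ltW.
  apply: (@le_trans _ _ (\sum_(i < N) K%:E)%E); first by apply: lee_sum => i _; exact: KP.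
  by rewrite sumEFin sumr_const card_ord mulr_natl.
rewrite -(fineK Bf) -(fineK (finB _ mA AQ)) -!EFinM lee_fin -mulrA /t mulrDl mul1r.
rewrite mulfVK ?gt_eqF// gerDl leNgt AB0//.
Qed.

End local.

Hypothesis cOmega : connected Omega.
Hypothesis hunt : ~ {ae mu, forall x, Omega x -> u x = 0}.

(** The points near which u > 0 a.e. and those near which u = 0 a.e. form two open sets that
    partition Omega; connectedness leaves one, and nontriviality excludes the second. *)
Lemma solution_pos : {ae mu, forall x, Omega x -> 0 < u x}.
Proof.
pose Z := [set x : V | u x = 0]; pose P := [set x : V | 0 < u x].
(* The points near which S is negligible; thus [loc Z] is where u is locally positive, not where it
   vanishes. *)
pose loc S := [set x | exists2 r, 0 < r & mu.-negligible (cube x r `&` S)] : set V.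
have oloc S : open (loc S).
  rewrite openE => x [r r0 nr].
  have : nbhs x (cube x (r / 2)).
    by apply: open_nbhs_nbhs; split; [exact: open_cube|apply: cube_center; rewrite divr_gt0].
  apply: filterS => y xy; exists (r / 2); first by rewrite divr_gt0.
  apply: negligibleS nr => z [yz Sz]; split=> // i.
  have := xy i; have := yz i; rewrite /= => h1 h2.
  rewrite -[z ord0 i](subrK (y ord0 i)) -addrA; apply: le_lt_trans (ler_normD _ _) _; lra.
have dich x : Omega x -> loc Z x \/ loc P x.
  move=> Ox; have [r r0 rO] := cube_sub oOmega Ox.
  have [h|h] := zero_dichotomy r0 rO.
    by left; exists (r / (2 * N.+1%:R)) => //; rewrite divr_gt0// mulr_gt0.
  by right; exists (r / (2 * N.+1%:R)) => //; rewrite divr_gt0// mulr_gt0.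
(* Otherwise a whole cube around x would be covered by null sets: the zeros, the positive values and
   the exceptional set of u >= 0. *)
have disj x : Omega x -> ~ (loc Z x /\ loc P x).
  move=> Ox [[r1 r10 n1] [r2 r20 n2]]; have [r r0 rO] := cube_sub oOmega Ox.
  pose s := Num.min r (Num.min r1 r2).
  have s0 : 0 < s by rewrite !lt_min r0 r10 r20.
  have : mu.-negligible (cube x s).
    apply: (@negligibleS _ _ _ _ ((cube x r1 `&` Z) `|` (cube x r2 `&` P) `|` ~` [set x | Omega x -> 0 <= u x])).
      move=> y xy.
      have sl i : `|y ord0 i - x ord0 i| < r /\ (`|y ord0 i - x ord0 i| < r1 /\ `|y ord0 i - x ord0 i| < r2).
        by have := xy i; rewrite /s !lt_min => /and3P[].
      have Oy : Omega y.
        apply: rO; apply: norm_le_coord => [|i]; first exact: ltW.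
        by rewrite !mxE ltW// (sl i).1.
      have [uy|uy] := pselect (0 <= u y); last by right => /(_ Oy).
      left; move: uy; rewrite le_eqVlt => /predU1P[uy|uy]; [left|right]; split => // i.
        exact: (sl i).2.1.
      exact: (sl i).2.2.
    by apply: negligibleU => //; exact: negligibleU.
  move=> /(negligibleP _ (measurable_cube x s)) h.
  have /eqP : ((2 * s) ^+ N)%:E = 0%E by rewrite -(cube_measure x s0); exact: h.
  by rewrite eqe gt_eqF// exprn_gt0// mulr_gt0.
have [[x0 [Ox0 Lx0]]|none] := pselect (exists x, Omega x /\ loc Z x).
  have E : Omega `&` loc Z = Omega.
    (* Connectedness is used in its clopen form: the trace of [loc Z] on Omega is also the trace of
       the closed complement of [loc P]. *)
    apply: cOmega; first by exists x0.
      by exists (loc Z).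
    exists (~` loc P); first by rewrite closedC.
    apply/seteqP; split => x [Ox]; first by move=> h1; split=> // h2; exact: (disj _ Ox).
    by move=> h; split=> //; have [|/h] := dich x Ox.
  have nZ : mu.-negligible (Omega `&` Z).
    apply: negligible_local => x Ox; have : (Omega `&` loc Z) x by rewrite E.
    by case.
  apply: (@negligibleS _ _ _ _ ((Omega `&` Z) `|` ~` [set x | Omega x -> 0 <= u x])); last first.
    exact: negligibleU.
  move=> x /= nx.
  have Ox : Omega x by apply: contrapT => nOx; apply: nx.
  have [ux|ux] := pselect (0 <= u x); last by right => /(_ Ox).
  left; split => //; rewrite /Z/=; apply: contrapT => u0; apply: nx => _.
  by rewrite lt0r ux andbT; apply/eqP.
exfalso; apply: hunt.
have nP : mu.-negligible (Omega `&` P).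
  apply: negligible_local => x Ox; have [h|//] := dich x Ox.
  by exfalso; apply: none; exists x.
apply: (@negligibleS _ _ _ _ ((Omega `&` P) `|` ~` [set x | Omega x -> 0 <= u x])); last first.
  exact: negligibleU.
move=> x /= nx.
have Ox : Omega x by apply: contrapT => nOx; apply: nx.
have [ux|ux] := pselect (0 <= u x); last by right => /(_ Ox).
left; split => //; rewrite /P/= lt0r ux andbT; apply/eqP => u0; exact: nx.
Qed.

End positivity.

(** * Minimality *)

Section minimality.
Variables (R : realType) (N : nat).
Local Notation V := 'rV[R]_N.
Local Notation mu := (lebesgue_rV R N).
Variables (Omega : set V).
Hypothesis oOmega : open Omega.
Hypothesis Ofin : (mu Omega < +oo)%E.
Variables (p q : R).
Hypothesis hp : 1 < p.
Hypothesis hq : 1 < q.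
Hypothesis hqp : q <= p.
Variable H : V -> R.
Hypothesis hH0 : forall z, 0 <= H z.
Hypothesis hHC1 : Ck 1 H.
Hypothesis hHconv : @convex_function R V setT H.
Hypothesis hHhom : p_homogeneous p H.
Variable C : R.
Hypothesis hC : 1 <= C.
Hypothesis hHbnd : forall z, C^-1 * enorm z `^ p <= H z <= C * enorm z `^ p.
Variables (lam : R) (u : V -> R) (Du : V -> V).
Hypothesis hu0 : {ae mu, forall x, Omega x -> 0 <= u x}.
Hypothesis husol : weak_solution Omega p q H lam u Du.
Hypothesis upos : {ae mu, forall x, Omega x -> 0 < u x}.

Let p0 : 0 < p. Proof. exact: lt_trans hp. Qed.
Let q0 : 0 < q. Proof. exact: lt_trans hq. Qed.
Let mO : measurable Omega. Proof. exact: open_measurable_rV. Qed.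
Let Wu : W01p Omega p u Du. Proof. by have [] := husol. Qed.
Let qp0 : 0 <= q / p. Proof. by apply: divr_ge0; exact: ltW. Qed.
Let qp1 : 0 <= 1 - q / p. Proof. by rewrite subr_ge0 ler_pdivrMr// mul1r. Qed.

(** Dominated convergence along the approximants of w: q <= p gives |phi_n|^q <= 1 + |phi_n|^p, and
    the growth of H controls the gradients. *)
Lemma hidden_convexity w Dw : W01p Omega p w Dw ->
  (lam%:E * \int[mu]_(x in Omega) (`|w x| `^ q)%:E <=
   \int[mu]_(x in Omega) ((q / p) * H (Dw x) + (1 - q / p) * H (Du x))%:E)%E.
Proof.
move=> W.
have [phi [h [tphi ih ap]]] := W01p_approximated oOmega p0 W.
have [iw iDw] := W01p_Lp oOmega Ofin p0 W; have [mw mDw] := W01p_measurable W.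
have [_ mDu] := W01p_measurable Wu.
have iA := integrable_H oOmega Ofin hp hH0 hHC1 hC hHbnd Wu.
pose S z x := (q / p) * H z + (1 - q / p) * H (Du x).
have mS F : measurable_fun Omega F -> measurable_fun Omega (fun x => S (F x) x).
  move=> mF; apply: measurable_funD; apply: measurable_funM => //.
    exact: (measurable_H hHC1 mF).
  exact: (measurable_H hHC1 mDu).
have S0 z x : 0 <= S z x by apply: addr_ge0; apply: mulr_ge0.
have mq (F : V -> R) : measurable_fun Omega F -> measurable_fun Omega (fun x : V => `|F x| `^ q : R).
  by move=> mF; apply: measurable_powR_comp; exact: measurableT_comp.
have [||||_ cf] := @dct_real _ _ _ mu Omega mO (fun n x => `|phi n x| `^ q)
  (fun x => `|w x| `^ q) (fun x => 1 + 2 `^ p * (h x + `|w x| `^ p)).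
- by move=> n; apply: mq; exact: test_measurable (tphi n).
- exact: mq.
- by apply: intgD => //; [exact: intg_cst|apply: intgZ => //; exact: intgD].
- apply: filterS ap => x ap Ox; have [c1 _ b1 _] := ap Ox; split.
    by apply: cvg_powR => //; apply: cvg_norm.
  move=> n; rewrite ger0_norm ?powR_ge0//.
  apply: (le_trans (powR_le1D (normr_ge0 _) (ltW q0) hqp)); rewrite lerD2l.
  apply: (le_trans (powR_distD p0 _ (w x))); rewrite ler_wpM2l ?powR_ge0// lerD2r.
  by rewrite distrC.
have [||||_ cg] := @dct_real _ _ _ mu Omega mO (fun n x => S (grad (phi n) x) x)
  (fun x => S (Dw x) x)
  (fun x => (q / p) * (C * N%:R `^ p * (2 `^ p * (h x + `|Dw x| `^ p))) + (1 - q / p) * H (Du x)).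
- by move=> n; apply: mS; exact: test_grad_measurable (tphi n).
- exact: mS.
- apply: intgD => //; last exact: intgZ.
  by do 3 apply: intgZ => //; exact: intgD.
- apply: filterS ap => x ap Ox; have [_ c2 _ b2] := ap Ox; split.
    apply: cvgD; last exact: cvg_cst.
    apply: cvgMr; apply: (cvg_comp _ _ c2); exact: (Ck_continuous hHC1).
  move=> n; rewrite ger0_norm//; apply: lerD => //; apply: ler_wpM2l => //.
  apply: (le_trans (growth hp hC hHbnd _)); apply: ler_wpM2l.
    by rewrite mulr_ge0 ?powR_ge0// (le_trans ler01).
  apply: (le_trans (powR_distD p0 _ (Dw x))); rewrite ler_wpM2l ?powR_ge0// lerD2r.
  by rewrite distrC.
have ub n : (lam%:E * \int[mu]_(x in Omega) (`|phi n x| `^ q)%:E <=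
    \int[mu]_(x in Omega) (S (grad (phi n) x) x)%:E)%E.
  exact: (test_limit oOmega Ofin hp hq hqp hH0 hHC1 hHconv hHhom hC hHbnd hu0 husol (tphi n) upos).
have cl : (fun n => lam%:E * \int[mu]_(x in Omega) (`|phi n x| `^ q)%:E)%E @ \oo -->
    (lam%:E * \int[mu]_(x in Omega) (`|w x| `^ q)%:E)%E.
  by apply: cvgeZl.
rewrite -(cvg_lim (@ereal_hausdorff R) cl) -(cvg_lim (@ereal_hausdorff R) cg).
apply: lee_lim; [apply: cvgP cl|apply: cvgP cg|].
exact: nearW.
Qed.


Lemma Lq_scale (w : V -> R) c : measurable_fun Omega w ->
  (\int[mu]_(x in Omega) (`|w x * c| `^ q)%:E =
   (`|c| `^ q)%:E * \int[mu]_(x in Omega) (`|w x| `^ q)%:E)%E.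
Proof.
move=> mw; rewrite -ge0_integralZl//.
- by apply: eq_integral => x _; rewrite normrM powRM// EFinM muleC.
- by apply/measurable_EFinP; apply: measurable_powR_comp; exact: measurableT_comp.
Qed.

Lemma energy_scale (Dw : V -> V) c : measurable_fun Omega Dw ->
  energy Omega H (fun x => c *: Dw x) = ((`|c| `^ p)%:E * energy Omega H Dw)%E.
Proof.
move=> mDw; rewrite /energy -ge0_integralZl//.
- by apply: eq_integral => x _; rewrite hHhom EFinM.
- by apply/measurable_EFinP; exact: (measurable_H hHC1 mDw).
- by move=> x _; rewrite lee_fin.
Qed.

(** The number k is the L^q norm of u; its positivity lets all later exponents be added freely. *)
Lemma Lq_mass_pos : ~ {ae mu, forall x, Omega x -> u x = 0} ->
  exists2 k : R, 0 < k & (\int[mu]_(x in Omega) (`|u x| `^ q)%:E)%E = (k `^ q)%:E.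
Proof.
move=> hunt; have [meas_u _] := W01p_measurable Wu.
have iu := integrable_Lq oOmega Ofin hp husol (ltW q0) hqp.
have ifin := intg_fin mO iu.
set I := (\int[mu]_(x in Omega) _)%E in ifin *.
have I0 : (0 <= I)%E by apply: integral_ge0 => x _; rewrite lee_fin powR_ge0.
have Ipos : 0 < fine I.
  rewrite lt0r fine_ge0// andbT; apply/eqP => fI0; apply: hunt.
  have I00 : I = 0%E by rewrite -(fineK ifin) fI0.
  have mf : measurable_fun Omega (fun x => (`|u x| `^ q)%:E).
    by apply/measurable_EFinP; apply: measurable_powR_comp; exact: measurableT_comp.
  have [+ _] := ae_eq_integral_abs mu mO mf.
  have -> : (\int[mu]_(x in Omega) `|(`|u x| `^ q)%:E| = I)%E.
    by apply: eq_integral => x _; rewrite /= ger0_norm// powR_ge0.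
  move=> /(_ I00); apply: filterS => x + Ox => /(_ Ox)[] /powR_eq0_eq0 /eqP.
  by rewrite normr_eq0 => /eqP.
exists (fine I `^ q^-1); first exact: powR_gt0.
by rewrite -powRrM mulVf ?gt_eqF// powRr1 ?fineK// ltW.
Qed.

(** Apply [hidden_convexity] to k w, whose L^q norm is that of u. As the energy of u is lam k^q, its
    share (1 - q/p) cancels and leaves lam k^q <= k^p times the energy of w. *)
Lemma energy_lower_bound k w Dw : 0 < k ->
  (\int[mu]_(x in Omega) (`|u x| `^ q)%:E)%E = (k `^ q)%:E ->
  admissible Omega p q w Dw -> ((lam * k `^ (q - p))%:E <= energy Omega H Dw)%E.
Proof.
move=> k0 kE [W Lw]; have [mw mDw] := W01p_measurable W.
have [_ mDu] := W01p_measurable Wu.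
have w1 : (\int[mu]_(x in Omega) (`|w x| `^ q)%:E)%E = 1%E.
  have I0 : (0 <= \int[mu]_(x in Omega) (`|w x| `^ q)%:E)%E.
    by apply: integral_ge0 => x _; rewrite lee_fin powR_ge0.
  move: Lw; rewrite Lp_normE// => /(congr1 (fun t => t `^ q)%E).
  by rewrite -poweRrM mulVf ?gt_eqF// poweRe1// poweR1r.
have iw := integrable_H oOmega Ofin hp hH0 hHC1 hC hHbnd W.
have iu := integrable_H oOmega Ofin hp hH0 hHC1 hC hHbnd Wu.
have fw : energy Omega H Dw \is a fin_num := intg_fin mO iw.
have eu := energy_solution oOmega Ofin hp hq hH0 hHC1 hHconv hHhom hC hHbnd hu0 husol.
have Z c (F : V -> V) : 0 <= c -> measurable_fun Omega F ->
    (\int[mu]_(x in Omega) (c%:E * (H (F x))%:E) = c%:E * \int[mu]_(x in Omega) (H (F x))%:E)%E.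
  move=> c0 mF; apply: ge0_integralZl => //; last by move=> x _; rewrite lee_fin.
  by apply/measurable_EFinP; exact: (measurable_H hHC1 mF).
have [_ mkDw] := W01p_measurable (W01p_scale oOmega p0 k W).
have := hidden_convexity (W01p_scale oOmega p0 k W).
rewrite (Lq_scale _ mw) w1 mule1 gtr0_norm//.
under eq_integral do rewrite EFinD EFinM [X in (_ + X)%E]EFinM.
rewrite ge0_integralD//; first last.
- by apply: measurable_funeM; apply/measurable_EFinP; exact: (measurable_H hHC1 mDu).
- by move=> x _; rewrite mule_ge0// lee_fin.
- apply: measurable_funeM; apply/measurable_EFinP; exact: (measurable_H hHC1 mkDw).
- by move=> x _; rewrite mule_ge0// lee_fin.
rewrite !Z//.
have := energy_scale k mDw; rewrite /energy => ->; rewrite eu kE gtr0_norm//.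
rewrite -/(energy Omega H Dw) -(fineK fw) -!EFinM -EFinD !lee_fin => h.
have qpp : 0 < q / p by rewrite divr_gt0.
have {h} : lam * k `^ q <= k `^ p * fine (energy Omega H Dw).
  by rewrite -(ler_pM2l qpp); lra.
have kp : 0 < k `^ p by exact: powR_gt0.
rewrite (_ : k `^ q = k `^ p * k `^ (q - p)); last by rewrite -gt0_powRD// addrC subrK.
by rewrite mulrCA ler_pM2l.
Qed.

End minimality.

Theorem theorem5p1 (R : realType) (N : nat) (hN : (0 < N)%N)
    (Omega : set 'rV[R]_N)
    (hopen : open Omega) (hconn : connected Omega)
    (hfin : (lebesgue_rV R N Omega < +oo)%E)
    (p q : R) (hp : 1 < p) (hq : 1 < q) (hqp : q <= p)
    (H : 'rV[R]_N -> R)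
    (hH0 : forall z, 0 <= H z)
    (hHC1 : Ck 1 H)
    (hHconv : @convex_function R 'rV[R]_N setT H)
    (hHhom : p_homogeneous p H)
    (C : R) (hC : 1 <= C)
    (hHbnd : forall z, C^-1 * enorm z `^ p <= H z <= C * enorm z `^ p)
    (lam : R) (hlam : 0 < lam)
    (u : 'rV[R]_N -> R) (Du : 'rV[R]_N -> 'rV[R]_N)
    (hu0 : {ae lebesgue_rV R N, forall x, Omega x -> 0 <= u x})
    (hunt : ~ {ae lebesgue_rV R N, forall x, Omega x -> u x = 0})
    (husol : weak_solution Omega p q H lam u Du) :
  (lam%:E * (\int[lebesgue_rV R N]_(x in Omega) (`|u x| `^ q)%:E)
      `^ ((q - p) / q))%E = lambda_pq Omega p q H /\
  is_minimizer Omega p q H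
    (fun x => u x * (fine (Lp_norm Omega q u))^-1)
    (fun x => (fine (Lp_norm Omega q u))^-1 *: Du x).
Proof.
have p0 : 0 < p by exact: lt_trans hp.
have q0 : 0 < q by exact: lt_trans hq.
have Wu : W01p Omega p u Du by case: husol.
have [meas_u mDu] := W01p_measurable Wu.
have upos := solution_pos hopen hfin hp hH0 hHC1 hHconv hHhom hC hHbnd hlam hu0 husol hconn hunt.
have [k k0 kE] := Lq_mass_pos hopen hfin hp hq hqp husol hunt.
have nk : Lp_norm Omega q u = k%:E.
  by rewrite Lp_normE// kE poweR_EFin -powRrM mulfV ?gt_eqF// powRr1// ltW.
have kk : k `^ q * k^-1 `^ q = 1 by rewrite -powRM ?invr_ge0 ?(ltW k0)// mulfV ?gt_eqF// powR1.
have kN : k^-1 `^ p * k `^ q = k `^ (q - p).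
  by rewrite -powR_inv1 ?(ltW k0)// -powRrM mulN1r -gt0_powRD// addrC.
have adm : admissible Omega p q (fun x => u x * k^-1) (fun x => k^-1 *: Du x).
  split; first exact: W01p_scale.
  rewrite Lp_normE// (Lq_scale hopen q _ meas_u) kE gtr0_norm ?invr_gt0// -EFinM mulrC kk.
  by rewrite poweR1r.
(* Homogeneity gives the factor k^-p, and the energy of u is lam k^q. *)
have en : energy Omega H (fun x => k^-1 *: Du x) = (lam * k `^ (q - p))%:E.
  rewrite (energy_scale hopen hH0 hHC1 hHhom _ mDu).
  have := energy_solution hopen hfin hp hq hH0 hHC1 hHconv hHhom hC hHbnd hu0 husol.
  rewrite /energy => ->; rewrite kE gtr0_norm ?invr_gt0// -!EFinM mulrCA kN.
  by [].
(* The normalised solution is an admissible competitor whose energy is exactly the universal lower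
   bound. *)
have lE : lambda_pq Omega p q H = (lam * k `^ (q - p))%:E.
  apply/eqP; rewrite eq_le; apply/andP; split.
    apply: ge_ereal_inf; exists (energy Omega H (fun x => k^-1 *: Du x)); last by rewrite en.
    by exists ((fun x => u x * k^-1), (fun x => k^-1 *: Du x)).
  apply/ereal_infP => _ [[w Dw] /= adw <-].
  exact: (energy_lower_bound hopen hfin hp hq hqp hH0 hHC1 hHconv hHhom hC hHbnd hu0 husol upos k0 kE adw).
(* The mass k^q raised to (q - p)/q is k^(q-p). *)
rewrite kE nk lE poweR_EFin -powRrM mulrCA mulfV ?gt_eqF// mulr1; split; first by [].
by split => //; rewrite en lE.
Qed.
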